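(* Let $\mathfrak N$ be a finite-dimensional Hilbert space and let $\Theta$ be a nonconstant inner function in $\mathbf S^{qs}(\mathfrak N)$. Then $\Theta$ is rational and, relative to some orthonormal basis of $\mathfrak N$, $$\Theta(\lambda)={\rm diag}\Big(\frac{\lambda-a_1}{1-\lambda a_1},\dots,\frac{\lambda-a_m}{1-\lambda a_m},X\Big),$$ where $a_1,\dots,a_m\in(-1,1)$ (not necessarily distinct) and $X$ is a constant unitary matrix.
   Context: $\mathbf S^{qs}(\mathfrak N)$: all $\mathbf L(\mathfrak N)$-valued $\Theta$ on $\mathbb D$ with (S1) $W=\Theta-\Theta(0)$ an operator Herglotz–Nevanlinna function with holomorphic continuation to $\mathbb C\setminus((-\infty,-1]\cup[1,\infty))$; (S2) strong limits $W(\pm1)$ exist and $W(1)-W(-1)\le2I$; (S3) $\Theta(0)\in\mathbf B\big(-\tfrac{W(1)+W(-1)}2, I-\tfrac{W(1)-W(-1)}2\big)$, where $\mathbf B(S,R)=\{S+R^{1/2}XR^{1/2}: X$ contraction in $\mathbf L(\overline{\rm ran}\,R)\}$. $\Theta$ is inner if its a.e. boundary values on $\mathbb T$ satisfy $\Theta(\xi)^*\Theta(\xi)=I$. *)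

(* Defs.v *)
From Stdlib Require Import Reals List.
Open Scope R_scope.

Record Cplx := mkC { re : R; im : R }.

Definition RtoC (x : R) : Cplx := mkC x 0.
Definition C0 : Cplx := RtoC 0.
Definition C1 : Cplx := RtoC 1.
Definition Ci : Cplx := mkC 0 1.
Definition Cadd (z w : Cplx) : Cplx := mkC (re z + re w) (im z + im w).
Definition Copp (z : Cplx) : Cplx := mkC (- re z) (- im z).
Definition Csub (z w : Cplx) : Cplx := Cadd z (Copp w).
Definition Cmul (z w : Cplx) : Cplx :=
  mkC (re z * re w - im z * im w) (re z * im w + im z * re w).
Definition Cconj (z : Cplx) : Cplx := mkC (re z) (- im z).
Definition Cnorm2 (z : Cplx) : R := re z * re z + im z * im z.
Definition Cabs (z : Cplx) : R := sqrt (Cnorm2 z).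
Definition Cinv (z : Cplx) : Cplx := mkC (re z / Cnorm2 z) (- im z / Cnorm2 z).
Definition Cdiv (z w : Cplx) : Cplx := Cmul z (Cinv w).
Definition Cexpi (t : R) : Cplx := mkC (cos t) (sin t).

Definition inD (z : Cplx) : Prop := Cabs z < 1.

Definition in_slit (z : Cplx) : Prop :=
  ~ (im z = 0 /\ (re z <= -1 \/ 1 <= re z)).

Definition cdiff (f : Cplx -> Cplx) (z : Cplx) : Prop :=
  exists f' : Cplx, forall eps, eps > 0 -> exists delta, delta > 0 /\
    forall h : Cplx, 0 < Cabs h < delta ->
      Cabs (Csub (Cdiv (Csub (f (Cadd z h)) (f z)) h) f') < eps.

Fixpoint peval (p : list Cplx) (z : Cplx) : Cplx :=
  match p with
  | nil => C0
  | c :: p' => Cadd c (Cmul z (peval p' z))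
  end.

(** * n x n complex matrices, represented as functions on indices < n *)
Definition Mat := nat -> nat -> Cplx.
Definition Vec := nat -> Cplx.

Fixpoint csum (f : nat -> Cplx) (n : nat) : Cplx :=
  match n with
  | O => C0
  | S k => Cadd (csum f k) (f k)
  end.

Definition mI : Mat := fun i j => if Nat.eqb i j then C1 else C0.
Definition madd (A B : Mat) : Mat := fun i j => Cadd (A i j) (B i j).
Definition msub (A B : Mat) : Mat := fun i j => Csub (A i j) (B i j).
Definition mscale (c : Cplx) (A : Mat) : Mat := fun i j => Cmul c (A i j).
Definition mmul (n : nat) (A B : Mat) : Mat :=
  fun i j => csum (fun k => Cmul (A i k) (B k j)) n.
Definition adj (A : Mat) : Mat := fun i j => Cconj (A j i).
Definition mv (n : nat) (A : Mat) (v : Vec) : Vec :=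
  fun i => csum (fun k => Cmul (A i k) (v k)) n.
Definition inner (n : nat) (u v : Vec) : Cplx :=
  csum (fun k => Cmul (Cconj (u k)) (v k)) n.

Definition meq (n : nat) (A B : Mat) : Prop :=
  forall i j, (i < n)%nat -> (j < n)%nat -> A i j = B i j.

Definition psd (n : nat) (A : Mat) : Prop :=
  meq n A (adj A) /\ forall v : Vec, 0 <= re (inner n v (mv n A v)).

Definition mle (n : nat) (A B : Mat) : Prop := psd n (msub B A).

Definition unitary (n : nat) (U : Mat) : Prop :=
  meq n (mmul n (adj U) U) mI /\ meq n (mmul n U (adj U)) mI.

Definition contraction (n : nat) (X : Mat) : Prop :=
  forall v : Vec, re (inner n (mv n X v) (mv n X v)) <= re (inner n v v).

(** imaginary part  Im A = (A - A^* ) / (2i) *)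
Definition mImag (A : Mat) : Mat :=
  mscale (mkC 0 (- / 2)) (msub A (adj A)).

Definition mholo_on (n : nat) (Omega : Cplx -> Prop) (F : Cplx -> Mat) : Prop :=
  forall z, Omega z -> forall i j, (i < n)%nat -> (j < n)%nat ->
    cdiff (fun w => F w i j) z.

Definition herglotz_nevanlinna (n : nat) (W : Cplx -> Mat) : Prop :=
  mholo_on n (fun z => im z <> 0) W /\
  (forall z, im z <> 0 -> meq n (W (Cconj z)) (adj (W z))) /\
  (forall z, im z <> 0 -> psd n (mscale (RtoC (im z)) (mImag (W z)))).

Definition mlim_left (n : nat) (F : Cplx -> Mat) (x0 : R) (L : Mat) : Prop :=
  forall eps, eps > 0 -> exists delta, delta > 0 /\
    forall x : R, x0 - delta < x < x0 -> -1 < x < 1 ->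
      forall i j, (i < n)%nat -> (j < n)%nat ->
        Cabs (Csub (F (RtoC x) i j) (L i j)) < eps.
Definition mlim_right (n : nat) (F : Cplx -> Mat) (x0 : R) (L : Mat) : Prop :=
  forall eps, eps > 0 -> exists delta, delta > 0 /\
    forall x : R, x0 < x < x0 + delta -> -1 < x < 1 ->
      forall i j, (i < n)%nat -> (j < n)%nat ->
        Cabs (Csub (F (RtoC x) i j) (L i j)) < eps.

(** B(S,R) = { S + R^{1/2} X R^{1/2} : X contraction in L(ran R) },
    R^{1/2} being the nonnegative square root of R >= 0 *)
Definition in_ball (n : nat) (S Rm T : Mat) : Prop :=
  psd n Rm /\
  exists Q X : Mat, psd n Q /\ meq n (mmul n Q Q) Rm /\ contraction n X /\
    meq n T (madd S (mmul n Q (mmul n X Q))).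

Definition Sqs (n : nat) (Theta : Cplx -> Mat) : Prop :=
  exists W : Cplx -> Mat,
    (forall z, inD z -> meq n (W z) (msub (Theta z) (Theta C0))) /\
    herglotz_nevanlinna n W /\ mholo_on n in_slit W /\
    exists W1 Wm1 : Mat,
      mlim_left n W 1 W1 /\ mlim_right n W (-1) Wm1 /\
      mle n (msub W1 Wm1) (mscale (RtoC 2) mI) /\
      in_ball n (mscale (RtoC (- / 2)) (madd W1 Wm1))
                (msub mI (mscale (RtoC (/ 2)) (msub W1 Wm1)))
                (Theta C0).

Definition null_set (E : R -> Prop) : Prop :=
  forall eps, eps > 0 -> exists a b : nat -> R,
    (forall k, a k <= b k) /\
    (forall N, sum_f_R0 (fun k => b k - a k) N < eps) /\
    (forall t, E t -> exists k, a k < t < b k).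

Definition radial_limit (n : nat) (Theta : Cplx -> Mat) (xi : Cplx) (L : Mat) : Prop :=
  forall eps, eps > 0 -> exists delta, delta > 0 /\
    forall r : R, 1 - delta < r < 1 -> 0 <= r ->
      forall i j, (i < n)%nat -> (j < n)%nat ->
        Cabs (Csub (Theta (Cmul (RtoC r) xi) i j) (L i j)) < eps.

Definition inner_fn (n : nat) (Theta : Cplx -> Mat) : Prop :=
  null_set (fun t => 0 <= t < 2 * PI /\
    ~ (exists L : Mat, radial_limit n Theta (Cexpi t) L /\
                       meq n (mmul n (adj L) L) mI)).

Definition nonconstant_on_D (n : nat) (Theta : Cplx -> Mat) : Prop :=
  exists z1 z2, inD z1 /\ inD z2 /\ ~ meq n (Theta z1) (Theta z2).

Definition rational_on_D (n : nat) (Theta : Cplx -> Mat) : Prop :=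
  forall i j, (i < n)%nat -> (j < n)%nat ->
    exists p q : list Cplx,
      (forall z, inD z -> peval q z <> C0) /\
      (forall z, inD z -> Theta z i j = Cdiv (peval p z) (peval q z)).

Definition blaschke (a : R) (z : Cplx) : Cplx :=
  Cdiv (Csub z (RtoC a)) (Csub C1 (Cmul z (RtoC a))).

Definition diag_form (m : nat) (a : nat -> R) (X : Mat) (z : Cplx) : Mat :=
  fun i j =>
    if Nat.ltb i m then (if Nat.eqb i j then blaschke (a i) z else C0)
    else if Nat.ltb j m then C0 else X (i - m)%nat (j - m)%nat.

(* Main.v *)
(* Write [W = C + M] with [M] and [G] the half sum and half difference of the boundary values
   of [W] at [1] and [-1], so that [Theta = C + K] with [K = Q X Q] and [Q ^ 2 = 1 - G].  For a
   vector [v] the scalar function [<W v, v>] is a Herglotz function on the slit plane, and a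
   Phragmen-Lindelof argument in the strip coordinate [z = (e^s - 1) / (e^s + 1)] gives
   [|<C(z) v, v>| <= <G v, v>] on the closed disc; equality at [i] forces a multiple of a
   Blaschke factor.
   At [xi] on the circle off the real axis [Theta(xi)] is unitary, and an eigenvector [x] of
   [L = Theta(i)] with eigenvalue [l] must satisfy [|x|^2 = |<C x, x> + <K x, x>|
   <= <G x, x> + <(1 - G) x, x>] with equality.  Hence [C(i) = G L = L G] and [K = (1 - G) L].
   Unitarity at [-i] then makes [G] a projection: on its kernel [Theta] is the constant [L], and
   on its range every joint eigenvector of [G] and [L] is an eigenvector of [Theta(xi)] for all
   [xi], with a Blaschke factor as eigenvalue; the maximum principle carries this to the disc. *)

From mathcomp Require all_boot all_order all_algebra complex.
From mathcomp.algebra_tactics Require ring.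
From mathcomp.reals_stdlib Require Rstruct.
From Stdlib Require Import Reals List Lra Lia Classical ClassicalChoice.
From Coquelicot Require Import Coquelicot.
Require Import Defs.
Open Scope R_scope.

(** * Bisection and Goursat's theorem for closed forms *)

(** [cdiff] asks for a derivative at each point and says nothing of its continuity, so second
    derivatives of a holomorphic function are not at hand. Goursat's theorem supplies a potential,
    and the maximum principle drawn from it carries all the analysis; no power series and no Cauchy
    formula occur. The strip coordinate [s] sends [1] and [-1] to infinity, where boundedness stands
    in for boundary values. With [Z = (w - p) / (q - w)] the Herglotz property becomes
    [arg Z <= im s] on the upper half of the strip: [Z] is positive on the real axis and
    [arg Z <= PI] near the top edge. The upper half of the disc is [0 < im s < PI / 2], so there [Z]
    lies in the right half-plane, that is, [w] lies in the disc with diameter [[p, q]]. Unitarity at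
    [-i] forces [G] to be a projection for this reason: if [l] and [g] are eigenvalues of [L] and
    [G] at a common eigenvector, then [g] times the conjugate of [l], plus [(1 - g) l], has modulus
    one, hence [g] is [0] or [1] unless [l ^ 2 = 1]. That exception lies in the kernel of [G],
    because a Blaschke factor with a real zero is never real at [i]. *)

Lemma nested_intervals (a b : nat -> R) :
  (forall k, a k <= a (S k)) -> (forall k, b (S k) <= b k) ->
  (forall k, a k <= b k) ->
  exists x, forall k, a k <= x <= b k.
Proof.
intros ha hb hab.
assert (ma : forall j k, (j <= k)%nat -> a j <= a k).
{ intros j k; induction 1 as [|k _ IH]; [lra | specialize (ha k); lra]. }
assert (mb : forall j k, (j <= k)%nat -> b k <= b j).
{ intros j k; induction 1 as [|k _ IH]; [lra | specialize (hb k); lra]. }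
assert (mab : forall j k, a j <= b k).
{ intros j k; pose proof (ma j (max j k) ltac:(lia));
  pose proof (mb k (max j k) ltac:(lia)); specialize (hab (max j k)); lra. }
destruct (completeness (fun t => exists k, t = a k)) as [x [ub lub]].
- exists (b 0%nat); intros t [k ->]; apply mab.
- exists (a 0%nat), 0%nat; reflexivity.
- exists x; intros k; split.
  + apply ub; exists k; reflexivity.
  + apply lub; intros t [j ->]; apply mab.
Qed.

(** One bisection serves three compactness arguments: [dominating] gives the extreme value theorem,
    [large] gives Goursat, and rectangles of height zero give the covering argument for null
    sets. *)
Lemma rectangle_bisection (P : R -> R -> R -> R -> Prop) (a b c d : R) :
  (forall a b c d, a <= b -> c <= d -> P a b c d ->
    let m := (a + b) / 2 in let n := (c + d) / 2 in
    P a m c n \/ P m b c n \/ P a m n d \/ P m b n d) ->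
  a <= b -> c <= d -> P a b c d ->
  exists x y, forall delta, 0 < delta ->
    exists a' b' c' d', a <= a' <= x /\ x <= b' <= b /\ c <= c' <= y /\ y <= d' <= d /\
      b' - a' < delta /\ d' - c' < delta /\ P a' b' c' d'.
Proof.
intros split hab hcd hP.
pose (good := fun q : R * R * R * R => let '(a, b, c, d) := q in
  a <= b /\ c <= d /\ P a b c d).
pose (next := fun q q' : R * R * R * R =>
  let '(a, b, c, d) := q in let '(a', b', c', d') := q' in
  good q -> good q' /\ a <= a' /\ b' <= b /\ c <= c' /\ d' <= d /\
    b' - a' = (b - a) / 2 /\ d' - c' = (d - c) / 2).
destruct (choice next) as [step hstep].
{ intros [[[a0 b0] c0] d0].
  destruct (classic (good (a0, b0, c0, d0))) as [[h1 [h2 h3]]|hn].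
  - specialize (split a0 b0 c0 d0 h1 h2 h3).
    destruct split as [h|[h|[h|h]]];
    [exists (a0, (a0 + b0) / 2, c0, (c0 + d0) / 2)
    |exists ((a0 + b0) / 2, b0, c0, (c0 + d0) / 2)
    |exists (a0, (a0 + b0) / 2, (c0 + d0) / 2, d0)
    |exists ((a0 + b0) / 2, b0, (c0 + d0) / 2, d0)];
    intros _; unfold good; repeat split; try assumption; lra.
  (* [next] is vacuous on bad rectangles, which makes [step] total; any value would do here. *)
  - exists (a0, b0, c0, d0); intros h; contradiction. }
pose (q := fun k => Nat.iter k step (a, b, c, d)).
assert (hq : forall k, good (q k)).
{ induction k as [|k IH]; [repeat split; assumption|].
  pose proof (hstep (q k)) as h; change (q (S k)) with (step (q k)).
  unfold next in h; destruct (q k) as [[[? ?] ?] ?], (step _) as [[[? ?] ?] ?]; apply h, IH. }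
pose (fa := fun k => fst (fst (fst (q k)))); pose (fb := fun k => snd (fst (fst (q k)))).
pose (fc := fun k => snd (fst (q k))); pose (fd := fun k => snd (q k)).
assert (hgood : forall k, fa k <= fb k /\ fc k <= fd k /\ P (fa k) (fb k) (fc k) (fd k)).
{ intros k; specialize (hq k); unfold fa, fb, fc, fd.
  destruct (q k) as [[[? ?] ?] ?]; exact hq. }
assert (hnext : forall k, fa k <= fa (S k) /\ fb (S k) <= fb k /\
   fc k <= fc (S k) /\ fd (S k) <= fd k /\ fb (S k) - fa (S k) = (fb k - fa k) / 2 /\
   fd (S k) - fc (S k) = (fd k - fc k) / 2).
{ intros k; pose proof (hq k) as g; pose proof (hstep (q k)) as h.
  unfold fa, fb, fc, fd; change (q (S k)) with (step (q k)).
  unfold next in h; destruct (q k) as [[[? ?] ?] ?], (step _) as [[[? ?] ?] ?].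
  apply h in g; simpl; tauto. }
destruct (nested_intervals fa fb) as [x hx]; try (intros k; apply hnext || apply hgood).
destruct (nested_intervals fc fd) as [y hy]; try (intros k; apply hnext || apply hgood).
assert (hlen : forall k, fb k - fa k = (b - a) * (/ 2) ^ k /\
                         fd k - fc k = (d - c) * (/ 2) ^ k).
{ induction k as [|k IH]; [unfold fa, fb, fc, fd; simpl; lra|].
  specialize (hnext k); simpl; lra. }
assert (hin : forall k, a <= fa k /\ fb k <= b /\ c <= fc k /\ fd k <= d).
{ induction k as [|k IH]; [unfold fa, fb, fc, fd; simpl; lra|].
  specialize (hnext k); lra. }
exists x, y; intros delta hd.
destruct (pow_lt_1_zero (/ 2) ltac:(rewrite Rabs_pos_eq; lra)
  (delta / ((b - a) + (d - c) + 1)) ltac:(apply Rdiv_lt_0_compat; lra)) as [N hN].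
specialize (hN N (le_n N)).
assert (0 < (/ 2) ^ N) by (apply pow_lt; lra).
rewrite Rabs_pos_eq in hN by lra.
apply (Rmult_lt_compat_r ((b - a) + (d - c) + 1)) in hN; [|lra].
unfold Rdiv in hN; rewrite Rmult_assoc, Rinv_l, Rmult_1_r in hN by lra.
exists (fa N), (fb N), (fc N), (fd N).
specialize (hx N); specialize (hy N); specialize (hin N); specialize (hlen N).
repeat split; try lra; try apply hgood; nra.
Qed.

(** A subrectangle dominates if every value of [f] is matched inside it. If no quarter dominated,
    each would be beaten by some point, and the best of these four points would beat the whole. At
    the limit point a larger value elsewhere would contradict continuity. *)
Lemma rectangle_max (f : R -> R -> R) (a b c d : R) :
  a <= b -> c <= d ->
  (forall x y, a <= x <= b -> c <= y <= d -> continuity_2d_pt f x y) ->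
  exists x y, a <= x <= b /\ c <= y <= d /\
    forall x' y', a <= x' <= b -> c <= y' <= d -> f x' y' <= f x y.
Proof.
intros hab hcd cont.
pose (dominating := fun a' b' c' d' => forall x y, a <= x <= b -> c <= y <= d ->
  exists x' y', a' <= x' <= b' /\ c' <= y' <= d' /\ f x y <= f x' y').
destruct (rectangle_bisection dominating a b c d) as [x [y hxy]]; trivial.
- intros a1 b1 c1 d1 h1 h2 dom m n.
  apply NNPP; intros hn.
  assert (beat : forall p q r s, ~ dominating p q r s ->
    exists x y, a <= x <= b /\ c <= y <= d /\
      forall x' y', p <= x' <= q -> r <= y' <= s -> f x' y' < f x y).
  { intros p q r s h; apply NNPP; intros h'; apply h; intros x y hx hy.
    apply NNPP; intros h''; apply h'; exists x, y; repeat split; try tauto.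
    intros x' y' hx' hy'; destruct (Rlt_le_dec (f x' y') (f x y)); trivial.
    exfalso; apply h''; exists x', y'; tauto. }
  destruct (beat a1 m c1 n) as [x1 [y1 [u1 [v1 w1]]]]; [tauto|].
  destruct (beat m b1 c1 n) as [x2 [y2 [u2 [v2 w2]]]]; [tauto|].
  destruct (beat a1 m n d1) as [x3 [y3 [u3 [v3 w3]]]]; [tauto|].
  destruct (beat m b1 n d1) as [x4 [y4 [u4 [v4 w4]]]]; [tauto|].
  assert (top : exists x y, a <= x <= b /\ c <= y <= d /\
    f x1 y1 <= f x y /\ f x2 y2 <= f x y /\ f x3 y3 <= f x y /\ f x4 y4 <= f x y).
  { assert (two : forall p q p' q', a <= p <= b -> c <= q <= d -> a <= p' <= b -> c <= q' <= d ->
       exists x y, a <= x <= b /\ c <= y <= d /\ f p q <= f x y /\ f p' q' <= f x y).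
    { intros p q p' q' ? ? ? ?; destruct (Rle_dec (f p q) (f p' q'));
      [exists p', q'|exists p, q]; repeat split; lra. }
    destruct (two x1 y1 x2 y2) as [x5 [y5 [? [? [? ?]]]]]; trivial.
    destruct (two x3 y3 x4 y4) as [x6 [y6 [? [? [? ?]]]]]; trivial.
    destruct (two x5 y5 x6 y6) as [x7 [y7 [? [? [? ?]]]]]; trivial.
    exists x7, y7; repeat split; lra. }
  destruct top as [x [y [hx [hy [t1 [t2 [t3 t4]]]]]]].
  destruct (dom x y hx hy) as [x' [y' [hx' [hy' le]]]].
  destruct (Rle_dec x' m), (Rle_dec y' n);
  [specialize (w1 x' y' ltac:(lra) ltac:(lra))
  |specialize (w3 x' y' ltac:(lra) ltac:(lra))
  |specialize (w2 x' y' ltac:(lra) ltac:(lra))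
  |specialize (w4 x' y' ltac:(lra) ltac:(lra))]; lra.
- intros x y hx hy; exists x, y; repeat split; lra.
- assert (hx : a <= x <= b /\ c <= y <= d).
  { destruct (hxy 1 Rlt_0_1) as [? [? [? [? h]]]]; lra. }
  exists x, y; repeat split; try tauto; intros x' y' hx' hy'.
  apply Rnot_lt_le; intros lt.
  destruct (cont x y (proj1 hx) (proj2 hx) (mkposreal (f x' y' - f x y) ltac:(lra)))
    as [delta hdelta]; simpl in hdelta.
  destruct (hxy delta (cond_pos delta)) as [a1 [b1 [c1 [d1 [? [? [? [? [? [? dom]]]]]]]]]].
  destruct (dom x' y' hx' hy') as [u [v [? [? le]]]].
  specialize (hdelta u v ltac:(apply Rabs_def1; lra) ltac:(apply Rabs_def1; lra)).
  apply Rabs_def2 in hdelta; lra.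
Qed.

(** For the form [P dx + Q dy] the shared coefficient [q] is the closedness condition [P_y = Q_x],
    required at the point alone and without continuity of the derivatives. *)
Definition closed_form_at (P Q : R -> R -> R) (x y : R) : Prop :=
  exists p q r, differentiable_pt_lim P x y p q /\ differentiable_pt_lim Q x y q r.

(** The integral of [P dx + Q dy] counterclockwise around the rectangle, opposite sides paired. *)
Definition loop_integral (P Q : R -> R -> R) (a b c d : R) : R :=
  RInt (fun t => P t c - P t d) a b + RInt (fun t => Q b t - Q a t) c d.

Lemma continuous_section_l (f : R -> R -> R) (x y : R) :
  continuity_2d_pt f x y -> continuous (fun t => f t y) x.
Proof.
intros h; apply continuity_pt_filterlim; intros eps he.
destruct (h (mkposreal eps he)) as [delta hd]; exists delta; split; [apply cond_pos|].
intros t [_ ht]; apply hd; [exact ht|rewrite Rminus_diag, Rabs_R0; apply cond_pos].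
Qed.

Lemma continuous_section_r (f : R -> R -> R) (x y : R) :
  continuity_2d_pt f x y -> continuous (fun t => f x t) y.
Proof.
intros h; apply continuity_pt_filterlim; intros eps he.
destruct (h (mkposreal eps he)) as [delta hd]; exists delta; split; [apply cond_pos|].
intros t [_ ht]; apply hd; [rewrite Rminus_diag, Rabs_R0; apply cond_pos|exact ht].
Qed.

Lemma differentiable_pt_lim_continuity (f : R -> R -> R) (x y p q : R) :
  differentiable_pt_lim f x y p q -> continuity_2d_pt f x y.
Proof. intros h; apply differentiable_continuity_pt; exists p, q; exact h. Qed.

Lemma ex_RInt_between (f : R -> R) (a b : R) : a <= b ->
  (forall t, a <= t <= b -> continuous f t) -> ex_RInt f a b.
Proof.
intros h cont; apply @ex_RInt_continuous.
rewrite Rmin_left, Rmax_right by exact h; exact cont.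
Qed.

Lemma loop_integral_split (P Q : R -> R -> R) (a m b c n d : R) :
  a <= m <= b -> c <= n <= d ->
  (forall x y, a <= x <= b -> c <= y <= d ->
     continuity_2d_pt P x y /\ continuity_2d_pt Q x y) ->
  loop_integral P Q a b c d =
    loop_integral P Q a m c n + loop_integral P Q m b c n +
    (loop_integral P Q a m n d + loop_integral P Q m b n d).
Proof.
intros hm hn cont.
assert (eP : forall x x' y, a <= x -> x <= x' -> x' <= b -> c <= y <= d ->
  ex_RInt (fun t => P t y) x x').
{ intros; apply ex_RInt_between; trivial.
  intros; apply continuous_section_l, cont; lra. }
assert (eQ : forall x y y', a <= x <= b -> c <= y -> y <= y' -> y' <= d ->
  ex_RInt (fun t => Q x t) y y').
{ intros; apply ex_RInt_between; trivial.
  intros; apply continuous_section_r, cont; lra. }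
assert (sP : forall x x' y y', a <= x -> x <= x' -> x' <= b -> c <= y <= d -> c <= y' <= d ->
  RInt (fun t => P t y - P t y') x x' = RInt (fun t => P t y) x x' - RInt (fun t => P t y') x x').
{ intros; apply @RInt_minus; apply eP; lra. }
assert (sQ : forall x x' y y', a <= x <= b -> a <= x' <= b -> c <= y -> y <= y' -> y' <= d ->
  RInt (fun t => Q x t - Q x' t) y y' = RInt (fun t => Q x t) y y' - RInt (fun t => Q x' t) y y').
{ intros; apply @RInt_minus; apply eQ; lra. }
unfold loop_integral.
rewrite !sP, !sQ by lra.
assert (cP : forall y, c <= y <= d -> RInt (fun t => P t y) a b =
  RInt (fun t => P t y) a m + RInt (fun t => P t y) m b).
{ intros y hy; symmetry; apply @RInt_Chasles; apply eP; lra. }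
assert (cQ : forall x, a <= x <= b -> RInt (fun t => Q x t) c d =
  RInt (fun t => Q x t) c n + RInt (fun t => Q x t) n d).
{ intros x hx; symmetry; apply @RInt_Chasles; apply eQ; lra. }
rewrite !cP, !cQ by lra; ring.
Qed.

(** The linear parts of [P] and [Q] contribute [(b - a) q (c - d)] and [(d - c) q (b - a)], which
    cancel by closedness. Only the differentiability remainders are left, [eps / 2] for each of the
    two opposite sides. *)
Lemma loop_integral_small (P Q : R -> R -> R) (x y : R) (eps : R) :
  0 < eps -> closed_form_at P Q x y ->
  exists delta, 0 < delta /\ forall a b c d,
    a <= x <= b -> c <= y <= d -> b - a < delta -> d - c < delta ->
    (forall s t, a <= s <= b -> c <= t <= d ->
       continuity_2d_pt P s t /\ continuity_2d_pt Q s t) ->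
    Rabs (loop_integral P Q a b c d) <= eps * ((b - a) + (d - c)) ^ 2.
Proof.
intros he [p [q [r [hP hQ]]]].
destruct (hP (mkposreal (eps / 2) ltac:(lra))) as [d1 h1].
destruct (hQ (mkposreal (eps / 2) ltac:(lra))) as [d2 h2]; simpl in h1, h2.
exists (Rmin d1 d2); split; [apply Rmin_glb_lt; apply cond_pos|].
intros a b c d hx hy hab hcd cont.
pose proof (Rmin_l d1 d2); pose proof (Rmin_r d1 d2).
set (l := (b - a) + (d - c)) in *.
assert (near : forall s t, a <= s <= b -> c <= t <= d ->
  Rmax (Rabs (s - x)) (Rabs (t - y)) <= l /\ Rabs (s - x) < Rmin d1 d2 /\
  Rabs (t - y) < Rmin d1 d2).
{ intros s t hs ht; unfold l; repeat split; [apply Rmax_lub; apply Rabs_le| |];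
  try apply Rabs_def1; lra. }
assert (bP : forall s t, a <= s <= b -> c <= t <= d ->
   Rabs (P s t - P x y - (p * (s - x) + q * (t - y))) <= eps / 2 * l).
{ intros s t hs ht; destruct (near s t hs ht) as [n1 [n2 n3]].
  eapply Rle_trans; [apply h1; lra|apply Rmult_le_compat_l; lra]. }
assert (bQ : forall s t, a <= s <= b -> c <= t <= d ->
   Rabs (Q s t - Q x y - (q * (s - x) + r * (t - y))) <= eps / 2 * l).
{ intros s t hs ht; destruct (near s t hs ht) as [n1 [n2 n3]].
  eapply Rle_trans; [apply h2; lra|apply Rmult_le_compat_l; lra]. }
assert (iP : Rabs (RInt (fun t => P t c - P t d) a b - (b - a) * (q * (c - d))) <= (b - a) * (eps * l)).
{ assert (e : ex_RInt (fun t => P t c - P t d) a b).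
  { apply ex_RInt_between; [lra|]; intros t ht; apply (@continuous_minus _ R_AbsRing R_NormedModule);
    apply (continuous_section_l P), cont; lra. }
  replace (RInt (fun t => P t c - P t d) a b - (b - a) * (q * (c - d)))
    with (RInt (fun t => minus (P t c - P t d) (q * (c - d))) a b).
  2: { etransitivity; [apply (@RInt_minus R_CompleteNormedModule); [exact e|apply ex_RInt_const]|].
       rewrite RInt_const; reflexivity. }
  apply abs_RInt_le_const; [lra|apply @ex_RInt_minus; [exact e|apply ex_RInt_const]|].
  intros t ht; unfold minus, plus, opp; simpl.
  pose proof (bP t c ltac:(lra) ltac:(lra)) as u1; pose proof (bP t d ltac:(lra) ltac:(lra)) as u2.
  apply Rabs_le_between in u1; apply Rabs_le_between in u2; apply Rabs_le_between; lra. }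
assert (iQ : Rabs (RInt (fun t => Q b t - Q a t) c d - (d - c) * (q * (b - a))) <= (d - c) * (eps * l)).
{ assert (e : ex_RInt (fun t => Q b t - Q a t) c d).
  { apply ex_RInt_between; [lra|]; intros t ht; apply (@continuous_minus _ R_AbsRing R_NormedModule);
    apply (continuous_section_r Q), cont; lra. }
  replace (RInt (fun t => Q b t - Q a t) c d - (d - c) * (q * (b - a)))
    with (RInt (fun t => minus (Q b t - Q a t) (q * (b - a))) c d).
  2: { etransitivity; [apply (@RInt_minus R_CompleteNormedModule); [exact e|apply ex_RInt_const]|].
       rewrite RInt_const; reflexivity. }
  apply abs_RInt_le_const; [lra|apply @ex_RInt_minus; [exact e|apply ex_RInt_const]|].
  intros t ht; unfold minus, plus, opp; simpl.
  pose proof (bQ b t ltac:(lra) ltac:(lra)) as u1; pose proof (bQ a t ltac:(lra) ltac:(lra)) as u2.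
  apply Rabs_le_between in u1; apply Rabs_le_between in u2; apply Rabs_le_between; lra. }
unfold loop_integral.
apply Rabs_le_between in iP; apply Rabs_le_between in iQ; apply Rabs_le_between.
replace (eps * l ^ 2) with ((b - a) * (eps * l) + (d - c) * (eps * l)) by (unfold l; ring).
split; lra.
Qed.

(** A quarter has a quarter of the squared half-perimeter, so the ratio of the integral to that
    square stays at least [kappa] in one of the quarters. Near the limit point [loop_integral_small]
    makes this ratio at most [kappa / 2]. *)
Lemma goursat (P Q : R -> R -> R) (a b c d : R) : a <= b -> c <= d ->
  (forall x y, a <= x <= b -> c <= y <= d -> closed_form_at P Q x y) ->
  loop_integral P Q a b c d = 0.
Proof.
intros hab hcd closed.
assert (cont : forall x y, a <= x <= b -> c <= y <= d ->
  continuity_2d_pt P x y /\ continuity_2d_pt Q x y).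
{ intros x y hx hy; destruct (closed x y hx hy) as [p [q [r [h1 h2]]]].
  split; eapply differentiable_pt_lim_continuity; eassumption. }
apply NNPP; intros hne.
assert (hpos : 0 < Rabs (loop_integral P Q a b c d)) by (apply Rabs_pos_lt; exact hne).
destruct (Req_dec (b - a + (d - c)) 0) as [z|hl].
{ apply hne; assert (b = a) by lra; assert (d = c) by lra; subst.
  unfold loop_integral; rewrite !RInt_point; unfold zero; simpl; ring. }
assert (hl2 : 0 < (b - a + (d - c)) ^ 2) by (apply pow_lt; lra).
set (kappa := Rabs (loop_integral P Q a b c d) / (b - a + (d - c)) ^ 2).
assert (hk : 0 < kappa) by (apply Rdiv_lt_0_compat; lra).
(* The positive half-perimeter, preserved by halving, makes the final comparison of [kappa] with
   [kappa / 2] a contradiction. *)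
pose (large := fun a' b' c' d' => 0 < b' - a' + (d' - c') /\ a <= a' /\ b' <= b /\ c <= c' /\ d' <= d /\
  kappa * (b' - a' + (d' - c')) ^ 2 <= Rabs (loop_integral P Q a' b' c' d')).
destruct (rectangle_bisection large a b c d) as [x [y hxy]]; trivial.
- intros a' b' c' d' hab' hcd' [l0 [l1 [l2 [l3 [l4 l5]]]]] m n.
  assert (a' <= m <= b') by (unfold m; lra). assert (c' <= n <= d') by (unfold n; lra).
  rewrite (loop_integral_split P Q a' m b' c' n d') in l5; trivial;
    [|intros; apply cont; lra].
  apply NNPP; intros hn.
  assert (q : forall a1 b1 c1 d1, ~ large a1 b1 c1 d1 -> a' <= a1 -> b1 <= b' -> c' <= c1 -> d1 <= d' ->
    b1 - a1 + (d1 - c1) = (b' - a' + (d' - c')) / 2 ->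
    Rabs (loop_integral P Q a1 b1 c1 d1) < kappa * (b' - a' + (d' - c')) ^ 2 / 4).
  { intros a1 b1 c1 d1 h ? ? ? ? e; apply Rnot_le_lt; intros le; apply h.
    unfold large; rewrite e; repeat split; lra. }
  assert (half1 : m - a' = (b' - a') / 2 /\ b' - m = (b' - a') / 2) by (unfold m; lra).
  assert (half2 : n - c' = (d' - c') / 2 /\ d' - n = (d' - c') / 2) by (unfold n; lra).
  pose proof (q a' m c' n ltac:(tauto) ltac:(lra) ltac:(lra) ltac:(lra) ltac:(lra) ltac:(lra)) as q1.
  pose proof (q m b' c' n ltac:(tauto) ltac:(lra) ltac:(lra) ltac:(lra) ltac:(lra) ltac:(lra)) as q2.
  pose proof (q a' m n d' ltac:(tauto) ltac:(lra) ltac:(lra) ltac:(lra) ltac:(lra) ltac:(lra)) as q3.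
  pose proof (q m b' n d' ltac:(tauto) ltac:(lra) ltac:(lra) ltac:(lra) ltac:(lra) ltac:(lra)) as q4.
  apply Rabs_def2 in q1; apply Rabs_def2 in q2; apply Rabs_def2 in q3; apply Rabs_def2 in q4.
  apply Rle_not_lt in l5; apply l5, Rabs_def1; lra.
- repeat split; try lra; unfold kappa; right; field; lra.
- assert (hx : a <= x <= b /\ c <= y <= d).
  { destruct (hxy 1 Rlt_0_1) as [? [? [? [? h]]]]; lra. }
  destruct (loop_integral_small P Q x y (kappa / 2) ltac:(lra) (closed x y (proj1 hx) (proj2 hx)))
    as [delta [hd small]].
  destruct (hxy (Rmin delta (b - a + (d - c))) ltac:(apply Rmin_glb_lt; lra))
    as [a' [b' [c' [d' h]]]].
  destruct h as [h1 [h2 [h3 [h4 [h5 [h6 [pos [_ [_ [_ [_ big]]]]]]]]]]].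
  pose proof (Rmin_l delta (b - a + (d - c))).
  assert (small' : Rabs (loop_integral P Q a' b' c' d') <= kappa / 2 * (b' - a' + (d' - c')) ^ 2).
  { apply small; try lra; intros; apply cont; lra. }
  assert (0 < (b' - a' + (d' - c')) ^ 2) by (apply pow_lt; lra); nra.
Qed.

(** * The maximum principle *)

(** The derivative of [u + i v] is [a + i b]; sharing the two coefficients expresses the
    Cauchy-Riemann equations. *)
Definition hol (u v : R -> R -> R) (x y : R) : Prop :=
  exists a b, differentiable_pt_lim u x y a (- b) /\ differentiable_pt_lim v x y b a.

Lemma differentiable_pt_lim_derive_l (f : R -> R -> R) (x y p q : R) :
  differentiable_pt_lim f x y p q -> is_derive (fun t => f t y) x p.
Proof.
intros h; apply is_derive_Reals.
replace p with (p * 1 + q * 0) by ring.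
apply (derivable_pt_lim_comp_2d f (fun t => t) (fun _ => y)); trivial.
- apply derivable_pt_lim_id.
- apply derivable_pt_lim_const.
Qed.

Lemma differentiable_pt_lim_derive_r (f : R -> R -> R) (x y p q : R) :
  differentiable_pt_lim f x y p q -> is_derive (fun t => f x t) y q.
Proof.
intros h; apply is_derive_Reals.
replace q with (p * 0 + q * 1) by ring.
apply (derivable_pt_lim_comp_2d f (fun _ => x) (fun t => t)); trivial.
- apply derivable_pt_lim_const.
- apply derivable_pt_lim_id.
Qed.

Lemma hol_continuity (u v : R -> R -> R) (x y : R) : hol u v x y ->
  continuity_2d_pt u x y /\ continuity_2d_pt v x y.
Proof.
intros [a [b [h1 h2]]]; split; eapply differentiable_pt_lim_continuity; eassumption.
Qed.

(** Were [r] positive, [f'] would be positive just to the right of its zero [x0], and the mean value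
    theorem would lift [f] above its maximum. *)
Lemma second_derivative_at_max (f f' : R -> R) (r x0 delta : R) : 0 < delta ->
  (forall t, Rabs (t - x0) < delta -> is_derive f t (f' t)) ->
  is_derive f' x0 r ->
  (forall t, Rabs (t - x0) < delta -> f t <= f x0) -> r <= 0.
Proof.
intros hd df ddf max; apply Rnot_lt_le; intros hr.
assert (crit : f' x0 = 0).
{ assert (d0 : is_derive f x0 (f' x0)) by (apply df; rewrite Rminus_diag, Rabs_R0; exact hd).
  apply is_derive_Reals in d0.
  pose (pr := exist _ (f' x0) d0 : derivable_pt f x0).
  change (f' x0) with (derive_pt f x0 pr).
  apply (deriv_maximum f (x0 - delta) (x0 + delta) x0 pr); try lra.
  intros t ? ?; apply max, Rabs_def1; lra. }
apply is_derive_Reals in ddf.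
destruct (ddf (r / 2) ltac:(lra)) as [e he].
pose (h := Rmin (e / 2) (delta / 2)).
assert (hh : 0 < h /\ h < e /\ h < delta).
{ pose proof (cond_pos e); unfold h; repeat split; [apply Rmin_glb_lt; lra| |];
  [pose proof (Rmin_l (e / 2) (delta / 2))|pose proof (Rmin_r (e / 2) (delta / 2))]; lra. }
assert (pos : forall t, 0 < t <= h -> 0 < f' (x0 + t)).
{ intros t ht; specialize (he t ltac:(lra) ltac:(rewrite Rabs_pos_eq; lra)).
  rewrite crit, Rminus_0_r in he; apply Rabs_def2 in he.
  assert (f' (x0 + t) = f' (x0 + t) / t * t) as -> by (field; lra).
  apply Rmult_lt_0_compat; lra. }
destruct (MVT_cor2 f f' x0 (x0 + h) ltac:(lra)) as [c [eq hc]].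
{ intros c hc; apply is_derive_Reals, df; rewrite Rabs_pos_eq; lra. }
specialize (pos (c - x0) ltac:(lra)); replace (x0 + (c - x0)) with c in pos by ring.
specialize (max (x0 + h) ltac:(rewrite Rabs_pos_eq; lra)).
assert (0 < f' c * (x0 + h - x0)) by (apply Rmult_lt_0_compat; lra); lra.
Qed.

Definition on_boundary (a b c d x y : R) : Prop :=
  a <= x <= b /\ c <= y <= d /\ (x = a \/ x = b \/ y = c \/ y = d).

(** Harmonicity enters only as opposite pure second derivatives [r] and [- r]. Adding [eps x ^ 2]
    makes their sum strictly positive, which excludes an interior maximum. *)
Lemma harmonic_max (g gx gy : R -> R -> R) (a b c d m : R) :
  (forall x y, a <= x <= b -> c <= y <= d -> continuity_2d_pt g x y) ->
  (forall x y, a < x < b -> c < y < d ->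
     is_derive (fun t => g t y) x (gx x y) /\ is_derive (fun t => g x t) y (gy x y) /\
     exists r, is_derive (fun t => gx t y) x r /\ is_derive (fun t => gy x t) y (- r)) ->
  (forall x y, on_boundary a b c d x y -> g x y <= m) ->
  forall x y, a <= x <= b -> c <= y <= d -> g x y <= m.
Proof.
intros cont harm bdry x y hx hy.
set (B := a ^ 2 + b ^ 2 + 1).
assert (hB : 0 < B) by (unfold B; nra).
assert (sq : forall t, a <= t <= b -> t ^ 2 <= B) by (intros t ht; unfold B; destruct (Rle_dec 0 t); nra).
apply Rnot_lt_le; intros lt.
(* [eps * B] is half the excess over [m], so the perturbation cannot lift a boundary value up to the
   perturbed maximum. *)
set (eps := (g x y - m) / (2 * B)).
assert (he : 0 < eps) by (apply Rdiv_lt_0_compat; lra).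
destruct (rectangle_max (fun x y => g x y + eps * x ^ 2) a b c d) as [x0 [y0 [hx0 [hy0 max]]]];
  try lra.
{ intros s t hs ht; apply continuity_2d_pt_plus; [apply cont; trivial|].
  apply (continuity_1d_2d_pt_comp (fun z => eps * z ^ 2) (fun u _ => u)).
  - apply derivable_continuous_pt; reg.
  - apply continuity_2d_pt_id1. }
assert (big : m + eps * B < g x0 y0 + eps * x0 ^ 2).
{ specialize (max x y hx hy).
  assert (eps * B = (g x y - m) / 2) by (unfold eps; field; lra).
  assert (0 <= eps * x ^ 2) by (apply Rmult_le_pos; [lra|apply pow2_ge_0]); lra. }
destruct (classic (on_boundary a b c d x0 y0)) as [hb|hb].
- specialize (bdry x0 y0 hb); specialize (sq x0 hx0); nra.
- assert (hx1 : a < x0 < b /\ c < y0 < d).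
  { unfold on_boundary in hb; repeat split;
    apply Rnot_le_lt; intros h; apply hb; repeat split; try tauto;
    [left|right; left|right; right; left|right; right; right]; lra. }
  destruct (harm x0 y0 (proj1 hx1) (proj2 hx1)) as [_ [_ [r [d1 d2]]]].
  set (delta := Rmin (Rmin (x0 - a) (b - x0)) (Rmin (y0 - c) (d - y0))).
  assert (hdelta : 0 < delta /\ delta <= x0 - a /\ delta <= b - x0 /\ delta <= y0 - c /\ delta <= d - y0).
  { unfold delta; repeat split; try (repeat apply Rmin_glb_lt; lra);
    unfold Rmin; repeat destruct Rle_dec; lra. }
  assert (r + eps * 2 <= 0).
  { apply (second_derivative_at_max (fun t => g t y0 + eps * t ^ 2)
      (fun t => gx t y0 + eps * (2 * t)) _ x0 delta); [lra| | |].
    - intros t ht; apply Rabs_def2 in ht.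
      apply @is_derive_plus; [apply harm; lra|auto_derive; [trivial|ring]].
    - apply @is_derive_plus; [exact d1|auto_derive; [trivial|ring]].
    - intros t ht; apply Rabs_def2 in ht; apply max; lra. }
  assert (- r <= 0).
  { apply (second_derivative_at_max (fun t => g x0 t) (fun t => gy x0 t) _ y0 delta); [lra| |exact d2|].
    - intros t ht; apply Rabs_def2 in ht; apply harm; lra.
    - intros t ht; apply Rabs_def2 in ht.
      specialize (max x0 t ltac:(lra) ltac:(lra)); lra. }
  lra.
Qed.

(** [U] is the real part of a primitive: [u dx - v dy] is closed by the Cauchy-Riemann equations.
    The base point is moved strictly inside because Goursat works on closed rectangles. *)
Lemma hol_potential (u v : R -> R -> R) (a b c d : R) :
  (forall x y, a < x < b -> c < y < d -> hol u v x y) ->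
  forall a' c', a < a' -> c < c' -> exists U : R -> R -> R,
  forall x y, a' < x < b -> c' < y < d ->
    is_derive (fun t => U t y) x (u x y) /\ is_derive (fun t => U x t) y (- v x y).
Proof.
intros hu a' c' ha hc.
pose (w := fun x y => - v x y).
assert (closed : forall x y, a < x < b -> c < y < d -> closed_form_at u w x y).
{ intros x y hx hy; destruct (hu x y hx hy) as [p [q [h1 h2]]].
  exists p, (- q), (- p); split; trivial.
  replace (- q) with (-1 * q + 0 * 0) by ring; replace (- p) with (-1 * p + 0 * 0) by ring.
  apply (differentiable_pt_lim_comp (fun z _ => - z) v (fun _ _ => 0)); trivial.
  - apply (differentiable_pt_lim_proj1_0 Ropp); apply is_derive_Reals; auto_derive; [trivial|ring].
  - apply (differentiable_pt_lim_proj1_0 (fun _ => 0)), derivable_pt_lim_const. }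
assert (cu : forall x y, a < x < b -> c < y < d -> continuous (fun t => u t y) x).
{ intros x y hx hy; apply (continuous_section_l u), (hol_continuity u v), hu; trivial. }
assert (cw : forall x y, a < x < b -> c < y < d -> continuous (fun t => w x t) y).
{ intros x y hx hy; apply (continuous_section_r w); unfold w.
  apply continuity_2d_pt_opp, (hol_continuity u v), hu; trivial. }
assert (eu : forall y s t, c < y < d -> a < s -> s <= t -> t < b -> ex_RInt (fun x => u x y) s t).
{ intros; apply ex_RInt_between; trivial; intros; apply cu; lra. }
assert (ew : forall x s t, a < x < b -> c < s -> s <= t -> t < d -> ex_RInt (fun y => w x y) s t).
{ intros; apply ex_RInt_between; trivial; intros; apply cw; lra. }
assert (near : forall l h z, l < z < h -> locally z (fun t => l < t < h)).
{ intros l h z hz; exists (mkposreal (Rmin (z - l) (h - z)) ltac:(apply Rmin_glb_lt; lra)).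
  intros t ht; apply Rabs_def2 in ht; simpl in ht; unfold minus, plus, opp in ht; simpl in ht.
  pose proof (Rmin_l (z - l) (h - z)); pose proof (Rmin_r (z - l) (h - z)); lra. }
(* Along this path the derivative in [y] is immediate; Goursat exchanges it for the path with the
   legs in the other order, which gives the derivative in [x]. *)
exists (fun x y => RInt (fun t => u t c') a' x + RInt (fun t => w x t) c' y).
intros x y hx hy; split.
- apply (is_derive_ext_loc (fun x => RInt (fun t => w a' t) c' y + RInt (fun t => u t y) a' x)).
  + apply (filter_imp (fun t => a' < t < b)); [|apply near; lra].
    intros t ht.
    assert (G : loop_integral u w a' t c' y = 0).
    { apply goursat; try lra; intros; apply closed; lra. }
    unfold loop_integral in G.
    assert (e1 : RInt (fun s => u s c' - u s y) a' t =
      RInt (fun s => u s c') a' t - RInt (fun s => u s y) a' t).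
    { apply @RInt_minus; apply eu; lra. }
    assert (e2 : RInt (fun s => w t s - w a' s) c' y =
      RInt (fun s => w t s) c' y - RInt (fun s => w a' s) c' y).
    { apply @RInt_minus; apply ew; lra. }
    rewrite e1, e2 in G; simpl in *; lra.
  + replace (u x y) with (plus 0 (u x y)) by (unfold plus; simpl; ring).
    apply (@is_derive_plus R_AbsRing R_NormedModule); [apply @is_derive_const|].
    apply (@is_derive_RInt R_NormedModule (fun t => u t y) _ a'); [|apply cu; lra].
    apply (filter_imp (fun t => a' < t < b)); [|apply near; lra].
    intros t ht; apply (@RInt_correct R_CompleteNormedModule), eu; lra.
- replace (- v x y) with (plus 0 (w x y)) by (unfold plus, w; simpl; ring).
  apply (@is_derive_plus R_AbsRing R_NormedModule); [apply @is_derive_const|].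
  apply (@is_derive_RInt R_NormedModule (fun t => w x t) _ c'); [|apply cw; lra].
  apply (filter_imp (fun t => c' < t < d)); [|apply near; lra].
  intros t ht; apply (@RInt_correct R_CompleteNormedModule), ew; lra.
Qed.

Lemma MVT_is_derive (f df : R -> R) (x y : R) :
  (forall t, Rmin x y <= t <= Rmax x y -> is_derive f t (df t)) ->
  exists t, Rmin x y <= t <= Rmax x y /\ f y - f x = df t * (y - x).
Proof.
intros h; apply MVT_gen; [intros t ht; apply h; lra|].
intros t ht; apply continuity_pt_filterlim, (@ex_derive_continuous _ R_NormedModule).
exists (df t); apply h, ht.
Qed.

(** The potential is known through its partial derivatives; joint continuity is what allows its
    difference quotient to be maximised over a rectangle. *)
Lemma continuity_2d_pt_of_partials (f fx fy : R -> R -> R) (x y delta : R) : 0 < delta ->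
  (forall s t, Rabs (s - x) < delta -> Rabs (t - y) < delta ->
     is_derive (fun z => f z t) s (fx s t) /\ is_derive (fun z => f s z) t (fy s t)) ->
  continuity_2d_pt fx x y -> continuity_2d_pt fy x y -> continuity_2d_pt f x y.
Proof.
intros hd der cx cy eps.
destruct (cx (mkposreal 1 Rlt_0_1)) as [d1 h1]; destruct (cy (mkposreal 1 Rlt_0_1)) as [d2 h2].
simpl in h1, h2.
set (B := Rabs (fx x y) + Rabs (fy x y) + 1).
assert (hB : 1 <= B) by (unfold B; pose proof (Rabs_pos (fx x y)); pose proof (Rabs_pos (fy x y)); lra).
assert (heps := cond_pos eps).
set (r := Rmin (Rmin delta (eps / (4 * B))) (Rmin d1 d2)).
assert (0 < eps / (4 * B)) by (apply Rdiv_lt_0_compat; lra).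
assert (hr : 0 < r /\ r <= delta /\ r <= eps / (4 * B) /\ r <= d1 /\ r <= d2).
{ pose proof (cond_pos d1); pose proof (cond_pos d2); unfold r; repeat split;
  try (repeat apply Rmin_glb_lt; lra); unfold Rmin; repeat destruct Rle_dec; lra. }
exists (mkposreal r (proj1 hr)); simpl; intros s t hs ht.
apply Rabs_def2 in hs; apply Rabs_def2 in ht.
assert (btw : forall p q z, Rmin p q <= z <= Rmax p q -> Rabs (p - q) < r -> Rabs (z - q) < r).
{ intros p q z; unfold Rmin, Rmax; destruct Rle_dec; intros ? h; apply Rabs_def2 in h;
  apply Rabs_def1; lra. }
destruct (MVT_is_derive (fun z => f z t) (fun z => fx z t) s x) as [p [hp ep]].
{ intros z hz; apply der; [|apply Rabs_def1; lra].
  apply Rlt_le_trans with r; [apply (btw s x z hz), Rabs_def1; lra|lra]. }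
destruct (MVT_is_derive (fun z => f x z) (fun z => fy x z) t y) as [q [hq eq]].
{ intros z hz; apply der; [apply Rabs_def1; lra|].
  apply Rlt_le_trans with r; [apply (btw t y z hz), Rabs_def1; lra|lra]. }
assert (bp : Rabs (fx p t) <= B).
{ assert (k : Rabs (p - x) < r) by (apply (btw s x p hp), Rabs_def1; lra).
  apply Rabs_def2 in k.
  assert (k' : Rabs (fx p t - fx x y) < 1) by (apply h1; apply Rabs_def1; lra).
  pose proof (Rabs_triang (fx p t - fx x y) (fx x y)) as tri.
  replace (fx p t - fx x y + fx x y) with (fx p t) in tri by ring.
  unfold B; pose proof (Rabs_pos (fy x y)); lra. }
assert (bq : Rabs (fy x q) <= B).
{ assert (k : Rabs (q - y) < r) by (apply (btw t y q hq), Rabs_def1; lra).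
  apply Rabs_def2 in k.
  assert (k' : Rabs (fy x q - fy x y) < 1) by (apply h2; apply Rabs_def1; lra).
  pose proof (Rabs_triang (fy x q - fy x y) (fy x y)) as tri.
  replace (fy x q - fy x y + fy x y) with (fy x q) in tri by ring.
  unfold B; pose proof (Rabs_pos (fx x y)); lra. }
replace (f s t - f x y) with (- (fx p t * (x - s)) + - (fy x q * (y - t))) by lra.
eapply Rle_lt_trans; [apply Rabs_triang|].
rewrite !Rabs_Ropp, !Rabs_mult.
assert (Rabs (x - s) <= r) by (apply Rabs_le; lra).
assert (Rabs (y - t) <= r) by (apply Rabs_le; lra).
pose proof (Rmult_le_compat _ _ _ _ (Rabs_pos (fx p t)) (Rabs_pos (x - s)) bp H0).
pose proof (Rmult_le_compat _ _ _ _ (Rabs_pos (fy x q)) (Rabs_pos (y - t)) bq H1).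
assert (B * r <= B * (eps / (4 * B))) by (apply Rmult_le_compat_l; lra).
assert (B * (eps / (4 * B)) = eps / 4) by (field; lra).
lra.
Qed.

(* The difference quotient of a potential is genuinely twice differentiable, so the
   second derivative test applies to it; it is also an average of [u] over a short segment. *)
Lemma hol_max (u v : R -> R -> R) (a b c d eta m : R) : 0 < eta ->
  (forall x y, a - eta < x < b + eta -> c - eta < y < d + eta -> hol u v x y) ->
  (forall x y, on_boundary a b c d x y -> u x y <= m) ->
  forall x y, a <= x <= b -> c <= y <= d -> u x y <= m.
Proof.
intros he hu bdry x y hx hy.
destruct (hol_potential u v (a - eta) (b + eta) (c - eta) (d + eta) hu
  (a - eta / 2) (c - eta / 2) ltac:(lra) ltac:(lra)) as [U hU].
apply Rnot_lt_le; intros lt.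
destruct (uniform_continuity_2d u a (b + eta / 2) c d) with
  (eps := mkposreal ((u x y - m) / 3) ltac:(lra)) as [delta unif].
{ intros s t hs ht; apply (hol_continuity u v), hu; lra. }
simpl in unif; assert (hd := cond_pos delta).
set (h := Rmin (delta / 2) (eta / 4)).
assert (hh : 0 < h /\ h < delta /\ h < eta / 2).
{ pose proof (Rmin_l (delta / 2) (eta / 4)); pose proof (Rmin_r (delta / 2) (eta / 4)).
  unfold h; repeat split; [apply Rmin_glb_lt|..]; lra. }
pose (g := fun s t => U (s + h) t - U s t).
(* By the mean value theorem [g / h] is a nearby value of [u]. It is off by less than a third of the
   excess, once on the boundary and once at [(x, y)], which still leaves a third for the
   contradiction. *)
assert (mean : forall s t, a <= s <= b -> c <= t <= d ->
  Rabs (g s t / h - u s t) < (u x y - m) / 3).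
{ intros s t hs ht.
  destruct (MVT_is_derive (fun z => U z t) (fun z => u z t) s (s + h)) as [p [hp ep]].
  { rewrite Rmin_left, Rmax_right by lra; intros z hz; apply hU; lra. }
  rewrite Rmin_left, Rmax_right in hp by lra.
  unfold g; rewrite ep; replace (u p t * (s + h - s) / h) with (u p t) by (field; lra).
  apply unif; try lra; apply Rabs_def1; lra. }
assert (scale : forall s, s / h * h = s) by (intros; field; lra).
assert (key : g x y <= (m + (u x y - m) / 3) * h).
{ apply (harmonic_max g (fun s t => u (s + h) t - u s t) (fun s t => - v (s + h) t - - v s t)
    a b c d); trivial.
  - intros s t hs ht.
    assert (cU : forall s, a <= s <= b + eta / 2 -> continuity_2d_pt U s t).
    { intros z hz; apply (continuity_2d_pt_of_partials U u (fun x y => - v x y) z t (eta / 2));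
      [lra| |apply (hol_continuity u v), hu; lra
        |apply continuity_2d_pt_opp, (hol_continuity u v), hu; lra].
      intros p q hp hq; apply Rabs_def2 in hp; apply Rabs_def2 in hq; apply hU; lra. }
    apply continuity_2d_pt_minus; [|apply cU; lra].
    intros eps; destruct (cU (s + h) ltac:(lra) eps) as [r hr]; exists r.
    intros p q hp hq; apply hr; trivial; replace (p + h - (s + h)) with (p - s) by ring; trivial.
  - intros s t hs ht.
    assert (shift : forall (f : R -> R) l, is_derive f (s + h) l -> is_derive (fun z => f (z + h)) s l).
    { intros f l hf; replace l with (1 * l) by ring.
      apply (is_derive_comp f (fun z => z + h)); [exact hf|auto_derive; [trivial|ring]]. }
    destruct (hU s t ltac:(lra) ltac:(lra)) as [d1 d2].
    destruct (hU (s + h) t ltac:(lra) ltac:(lra)) as [d3 d4].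
    split; [|split].
    + apply (@is_derive_minus R_AbsRing R_NormedModule); [|exact d1].
      apply (shift (fun z => U z t)); exact d3.
    + apply (@is_derive_minus R_AbsRing R_NormedModule); assumption.
    + destruct (hu s t ltac:(lra) ltac:(lra)) as [p1 [q1 [e1 e2]]].
      destruct (hu (s + h) t ltac:(lra) ltac:(lra)) as [p2 [q2 [e3 e4]]].
      exists (p2 - p1); split.
      * apply (@is_derive_minus R_AbsRing R_NormedModule);
        [apply (shift (fun z => u z t))|]; eapply differentiable_pt_lim_derive_l; eassumption.
      * replace (- (p2 - p1)) with (- p2 - - p1) by ring.
        apply (@is_derive_minus R_AbsRing R_NormedModule);
        apply (@is_derive_opp R_AbsRing R_NormedModule); eapply differentiable_pt_lim_derive_r; eassumption.
  - intros s t hb; specialize (bdry s t hb); destruct hb as [hs [ht _]].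
    specialize (mean s t hs ht); apply Rabs_def2 in mean.
    rewrite <- (scale (g s t)); apply Rmult_le_compat_r; lra. }
specialize (mean x y hx hy); apply Rabs_def2 in mean.
rewrite <- (scale (g x y)) in key; apply Rmult_le_reg_r in key; lra.
Qed.

(** * Holomorphic functions of a complex variable *)

Lemma Cplx_ext (z w : Cplx) : re z = re w -> im z = im w -> z = w.
Proof. destruct z, w; simpl; intros -> ->; reflexivity. Qed.

Lemma Cplx_eta (z : Cplx) : mkC (re z) (im z) = z.
Proof. destruct z; reflexivity. Qed.

Lemma Cnorm2_ge0 (z : Cplx) : 0 <= Cnorm2 z.
Proof. unfold Cnorm2; nra. Qed.

Lemma Cnorm2_eq0 (z : Cplx) : Cnorm2 z = 0 -> z = C0.
Proof. unfold Cnorm2; intros h; apply Cplx_ext; simpl; nra. Qed.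

Lemma Cnorm2_gt0 (z : Cplx) : z <> C0 -> 0 < Cnorm2 z.
Proof.
intros h; destruct (Cnorm2_ge0 z) as [lt|eq]; [exact lt|].
contradict h; apply Cnorm2_eq0; symmetry; exact eq.
Qed.

Lemma Cplx_ring_theory : ring_theory C0 C1 Cadd Cmul Csub Copp eq.
Proof.
split; intros; apply Cplx_ext; unfold C0, C1, RtoC, Cadd, Cmul, Csub, Copp; simpl; ring.
Qed.

Lemma Cplx_field_theory : field_theory C0 C1 Cadd Cmul Csub Copp Cdiv Cinv eq.
Proof.
split.
- exact Cplx_ring_theory.
- intros h; apply (f_equal re) in h; unfold C1, C0, RtoC in h; simpl in h; lra.
- reflexivity.
- intros z hz; apply Cnorm2_gt0 in hz; unfold Cinv, Cmul, C1, RtoC.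
  apply Cplx_ext; simpl; unfold Cnorm2 in *; field; lra.
Qed.

Add Field Cplx_field : Cplx_field_theory.

Lemma Cnorm2_mul (z w : Cplx) : Cnorm2 (Cmul z w) = Cnorm2 z * Cnorm2 w.
Proof. unfold Cnorm2; simpl; ring. Qed.

Lemma Cabs_mul (z w : Cplx) : Cabs (Cmul z w) = Cabs z * Cabs w.
Proof. unfold Cabs; rewrite Cnorm2_mul; apply sqrt_mult; apply Cnorm2_ge0. Qed.

Lemma Cabs_ge0 (z : Cplx) : 0 <= Cabs z.
Proof. apply sqrt_pos. Qed.

Lemma Cabs_sqr (z : Cplx) : Cabs z * Cabs z = Cnorm2 z.
Proof. apply sqrt_sqrt, Cnorm2_ge0. Qed.

Lemma Rabs_le_of_sqr (t b : R) : 0 <= b -> t * t <= b * b -> Rabs t <= b.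
Proof. intros hb h; apply Rabs_le; split; nra. Qed.

Lemma re_le_Cabs (z : Cplx) : Rabs (re z) <= Cabs z.
Proof.
apply Rabs_le_of_sqr; [apply Cabs_ge0|]; rewrite Cabs_sqr; unfold Cnorm2; nra.
Qed.

Lemma im_le_Cabs (z : Cplx) : Rabs (im z) <= Cabs z.
Proof.
apply Rabs_le_of_sqr; [apply Cabs_ge0|]; rewrite Cabs_sqr; unfold Cnorm2; nra.
Qed.

Lemma Cabs_le_Rmax (z : Cplx) : Cabs z <= 2 * Rmax (Rabs (re z)) (Rabs (im z)).
Proof.
set (m := Rmax _ _).
assert (h1 : Rabs (re z) <= m) by apply Rmax_l; assert (h2 : Rabs (im z) <= m) by apply Rmax_r.
apply Rabs_le_between in h1; apply Rabs_le_between in h2.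
assert (0 <= m) by lra.
replace (2 * m) with (sqrt ((2 * m) * (2 * m))) by (apply sqrt_square; lra).
apply sqrt_le_1_alt; unfold Cnorm2; nra.
Qed.

Lemma differentiable_pt_lim_eq (f : R -> R -> R) (x y p q p' q' : R) :
  differentiable_pt_lim f x y p q -> p = p' -> q = q' -> differentiable_pt_lim f x y p' q'.
Proof. intros h <- <-; exact h. Qed.

Lemma differentiable_pt_lim_const (x y c : R) : differentiable_pt_lim (fun _ _ => c) x y 0 0.
Proof. apply (differentiable_pt_lim_proj1_0 (fun _ => c)), derivable_pt_lim_const. Qed.

Lemma differentiable_pt_lim_fst (x y : R) : differentiable_pt_lim (fun s _ => s) x y 1 0.
Proof. apply (differentiable_pt_lim_proj1_0 (fun s => s)), derivable_pt_lim_id. Qed.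

Lemma differentiable_pt_lim_snd (x y : R) : differentiable_pt_lim (fun _ t => t) x y 0 1.
Proof.
intros eps; exists (mkposreal 1 Rlt_0_1); intros s t _ _.
replace (t - y - (0 * (s - x) + 1 * (t - y))) with 0 by ring; rewrite Rabs_R0.
apply Rmult_le_pos; [apply Rlt_le, cond_pos|].
apply Rle_trans with (Rabs (s - x)); [apply Rabs_pos|apply Rmax_l].
Qed.

Lemma differentiable_pt_lim_comp1 (g : R -> R) (f : R -> R -> R) (x y l p q : R) :
  is_derive g (f x y) l -> differentiable_pt_lim f x y p q ->
  differentiable_pt_lim (fun s t => g (f s t)) x y (l * p) (l * q).
Proof.
intros hg hf; replace (l * p) with (l * p + 0 * 0) by ring; replace (l * q) with (l * q + 0 * 0) by ring.
apply (differentiable_pt_lim_comp (fun z _ => g z) f (fun _ _ => 0)); trivial.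
- apply differentiable_pt_lim_proj1_0, is_derive_Reals, hg.
- apply differentiable_pt_lim_const.
Qed.

Lemma differentiable_pt_lim_plus (f g : R -> R -> R) (x y p q r s : R) :
  differentiable_pt_lim f x y p q -> differentiable_pt_lim g x y r s ->
  differentiable_pt_lim (fun a b => f a b + g a b) x y (p + r) (q + s).
Proof.
intros hf hg; replace (p + r) with (1 * p + 1 * r) by ring; replace (q + s) with (1 * q + 1 * s) by ring.
apply (differentiable_pt_lim_comp Rplus f g); trivial.
intros eps; exists (mkposreal 1 Rlt_0_1); intros a b _ _.
match goal with |- Rabs ?e <= _ => replace e with 0 by ring end; rewrite Rabs_R0.
apply Rmult_le_pos; [apply Rlt_le, cond_pos|].
apply Rle_trans with (Rabs (a - f x y)); [apply Rabs_pos|apply Rmax_l].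
Qed.

Lemma differentiable_pt_lim_mult (f g : R -> R -> R) (x y p q r s : R) :
  differentiable_pt_lim f x y p q -> differentiable_pt_lim g x y r s ->
  differentiable_pt_lim (fun a b => f a b * g a b) x y
    (p * g x y + f x y * r) (q * g x y + f x y * s).
Proof.
intros hf hg.
replace (p * g x y + f x y * r) with (g x y * p + f x y * r) by ring.
replace (q * g x y + f x y * s) with (g x y * q + f x y * s) by ring.
apply (differentiable_pt_lim_comp Rmult f g); trivial.
intros eps; exists eps; intros a b ha hb.
replace (a * b - f x y * g x y - (g x y * (a - f x y) + f x y * (b - g x y)))
  with ((a - f x y) * (b - g x y)) by ring.
rewrite Rabs_mult; apply Rmult_le_compat; try apply Rabs_pos; [lra|apply Rmax_r].
Qed.

Definition holc (F : Cplx -> Cplx) (z : Cplx) : Prop :=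
  hol (fun x y => re (F (mkC x y))) (fun x y => im (F (mkC x y))) (re z) (im z).

Lemma cdiff_holc (F : Cplx -> Cplx) (z : Cplx) : cdiff F z -> holc F z.
Proof.
intros [l hl]; exists (re l), (im l).
assert (key : forall eps : posreal, locally_2d (fun s t =>
  Cabs (Csub (Csub (F (mkC s t)) (F z)) (Cmul l (Csub (mkC s t) z))) <=
  eps * Rmax (Rabs (s - re z)) (Rabs (t - im z))) (re z) (im z)).
(* Half of [eps], because [Cabs h] may be twice the larger coordinate of [h]. *)
{ intros eps; destruct (hl (eps / 2)) as [delta [hd small]];
  [apply Rdiv_lt_0_compat; [apply cond_pos|lra]|].
  exists (mkposreal (delta / 4) ltac:(lra)); simpl; intros s t hs ht.
  set (h := Csub (mkC s t) z).
  assert (eh : re h = s - re z /\ im h = t - im z) by (split; reflexivity).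
  assert (hm : Cabs h <= 2 * Rmax (Rabs (s - re z)) (Rabs (t - im z))).
  { rewrite <- (proj1 eh), <- (proj2 eh); apply Cabs_le_Rmax. }
  assert (hz : Cadd z h = mkC s t) by (unfold h; ring).
  destruct (Req_dec (Cabs h) 0) as [e|ne].
  - assert (h0 : h = C0) by (apply Cnorm2_eq0; rewrite <- Cabs_sqr, e; ring).
    rewrite h0 in hz |- *; rewrite <- hz; replace (Cadd z C0) with z by ring.
    replace (Csub _ _) with (RtoC 0) by (change (RtoC 0) with C0; ring).
    replace (Cabs (RtoC 0)) with 0.
    + apply Rmult_le_pos; [apply Rlt_le, cond_pos|].
      apply Rle_trans with (Rabs (s - re z)); [apply Rabs_pos|apply Rmax_l].
    + unfold Cabs, Cnorm2; simpl; rewrite Rmult_0_l, Rplus_0_l, sqrt_0; reflexivity.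
  - assert (hpos : 0 < Cabs h) by (pose proof (Cabs_ge0 h); lra).
    assert (hlt : Cabs h < delta).
    { eapply Rle_lt_trans; [exact hm|]; assert (Rmax (Rabs (s - re z)) (Rabs (t - im z)) < delta / 4)
        by (apply Rmax_lub_lt; assumption); lra. }
    specialize (small h (conj hpos hlt)); rewrite hz in small.
    assert (hne : h <> C0).
    { intros h0; apply ne; rewrite h0; unfold Cabs, Cnorm2; simpl;
      rewrite Rmult_0_l, Rplus_0_l, sqrt_0; reflexivity. }
    replace (Csub (Csub (F (mkC s t)) (F z)) (Cmul l h)) with
      (Cmul (Csub (Cdiv (Csub (F (mkC s t)) (F z)) h) l) h) by (field; exact hne).
    rewrite Cabs_mul.
    apply Rle_trans with (eps / 2 * Cabs h).
    + apply Rmult_le_compat_r; lra.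
    + replace (pos eps) with (eps / 2 * 2) at 2 by field; rewrite Rmult_assoc.
      apply Rmult_le_compat_l; [|exact hm].
      apply Rlt_le, Rdiv_lt_0_compat; [apply cond_pos|lra]. }
split; intros eps; destruct (key eps) as [delta hd]; exists delta; intros s t hs ht;
specialize (hd s t hs ht); rewrite Cplx_eta;
(eapply Rle_trans; [|exact hd]).
- eapply Rle_trans; [|apply re_le_Cabs]; right; f_equal; simpl; ring.
- eapply Rle_trans; [|apply im_le_Cabs]; right; f_equal; simpl; ring.
Qed.

Lemma holc_const (c z : Cplx) : holc (fun _ => c) z.
Proof. exists 0, 0; split; [rewrite Ropp_0|]; apply differentiable_pt_lim_const. Qed.

Lemma holc_id (z : Cplx) : holc (fun w => w) z.
Proof.
exists 1, 0; split; [rewrite Ropp_0|]; [apply differentiable_pt_lim_fst|apply differentiable_pt_lim_snd].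
Qed.

Lemma holc_add (F G : Cplx -> Cplx) (z : Cplx) :
  holc F z -> holc G z -> holc (fun w => Cadd (F w) (G w)) z.
Proof.
intros [a [b [h1 h2]]] [c [d [h3 h4]]]; exists (a + c), (b + d); split.
- replace (- (b + d)) with (- b + - d) by ring; apply differentiable_pt_lim_plus; assumption.
- apply differentiable_pt_lim_plus; assumption.
Qed.

Lemma holc_mul (F G : Cplx -> Cplx) (z : Cplx) :
  holc F z -> holc G z -> holc (fun w => Cmul (F w) (G w)) z.
Proof.
intros [a [b [h1 h2]]] [c [d [h3 h4]]].
pose proof (differentiable_pt_lim_mult _ _ _ _ _ _ _ _ h1 h3) as m1.
pose proof (differentiable_pt_lim_mult _ _ _ _ _ _ _ _ h2 h4) as m2.
pose proof (differentiable_pt_lim_mult _ _ _ _ _ _ _ _ h1 h4) as m3.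
pose proof (differentiable_pt_lim_mult _ _ _ _ _ _ _ _ h2 h3) as m4.
apply (differentiable_pt_lim_comp1 Ropp _ _ _ (-1)) in m2; [|auto_derive; [trivial|ring]].
pose proof (differentiable_pt_lim_plus _ _ _ _ _ _ _ _ m1 m2) as p1.
pose proof (differentiable_pt_lim_plus _ _ _ _ _ _ _ _ m3 m4) as p2.
cbv beta in p1, p2; rewrite ?Cplx_eta in p1; rewrite ?Cplx_eta in p2.
exists (a * re (G z) - b * im (G z) + (re (F z) * c - im (F z) * d)),
       (b * re (G z) + a * im (G z) + (re (F z) * d + im (F z) * c)); split.
- eapply differentiable_pt_lim_eq; [exact p1|ring|ring].
- eapply differentiable_pt_lim_eq; [exact p2|ring|ring].
Qed.

Lemma holc_sub (F G : Cplx -> Cplx) (z : Cplx) :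
  holc F z -> holc G z -> holc (fun w => Csub (F w) (G w)) z.
Proof.
intros hF hG.
pose proof (holc_add _ _ _ hF (holc_mul _ _ _ (holc_const (RtoC (-1)) z) hG)) as h.
unfold holc in *; simpl in *.
destruct h as [a [b [h1 h2]]]; exists a, b; split;
(eapply differentiable_pt_lim_ext; [|eassumption]);
exists (mkposreal 1 Rlt_0_1); intros; simpl; ring.
Qed.

Lemma holc_opp (z : Cplx) : holc Copp z.
Proof.
destruct (holc_sub _ _ z (holc_const C0 z) (holc_id z)) as [p [q [h1 h2]]]; exists p, q; split;
(eapply differentiable_pt_lim_ext; [|eassumption]);
exists (mkposreal 1 Rlt_0_1); intros; simpl; ring.
Qed.

Lemma holc_comp (F G : Cplx -> Cplx) (z : Cplx) :
  holc F (G z) -> holc G z -> holc (fun w => F (G w)) z.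
Proof.
intros [a [b [h1 h2]]] [c [d [h3 h4]]].
assert (e : forall x y, F (mkC (re (G (mkC x y))) (im (G (mkC x y)))) = F (G (mkC x y))).
{ intros; rewrite Cplx_eta; reflexivity. }
exists (a * c - b * d), (b * c + a * d); split.
- replace (a * c - b * d) with (a * c + - b * d) by ring.
  replace (- (b * c + a * d)) with (a * - d + - b * c) by ring.
  eapply differentiable_pt_lim_ext; [exists (mkposreal 1 Rlt_0_1); intros s t _ _; apply (f_equal re), e|].
  apply (differentiable_pt_lim_comp (fun x y => re (F (mkC x y)))); rewrite ?Cplx_eta; assumption.
- replace (a * c - b * d) with (b * - d + a * c) by ring.
  eapply differentiable_pt_lim_ext; [exists (mkposreal 1 Rlt_0_1); intros s t _ _; apply (f_equal im), e|].
  apply (differentiable_pt_lim_comp (fun x y => im (F (mkC x y)))); rewrite ?Cplx_eta; assumption.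
Qed.

Lemma holc_inv (z : Cplx) : z <> C0 -> holc Cinv z.
Proof.
intros hz; apply Cnorm2_gt0 in hz.
destruct z as [x y]; unfold holc, Cinv, Cnorm2 in *; simpl in *.
set (n := x * x + y * y) in *.
pose proof (differentiable_pt_lim_fst x y) as h1; pose proof (differentiable_pt_lim_snd x y) as h2.
pose proof (differentiable_pt_lim_plus _ _ _ _ _ _ _ _
  (differentiable_pt_lim_mult _ _ _ _ _ _ _ _ h1 h1)
  (differentiable_pt_lim_mult _ _ _ _ _ _ _ _ h2 h2)) as h3.
apply (differentiable_pt_lim_comp1 Rinv _ _ _ (- / n ^ 2)) in h3;
  [|auto_derive; [fold n; lra|fold n; field; lra]].
apply (differentiable_pt_lim_comp1 Ropp _ _ _ (-1)) in h2; [|auto_derive; [trivial|ring]].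
pose proof (differentiable_pt_lim_mult _ _ _ _ _ _ _ _ h1 h3) as p1.
pose proof (differentiable_pt_lim_mult _ _ _ _ _ _ _ _ h2 h3) as p2.
fold n in p1, p2.
exists ((y * y - x * x) / n ^ 2), (2 * x * y / n ^ 2); split.
- eapply differentiable_pt_lim_eq; [exact p1|unfold n; field; unfold n in hz; lra..].
- eapply differentiable_pt_lim_eq; [exact p2|unfold n; field; unfold n in hz; lra..].
Qed.

Lemma holc_div (F G : Cplx -> Cplx) (z : Cplx) : G z <> C0 ->
  holc F z -> holc G z -> holc (fun w => Cdiv (F w) (G w)) z.
Proof.
intros h hF hG; apply (holc_mul F (fun w => Cinv (G w))); [exact hF|].
apply (holc_comp Cinv G); [apply holc_inv, h|exact hG].
Qed.

(** * The exponential and the logarithm on the slit plane *)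

Definition Cexp (z : Cplx) : Cplx := mkC (exp (re z) * cos (im z)) (exp (re z) * sin (im z)).

Lemma holc_exp (z : Cplx) : holc Cexp z.
Proof.
destruct z as [x y]; unfold holc, Cexp; simpl.
pose proof (differentiable_pt_lim_comp1 exp _ x y _ _ _ (is_derive_exp x) (differentiable_pt_lim_fst x y)) as h1.
pose proof (differentiable_pt_lim_comp1 cos _ x y _ _ _ (is_derive_cos y) (differentiable_pt_lim_snd x y)) as h2.
pose proof (differentiable_pt_lim_comp1 sin _ x y _ _ _ (is_derive_sin y) (differentiable_pt_lim_snd x y)) as h3.
pose proof (differentiable_pt_lim_mult _ _ _ _ _ _ _ _ h1 h2) as p1.
pose proof (differentiable_pt_lim_mult _ _ _ _ _ _ _ _ h1 h3) as p2.
exists (exp x * cos y), (exp x * sin y); split.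
- eapply differentiable_pt_lim_eq; [exact p1|cbv beta; ring..].
- eapply differentiable_pt_lim_eq; [exact p2|cbv beta; ring..].
Qed.

(* The argument on the slit plane, through the half-angle formula
   [tan (theta / 2) = b / (|a + i b| + a)]. *)
Definition Carg (z : Cplx) : R := 2 * atan (im z / (Cabs z + re z)).
Definition Clog (z : Cplx) : Cplx := mkC (ln (Cabs z)) (Carg z).

Definition in_slit_plane (z : Cplx) : Prop := 0 < re z \/ im z <> 0.

Lemma slit_plane_pos (z : Cplx) : in_slit_plane z ->
  0 < Cnorm2 z /\ 0 < Cabs z /\ 0 < Cabs z + re z.
Proof.
intros h; assert (n : 0 < Cnorm2 z) by (unfold Cnorm2; destruct h; nra).
assert (a : 0 < Cabs z) by (apply sqrt_lt_R0, n); repeat split; trivial.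
pose proof (Cabs_sqr z) as e; unfold Cnorm2 in e.
destruct h as [h|h]; [lra|]; assert (0 < im z * im z) by nra; nra.
Qed.

Lemma holc_log (z : Cplx) : in_slit_plane z -> holc Clog z.
Proof.
intros hz; apply slit_plane_pos in hz; destruct hz as [hn [hr hs]].
pose proof (Cabs_sqr z) as e.
destruct z as [x y]; unfold holc, Clog, Carg, Cabs, Cnorm2 in *; simpl in *.
set (n := x * x + y * y) in *; set (r := sqrt n) in *.
pose proof (differentiable_pt_lim_fst x y) as h1; pose proof (differentiable_pt_lim_snd x y) as h2.
pose proof (differentiable_pt_lim_plus _ _ _ _ _ _ _ _
  (differentiable_pt_lim_mult _ _ _ _ _ _ _ _ h1 h1)
  (differentiable_pt_lim_mult _ _ _ _ _ _ _ _ h2 h2)) as h3.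
apply (differentiable_pt_lim_comp1 sqrt _ _ _ (/ (2 * r))) in h3;
  [|auto_derive; [exact hn|fold n r; field; lra]].
pose proof h3 as h4.
apply (differentiable_pt_lim_comp1 ln _ _ _ (/ r)) in h4;
  [|auto_derive; [exact hr|fold n r; field; lra]].
pose proof (differentiable_pt_lim_plus _ _ _ _ _ _ _ _ h3 h1) as h5.
apply (differentiable_pt_lim_comp1 Rinv _ _ _ (- / (r + x) ^ 2)) in h5;
  [|auto_derive; [fold n r; lra|fold n r; field; lra]].
pose proof (differentiable_pt_lim_mult _ _ _ _ _ _ _ _ h2 h5) as h6.
set (t := y * / (r + x)).
apply (differentiable_pt_lim_comp1 (fun s => 2 * atan s) _ _ _ (2 / (1 + t ^ 2))) in h6.
2: { fold n r t; auto_derive; [trivial|field; nra]. }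
fold n r in h6.
assert (ht : 1 + t ^ 2 = 2 * r / (r + x)).
{ assert (yy : y * y = (r + x) * (r - x)) by (unfold n in e; lra).
  unfold t; replace ((y * / (r + x)) ^ 2) with ((y * y) / (r + x) ^ 2) by (field; lra).
  rewrite yy; field; lra. }
rewrite ht in h6.
exists (x / n), (- y / n); rewrite <- e; split.
- eapply differentiable_pt_lim_eq; [exact h4|cbv beta; field; lra..].
- assert (yy : y ^ 2 = (r + x) * (r - x)) by (unfold n in e; lra).
  eapply differentiable_pt_lim_eq; [exact h6|cbv beta; field; lra|].
  cbv beta; fold n r; field_simplify_eq; [|lra]; rewrite ?yy; ring.
Qed.

(** * Strips *)

Lemma holc_rectangle_max (F : Cplx -> Cplx) (a b c d eta m : R) : 0 < eta ->
  (forall z, a - eta < re z < b + eta -> c - eta < im z < d + eta -> holc F z) ->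
  (forall z, on_boundary a b c d (re z) (im z) -> re (F z) <= m) ->
  forall z, a <= re z <= b -> c <= im z <= d -> re (F z) <= m.
Proof.
intros he hF hb z hx hy.
rewrite <- (Cplx_eta z).
apply (hol_max (fun x y => re (F (mkC x y))) (fun x y => im (F (mkC x y))) a b c d eta m); trivial.
- intros x y h1 h2; apply (hF (mkC x y)); trivial.
- intros x y h; apply hb; exact h.
Qed.

(* Phragmen-Lindelof: [re (z ^ 2 + PI ^ 2) >= (re z) ^ 2] when [|im z| <= PI]. *)
Lemma holc_strip_max (F : Cplx -> Cplx) (c d eta m B : R) :
  0 < eta -> - PI <= c -> d <= PI ->
  (forall z, c - eta < im z < d + eta -> holc F z) ->
  (forall z, c <= im z <= d -> re (F z) <= B) ->
  (forall z, c <= im z <= d -> im z = c \/ im z = d -> re (F z) <= m) ->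
  forall z, c <= im z <= d -> re (F z) <= m.
Proof.
intros he hc hd hF hB hm z hz.
apply Rnot_lt_le; intros lt.
set (S := re z * re z + PI * PI + 1).
assert (hS : 0 < S) by (unfold S; pose proof PI_RGT_0; nra).
set (eps := (re (F z) - m) / (2 * S)).
assert (heps : 0 < eps) by (apply Rdiv_lt_0_compat; lra).
pose (G := fun w => Csub (F w) (Cmul (RtoC eps) (Cadd (Cmul w w) (RtoC (PI * PI))))).
assert (reG : forall w, re (G w) = re (F w) - eps * (re w * re w - im w * im w + PI * PI)).
{ intros w; simpl; ring. }
(* Far enough out that [eps * X ^ 2] absorbs the gap between the crude bound [B] and [m] on the
   vertical sides. *)
set (X := Rabs (re z) + (Rabs (B - m) / eps + 1)).
assert (hq : 0 <= Rabs (B - m) / eps).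
{ apply Rmult_le_pos; [apply Rabs_pos|apply Rlt_le, Rinv_0_lt_compat, heps]. }
assert (hX : Rabs (re z) <= X /\ 1 <= X /\ B - m <= eps * (X * X)).
{ pose proof (Rabs_pos (re z)); unfold X; repeat split; try lra; fold X.
  assert (e : Rabs (B - m) = eps * (Rabs (B - m) / eps)) by (field; lra).
  pose proof (Rle_abs (B - m)).
  assert (Rabs (B - m) / eps <= X) by (unfold X; lra).
  assert (1 <= X) by (unfold X; lra).
  assert (X <= X * X) by nra.
  assert (eps * (Rabs (B - m) / eps) <= eps * (X * X)) by (apply Rmult_le_compat_l; lra).
  lra. }
assert (pi2 : forall w, c <= im w <= d -> im w * im w <= PI * PI).
{ intros w hw; pose proof PI_RGT_0; nra. }
assert (key : re (G z) <= m).
{ apply (holc_rectangle_max G (- X) X c d eta m); trivial.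
  - intros w _ hw; apply holc_sub; [apply hF, hw|].
    apply holc_mul; [apply holc_const|apply holc_add; [|apply holc_const]].
    apply holc_mul; apply holc_id.
  - intros w [h1 [h2 h3]]; rewrite reG; specialize (pi2 w h2).
    assert (0 <= re w * re w) by nra.
    assert (h4 : 0 <= eps * (re w * re w - im w * im w + PI * PI)) by (apply Rmult_le_pos; lra).
    destruct h3 as [h3|[h3|h3]].
    + specialize (hB w h2); rewrite h3 in h4 |- *; nra.
    + specialize (hB w h2); rewrite h3 in h4 |- *; nra.
    + specialize (hm w h2 h3); lra.
  - apply Rabs_le_between; lra. }
rewrite reG in key.
assert (eps * (re z * re z - im z * im z + PI * PI) <= eps * S).
{ apply Rmult_le_compat_l; [lra|unfold S; nra]. }
assert (eps * S = (re (F z) - m) / 2) by (unfold eps; field; lra); lra.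
Qed.

(** With [im F = 0] the Cauchy-Riemann equations kill both partials of [re F]; a horizontal and a
    vertical segment join any two points of the strip. *)
Lemma holc_real_const (F : Cplx -> Cplx) (a b : R) :
  (forall z, a < im z < b -> holc F z) -> (forall z, a < im z < b -> im (F z) = 0) ->
  forall z w, a < im z < b -> a < im w < b -> F z = F w.
Proof.
intros hF h0.
assert (der : forall x y, a < y < b -> is_derive (fun t => re (F (mkC t y))) x 0 /\
                                      is_derive (fun t => re (F (mkC x t))) y 0).
{ intros x y hy; destruct (hF (mkC x y) hy) as [p [q [h1 h2]]]; simpl in *.
  pose proof (differentiable_pt_lim_unique _ _ _ _ _ h2) as [e1 e2].
  rewrite (Derive_ext _ (fun _ => 0)) in e1 by (intros t; apply h0; exact hy).
  rewrite Derive_const in e1.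
  rewrite (Derive_ext_loc _ (fun _ => 0)), Derive_const in e2.
  2: { exists (mkposreal (Rmin (y - a) (b - y)) ltac:(apply Rmin_glb_lt; lra)); intros t ht.
       apply Rabs_def2 in ht; simpl in ht; unfold minus, plus, opp in ht; simpl in ht.
       pose proof (Rmin_l (y - a) (b - y)); pose proof (Rmin_r (y - a) (b - y)).
       apply h0; simpl; lra. }
  subst p q; split; [exact (differentiable_pt_lim_derive_l _ _ _ _ _ h1)|].
  rewrite Ropp_0 in h1; exact (differentiable_pt_lim_derive_r _ _ _ _ _ h1). }
intros z w hz hw; apply Cplx_ext; [|rewrite !h0; trivial].
rewrite <- (Cplx_eta z), <- (Cplx_eta w).
destruct (MVT_is_derive (fun t => re (F (mkC t (im z)))) (fun _ => 0) (re z) (re w)) as [t1 [_ e1]].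
{ intros t _; exact (proj1 (der t (im z) hz)). }
destruct (MVT_is_derive (fun t => re (F (mkC (re w) t))) (fun _ => 0) (im z) (im w)) as [t2 [_ e2]].
{ intros t ht; refine (proj2 (der (re w) t _)).
  revert ht; unfold Rmin, Rmax; destruct Rle_dec; lra. }
lra.
Qed.

Lemma mult_between (x y E d : R) : - E <= x <= E -> - d <= y <= d -> - (E * d) <= x * y <= E * d.
Proof.
intros hx hy; apply Rabs_le_between; rewrite Rabs_mult.
apply Rmult_le_compat; try apply Rabs_pos; apply Rabs_le_between; assumption.
Qed.

(** Its real part [sinh x cos y] is a harmonic barrier: positive for [x > 0] and [|y| < PI / 2],
    zero on the sides [x = 0] and [|y| = PI / 2]. *)
Definition Csinh (z : Cplx) : Cplx :=
  Cmul (RtoC (/ 2)) (Csub (Cexp z) (Cexp (Copp z))).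

Lemma re_Csinh (z : Cplx) : re (Csinh z) = sinh (re z) * cos (im z).
Proof. unfold Csinh, sinh; simpl; rewrite cos_neg; field. Qed.

Lemma holc_sinh (z : Cplx) : holc Csinh z.
Proof.
apply holc_mul; [apply holc_const|]; apply holc_sub; [apply holc_exp|].
apply (holc_comp Cexp Copp); [apply holc_exp|apply holc_opp].
Qed.

Lemma sinh_pos (x : R) : 0 < x -> 0 < sinh x.
Proof. intros h; unfold sinh; assert (exp (- x) < exp x) by (apply exp_increasing; lra); lra. Qed.

(* On a thin rectangle around the segment from [z1] to [z2] the function dominates a
   multiple of [re (Csinh (kappa (T - s)))], which is positive on the axis and vanishes on
   the three sides away from [z1]. *)
Lemma holc_strip_positive (F : Cplx -> Cplx) (a b : R) (z1 z2 : Cplx) :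
  (forall z, a < im z < b -> holc F z) -> (forall z, a < im z < b -> 0 <= re (F z)) ->
  a < im z1 < b -> a < im z2 < b -> 0 < re (F z1) -> 0 < re (F z2).
Proof.
intros hF pos hz1 hz2 p1.
set (e := Csub z2 z1).
pose (path := fun s => Cadd z1 (Cmul e s)).
pose (G := fun s => F (path s)).
set (mu := Rmin (Rmin (im z1 - a) (b - im z1)) (Rmin (im z2 - a) (b - im z2))).
assert (hmu : 0 < mu /\ mu <= im z1 - a /\ mu <= b - im z1 /\ mu <= im z2 - a /\ mu <= b - im z2).
{ unfold mu; repeat split; try (repeat apply Rmin_glb_lt; lra);
  unfold Rmin; repeat destruct Rle_dec; lra. }
set (E := Rabs (re e) + Rabs (im e) + 1).
assert (hE : 1 <= E) by (unfold E; pose proof (Rabs_pos (re e)); pose proof (Rabs_pos (im e)); lra).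
destruct (hol_continuity _ _ _ _ (hF z1 hz1)) as [cont _].
destruct (cont (mkposreal (re (F z1) / 2) ltac:(lra))) as [dl hdl]; simpl in hdl.
assert (hdlp := cond_pos dl).
(* Small enough that the rectangle around the segment stays in the strip and that [re F] exceeds
   half of [re (F z1)] on its left side. *)
set (r := Rmin (mu / (8 * E)) (dl / (2 * E))).
assert (hr : 0 < r /\ 8 * E * r <= mu /\ r * E < dl).
{ assert (0 < mu / (8 * E)) by (apply Rdiv_lt_0_compat; lra).
  assert (0 < dl / (2 * E)) by (apply Rdiv_lt_0_compat; lra).
  pose proof (Rmin_l (mu / (8 * E)) (dl / (2 * E))) as l1.
  pose proof (Rmin_r (mu / (8 * E)) (dl / (2 * E))) as l2.
  fold r in l1, l2; repeat split; [apply Rmin_glb_lt; lra| |].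
  - apply (Rmult_le_compat_l (8 * E)) in l1; [|lra].
    replace (8 * E * (mu / (8 * E))) with mu in l1 by (field; lra); lra.
  - apply (Rmult_le_compat_l E) in l2; [|lra].
    replace (E * (dl / (2 * E))) with (dl / 2) in l2 by (field; lra); lra. }
clearbody r mu.
assert (be : - E <= re e <= E /\ - E <= im e <= E).
{ pose proof (Rabs_pos (re e)); pose proof (Rabs_pos (im e)).
  pose proof (Rle_abs (re e)); pose proof (Rle_abs (im e)).
  pose proof (Rle_abs (- re e)); pose proof (Rle_abs (- im e)); rewrite !Rabs_Ropp in *.
  unfold E; lra. }
assert (inside : forall s, - (2 * r) < re s < 1 + 2 * r -> - (2 * r) < im s < 2 * r ->
  a < im (path s) < b).
{ intros s hs ht; change (im (path s)) with (im z1 + (re e * im s + im e * re s)).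
  assert (im z1 + im e = im z2) by (unfold e; simpl; ring).
  pose proof (mult_between (re e) (im s) E (2 * r) ltac:(lra) ltac:(lra)).
  destruct (Rlt_le_dec (re s) 0); [|destruct (Rlt_le_dec 1 (re s))].
  - pose proof (mult_between (im e) (re s) E (2 * r) ltac:(lra) ltac:(lra)); lra.
  - pose proof (mult_between (im e) (re s - 1) E (2 * r) ltac:(lra) ltac:(lra)); lra.
  - assert (mu <= im z1 + im e * re s - a).
    { replace (im z1 + im e * re s - a) with ((1 - re s) * (im z1 - a) + re s * (im z2 - a)) by (replace (im z2) with (im z1 + im e); ring).
      assert (0 <= (1 - re s) * (im z1 - a - mu)) by (apply Rmult_le_pos; lra).
      assert (0 <= re s * (im z2 - a - mu)) by (apply Rmult_le_pos; lra); lra. }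
    assert (mu <= b - (im z1 + im e * re s)).
    { replace (b - (im z1 + im e * re s)) with ((1 - re s) * (b - im z1) + re s * (b - im z2)) by (replace (im z2) with (im z1 + im e); ring).
      assert (0 <= (1 - re s) * (b - im z1 - mu)) by (apply Rmult_le_pos; lra).
      assert (0 <= re s * (b - im z2 - mu)) by (apply Rmult_le_pos; lra); lra. }
    lra. }
assert (hG : forall s, - (2 * r) < re s < 1 + 2 * r -> - (2 * r) < im s < 2 * r -> holc G s).
{ intros s hs ht; apply (holc_comp F path); [apply hF, inside; trivial|].
  apply holc_add; [apply holc_const|]; apply holc_mul; [apply holc_const|apply holc_id]. }
(* [T > 1] keeps the barrier positive at [s = 1], the parameter of [z2]; [kappa] puts its zeros at
   [im s = r] and [im s = - r]; [delta] keeps it below [re F] on the left side. *)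
set (T := 1 + r).
set (kappa := PI / (2 * r)).
assert (hk : 0 < kappa) by (apply Rdiv_lt_0_compat; [apply PI_RGT_0|lra]).
assert (kr : kappa * r = PI / 2) by (unfold kappa; field; lra).
set (delta := re (F z1) / 2 / sinh (kappa * T)).
assert (hsT : 0 < sinh (kappa * T)) by (apply sinh_pos, Rmult_lt_0_compat; unfold T; lra).
assert (hdelta : 0 < delta) by (apply Rdiv_lt_0_compat; lra).
pose (H := fun s => Csub (Cmul (RtoC delta) (Csinh (Cmul (RtoC kappa) (Csub (RtoC T) s)))) (G s)).
assert (reH : forall s, re (H s) = delta * (sinh (kappa * (T - re s)) * cos (kappa * im s)) - re (G s)).
{ intros s; unfold H; change (re (Csub ?p ?q)) with (re p + - re q).
  change (re (Cmul (RtoC delta) ?p)) with (delta * re p - 0 * im p); rewrite re_Csinh; simpl.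
  replace (kappa * (T + - re s) - 0 * (0 + - im s)) with (kappa * (T - re s)) by ring.
  replace (kappa * (0 + - im s) + 0 * (T + - re s)) with (- (kappa * im s)) by ring.
  rewrite cos_neg; ring. }
assert (posG : forall s, - (2 * r) < re s < 1 + 2 * r -> - (2 * r) < im s < 2 * r -> 0 <= re (G s)).
{ intros s hs ht; apply pos, inside; trivial. }
assert (key : re (H (RtoC 1)) <= 0).
{ apply (holc_rectangle_max H 0 T (- r) r (r / 2) 0); try lra.
  - intros s hs ht; apply holc_sub; [|apply hG; unfold T in hs; lra].
    apply holc_mul; [apply holc_const|].
    apply (holc_comp Csinh (fun s => Cmul (RtoC kappa) (Csub (RtoC T) s))); [apply holc_sinh|].
    apply holc_mul; [apply holc_const|]; apply holc_sub; [apply holc_const|apply holc_id].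
  - intros s [hs [ht hb]]; rewrite reH.
    assert (q : 0 <= re (G s)) by (apply posG; unfold T in hs; lra).
    assert (hcos : 0 <= cos (kappa * im s) <= 1).
    { split; [|apply COS_bound]; apply cos_ge_0; nra. }
    destruct hb as [hb|[hb|[hb|hb]]]; rewrite hb.
    + rewrite Rminus_0_r.
      assert (near : Rabs (re (G s) - re (F z1)) < re (F z1) / 2).
      { unfold G; rewrite <- (Cplx_eta (path s)), <- (Cplx_eta z1) at 1.
        rewrite (Cplx_eta z1) in hdl.
        assert (re (path s) = re z1 - im e * im s) by (unfold path; simpl; rewrite hb; ring).
        assert (im (path s) = im z1 + re e * im s) by (unfold path; simpl; rewrite hb; ring).
        pose proof (hdl (re (path s)) (im (path s))) as q'.
        rewrite (Cplx_eta (path s)) in q' |- *; rewrite ?Cplx_eta; apply q';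
        [replace (re (path s) - re z1) with (- (im e * im s)) by lra
        |replace (im (path s) - im z1) with (re e * im s) by lra];
        apply Rabs_def1; nra. }
      apply Rabs_def2 in near.
      assert (delta * (sinh (kappa * T) * cos (kappa * im s)) <= re (F z1) / 2); [|lra].
      replace (delta * (sinh (kappa * T) * cos (kappa * im s))) with
        (re (F z1) / 2 * cos (kappa * im s)) by (unfold delta; field; lra); nra.
    + replace (kappa * (T - T)) with 0 by ring; rewrite sinh_0; lra.
    + replace (kappa * - r) with (- (PI / 2)) by lra; rewrite cos_neg, cos_PI2; lra.
    + rewrite kr, cos_PI2; lra.
  - simpl; unfold T; lra.
  - simpl; lra. }
rewrite reH in key; simpl in key; rewrite Rmult_0_r, cos_0, Rmult_1_r in key.
replace (F z2) with (G (RtoC 1)).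
- assert (0 < sinh (kappa * (T - 1))).
  { apply sinh_pos, Rmult_lt_0_compat; unfold T; lra. }
  assert (0 < delta * sinh (kappa * (T - 1))) by (apply Rmult_lt_0_compat; lra); lra.
- unfold G, path, e; f_equal; change (RtoC 1) with C1; ring.
Qed.

(** * Herglotz functions on the slit plane *)

Lemma cos_double_atan (t : R) : cos (2 * atan t) = (1 - t ^ 2) / (1 + t ^ 2).
Proof.
assert (h : 0 < 1 + t ^ 2) by nra.
rewrite cos_2a, cos_atan, sin_atan.
assert (e : sqrt (1 + t²) * sqrt (1 + t²) = 1 + t ^ 2).
{ rewrite sqrt_sqrt; unfold Rsqr; nra. }
assert (sqrt (1 + t²) <> 0) by (intros z; rewrite z in e; lra).
rewrite <- e; field; trivial.
Qed.

Lemma sin_double_atan (t : R) : sin (2 * atan t) = 2 * t / (1 + t ^ 2).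
Proof.
assert (h : 0 < 1 + t ^ 2) by nra.
rewrite sin_2a, cos_atan, sin_atan.
assert (e : sqrt (1 + t²) * sqrt (1 + t²) = 1 + t ^ 2).
{ rewrite sqrt_sqrt; unfold Rsqr; nra. }
assert (sqrt (1 + t²) <> 0) by (intros z; rewrite z in e; lra).
rewrite <- e; field; trivial.
Qed.

Lemma Carg_bounds (z : Cplx) : - PI < Carg z < PI.
Proof.
unfold Carg; destruct (atan_bound (im z / (Cabs z + re z))); lra.
Qed.

Lemma Cexp_Clog (z : Cplx) : in_slit_plane z -> Cexp (Clog z) = z.
Proof.
intros hz; destruct (slit_plane_pos z hz) as [hn [hr hs]].
pose proof (Cabs_sqr z) as e; unfold Cnorm2 in e.
unfold Cexp, Clog, Carg; simpl; rewrite exp_ln, cos_double_atan, sin_double_atan by exact hr.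
set (r := Cabs z) in *.
assert (h : 1 + (im z / (r + re z)) ^ 2 = 2 * r / (r + re z)).
{ replace ((im z / (r + re z)) ^ 2) with ((im z * im z) / (r + re z) ^ 2) by (field; lra).
  replace (im z * im z) with ((r + re z) * (r - re z)) by lra; field; lra. }
rewrite h; apply Cplx_ext; cbn [re im].
- replace (1 - (im z / (r + re z)) ^ 2) with (2 - 2 * r / (r + re z)) by lra; field; lra.
- field; lra.
Qed.

Lemma Carg_trig (z : Cplx) : in_slit_plane z ->
  re z = Cabs z * cos (Carg z) /\ im z = Cabs z * sin (Carg z).
Proof.
intros hz; destruct (slit_plane_pos z hz) as [hn [hr hs]].
pose proof (Cexp_Clog z hz) as e; split.
- rewrite <- e at 1; simpl; rewrite exp_ln by exact hr; reflexivity.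
- rewrite <- e at 1; simpl; rewrite exp_ln by exact hr; reflexivity.
Qed.

Lemma Carg_upper (z : Cplx) : 0 < im z -> 0 < Carg z < PI.
Proof.
intros h; assert (hz : in_slit_plane z) by (right; lra).
destruct (slit_plane_pos z hz) as [_ [hr hs]]; split; [|apply Carg_bounds].
unfold Carg; assert (0 < atan (im z / (Cabs z + re z))); [|lra].
rewrite <- atan_0; apply atan_increasing, Rdiv_lt_0_compat; lra.
Qed.

Lemma Carg_real (z : Cplx) : im z = 0 -> Carg z = 0.
Proof. intros h; unfold Carg; rewrite h; unfold Rdiv; rewrite Rmult_0_l, atan_0; ring. Qed.

(* The strip [|im s| < PI] parametrises the slit plane, its subset [|im s| < PI / 2] the disc. *)
Definition cayley (s : Cplx) : Cplx := Cdiv (Csub (Cexp s) C1) (Cadd (Cexp s) C1).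

Lemma Cexp_add1_neq0 (s : Cplx) : - PI < im s < PI -> Cadd (Cexp s) C1 <> C0.
Proof.
intros h e; pose proof (f_equal re e) as e1; pose proof (f_equal im e) as e2; simpl in e1, e2.
pose proof (exp_pos (re s)).
assert (sn : sin (im s) = 0) by nra.
destruct (Req_dec (im s) 0) as [z|nz]; [rewrite z, cos_0 in e1; lra|].
destruct (Rlt_le_dec 0 (im s)) as [p|p].
- pose proof (sin_gt_0 (im s) p (proj2 h)); lra.
- pose proof (sin_lt_0_var (im s) (proj1 h) ltac:(lra)); lra.
Qed.

Lemma cayley_components (s : Cplx) : - PI < im s < PI ->
  let n := Cnorm2 (Cadd (Cexp s) C1) in 0 < n /\
  re (cayley s) = (exp (re s) * exp (re s) - 1) / n /\
  im (cayley s) = 2 * exp (re s) * sin (im s) / n.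
Proof.
intros h n; assert (hn : 0 < n) by (apply Cnorm2_gt0, Cexp_add1_neq0, h).
split; [exact hn|].
assert (sc := sin2_cos2 (im s)); unfold Rsqr in sc.
unfold cayley, Cdiv, Cinv; simpl; fold C1 n; change (Cnorm2 (Cadd (Cexp s) C1)) with n.
split; [|field; lra].
replace (exp (re s) * exp (re s) - 1) with
  (exp (re s) * exp (re s) * (sin (im s) * sin (im s) + cos (im s) * cos (im s)) - 1) by (rewrite sc; ring).
field; lra.
Qed.

Lemma cayley_im_sign (s : Cplx) : - PI < im s < PI ->
  (0 < im s -> 0 < im (cayley s)) /\ (im s < 0 -> im (cayley s) < 0) /\
  (im s = 0 -> im (cayley s) = 0).
Proof.
intros h; destruct (cayley_components s h) as [hn [_ e]]; rewrite e.
pose proof (exp_pos (re s)).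
assert (sg : forall t, 2 * exp (re s) * t / Cnorm2 (Cadd (Cexp s) C1) =
   t * (2 * exp (re s) / Cnorm2 (Cadd (Cexp s) C1))) by (intros; field; lra).
assert (0 < 2 * exp (re s) / Cnorm2 (Cadd (Cexp s) C1)) by (apply Rdiv_lt_0_compat; lra).
rewrite sg; repeat split; intros h0.
- apply Rmult_lt_0_compat; trivial; apply sin_gt_0; lra.
- pose proof (sin_lt_0_var (im s) (proj1 h) h0); nra.
- rewrite h0, sin_0; ring.
Qed.

Lemma cayley_in_slit (s : Cplx) : - PI < im s < PI -> in_slit (cayley s).
Proof.
intros h [h0 h1]; destruct (cayley_im_sign s h) as [sp [sn _]].
destruct (cayley_components s h) as [hn [e _]].
assert (im s = 0) by (destruct (Rtotal_order (im s) 0) as [l|[l|l]]; [apply sn in l; lra|exact l|apply sp in l; lra]).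
pose proof (exp_pos (re s)).
assert (en : Cnorm2 (Cadd (Cexp s) C1) = (exp (re s) + 1) ^ 2).
{ unfold Cnorm2; simpl; rewrite H, sin_0, cos_0; ring. }
assert (e' : re (cayley s) = 1 - 2 / (exp (re s) + 1)) by (rewrite e, en; field; lra).
assert (0 < 2 / (exp (re s) + 1)) by (apply Rdiv_lt_0_compat; lra).
assert (2 / (exp (re s) + 1) < 2).
{ apply (Rmult_lt_reg_r (exp (re s) + 1)); [lra|].
  replace (2 / (exp (re s) + 1) * (exp (re s) + 1)) with 2 by (field; lra); lra. }
lra.
Qed.

Lemma holc_cayley (s : Cplx) : - PI < im s < PI -> holc cayley s.
Proof.
intros h; apply holc_div; [apply Cexp_add1_neq0, h|..];
[apply holc_sub|apply holc_add]; apply holc_exp || apply holc_const.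
Qed.

(** This is [exp s] for the strip coordinate [s] of [z]; for [z] other than [1] its real part is
    positive exactly when [z] lies in the disc. *)
Definition cayley_arg (z : Cplx) : Cplx := Cdiv (Cadd C1 z) (Csub C1 z).

Lemma cayley_arg_components (z : Cplx) : z <> C1 ->
  let n := Cnorm2 (Csub C1 z) in 0 < n /\
  re (cayley_arg z) = (1 - Cnorm2 z) / n /\ im (cayley_arg z) = 2 * im z / n.
Proof.
intros h n.
assert (hn : 0 < n).
{ apply Cnorm2_gt0; intros e; apply h; replace z with (Csub C1 (Csub C1 z)) by ring.
  rewrite e; ring. }
split; [exact hn|].
unfold cayley_arg, Cdiv, Cinv; fold n; unfold Cnorm2; simpl; split; field; lra.
Qed.

Lemma cayley_arg_slit_plane (z : Cplx) : in_slit z -> in_slit_plane (cayley_arg z).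
Proof.
intros h; assert (h1 : z <> C1) by (intros e; apply h; rewrite e; simpl; lra).
destruct (cayley_arg_components z h1) as [hn [e1 e2]]; unfold in_slit_plane; rewrite e1, e2.
destruct (Req_dec (im z) 0) as [e|ne].
- left; apply Rdiv_lt_0_compat; trivial; unfold Cnorm2; rewrite e.
  assert (-1 < re z < 1); [|nra].
  split; apply Rnot_le_lt; intros ?; apply h; split; trivial; [left|right]; lra.
- right; intros e; apply ne.
  apply (Rmult_eq_compat_r (Cnorm2 (Csub C1 z))) in e.
  replace (2 * im z / Cnorm2 (Csub C1 z) * Cnorm2 (Csub C1 z)) with (2 * im z) in e by (field; lra); lra.
Qed.

Lemma cayley_surj (z : Cplx) : in_slit z -> exists s, - PI < im s < PI /\ cayley s = z /\
  Cexp s = cayley_arg z.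
Proof.
intros h; exists (Clog (cayley_arg z)).
assert (h1 : Csub C1 z <> C0).
{ intros e; apply h; replace z with (Csub C1 (Csub C1 z)) by ring; rewrite e; simpl; lra. }
split; [apply Carg_bounds|]; unfold cayley; rewrite Cexp_Clog by (apply cayley_arg_slit_plane, h).
split; [|reflexivity].
assert (C1 <> C0) by (intros e; apply (f_equal re) in e; simpl in e; lra).
unfold cayley_arg; field; split; [exact h1|].
intros e; assert (e' : Cadd C1 C1 = C0).
{ replace (Cadd C1 C1) with (Cadd (Cadd C1 z) (Csub C1 z)) by ring; exact e. }
apply (f_equal re) in e'; simpl in e'; lra.
Qed.

(** The scalar functions [<W v, v>]. No symmetry under conjugation is recorded: reality on [(-1, 1)]
    follows from the two sign conditions by continuity. *)
Definition slit_herglotz (w : Cplx -> Cplx) (p q : R) : Prop :=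
  (forall z, in_slit z -> holc w z) /\
  (forall z, 0 < im z -> 0 <= im (w z)) /\ (forall z, im z < 0 -> im (w z) <= 0) /\
  (forall eps, 0 < eps -> exists delta, 0 < delta /\
     forall x, 1 - delta < x < 1 -> -1 < x -> Rabs (re (w (RtoC x)) - q) < eps) /\
  (forall eps, 0 < eps -> exists delta, 0 < delta /\
     forall x, -1 < x < -1 + delta -> x < 1 -> Rabs (re (w (RtoC x)) - p) < eps).

Lemma in_slit_real (x : R) : -1 < x < 1 -> in_slit (RtoC x).
Proof. unfold in_slit; simpl; lra. Qed.

Lemma in_slit_im (z : Cplx) : im z <> 0 -> in_slit z.
Proof. unfold in_slit; tauto. Qed.

Lemma slit_herglotz_real (w : Cplx -> Cplx) (p q x : R) : slit_herglotz w p q ->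
  -1 < x < 1 -> im (w (RtoC x)) = 0.
Proof.
intros [hw [up [lo _]]] hx.
destruct (hol_continuity _ _ _ _ (hw _ (in_slit_real x hx))) as [_ cont]; simpl in cont.
destruct (Rtotal_order (im (w (RtoC x))) 0) as [h|[h|h]]; trivial; exfalso.
- destruct (cont (mkposreal (- im (w (RtoC x))) ltac:(lra))) as [d hd]; simpl in hd.
  pose proof (cond_pos d).
  specialize (hd x (d / 2) ltac:(rewrite Rminus_diag, Rabs_R0; lra)
     ltac:(rewrite Rminus_0_r, Rabs_pos_eq; lra)).
  specialize (up (mkC x (d / 2)) ltac:(simpl; lra)).
  apply Rabs_def2 in hd; unfold RtoC in *; lra.
- destruct (cont (mkposreal (im (w (RtoC x))) h)) as [d hd]; simpl in hd.
  pose proof (cond_pos d).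
  specialize (hd x (- (d / 2)) ltac:(rewrite Rminus_diag, Rabs_R0; lra)
     ltac:(rewrite Rminus_0_r, Rabs_Ropp, Rabs_pos_eq; lra)).
  specialize (lo (mkC x (- (d / 2))) ltac:(simpl; lra)).
  apply Rabs_def2 in hd; unfold RtoC in *; lra.
Qed.

(* By the Cauchy-Riemann equations the derivative on the real axis is the normal
   derivative of the imaginary part. *)
Lemma slit_herglotz_incr (w : Cplx -> Cplx) (p q x y : R) : slit_herglotz w p q ->
  -1 < x -> x <= y -> y < 1 -> re (w (RtoC x)) <= re (w (RtoC y)).
Proof.
intros H hx hxy hy; pose proof H as [hw [up _]].
assert (der : forall t, -1 < t < 1 -> exists l, 0 <= l /\ is_derive (fun s => re (w (RtoC s))) t l).
{ intros t ht; destruct (hw _ (in_slit_real t ht)) as [a [b [h1 h2]]]; simpl in *.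
  exists a; split; [|exact (differentiable_pt_lim_derive_l _ _ _ _ _ h1)].
  apply differentiable_pt_lim_derive_r, is_derive_Reals in h2.
  apply Rnot_lt_le; intros ha.
  destruct (h2 (- a) ltac:(lra)) as [d hd]; pose proof (cond_pos d).
  specialize (hd (d / 2) ltac:(lra) ltac:(rewrite Rabs_pos_eq; lra)).
  assert (e0 := slit_herglotz_real w p q t H ht); unfold RtoC in e0; rewrite e0 in hd.
  specialize (up (mkC t (0 + d / 2)) ltac:(simpl; lra)).
  apply Rabs_def2 in hd.
  assert (0 <= (im (w (mkC t (0 + d / 2))) - 0) / (d / 2)).
  { apply Rmult_le_pos; [lra|apply Rlt_le, Rinv_0_lt_compat; lra]. }
  lra. }
destruct (MVT_is_derive (fun s => re (w (RtoC s))) (fun s => Derive (fun s => re (w (RtoC s))) s) x y)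
  as [t [ht e]].
{ rewrite Rmin_left, Rmax_right by lra; intros t ht; destruct (der t ltac:(lra)) as [l [_ hl]].
  apply Derive_correct; exists l; exact hl. }
rewrite Rmin_left, Rmax_right in ht by lra.
destruct (der t ltac:(lra)) as [l [l0 hl]]; 
assert (el : Derive (fun s => re (w (RtoC s))) t = l) by (apply is_derive_unique; exact hl).
cbv beta in e; rewrite el in e; nra.
Qed.

Lemma slit_herglotz_range (w : Cplx -> Cplx) (p q x : R) : slit_herglotz w p q ->
  -1 < x < 1 -> p <= re (w (RtoC x)) <= q.
Proof.
intros H hx; pose proof H as [_ [_ [_ [lq lp]]]]; split; apply Rnot_lt_le; intros lt.
- destruct (lp (p - re (w (RtoC x))) ltac:(lra)) as [d [hd near]].
  set (t := Rmin x (-1 + d / 2)).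
  assert (-1 < t /\ t <= x /\ t < -1 + d).
  { unfold t; repeat split; [apply Rmin_glb_lt; lra|apply Rmin_l|].
    pose proof (Rmin_r x (-1 + d / 2)); lra. }
  specialize (near t ltac:(lra) ltac:(lra)); apply Rabs_def2 in near.
  pose proof (slit_herglotz_incr w p q t x H ltac:(lra) ltac:(lra) ltac:(lra)); lra.
- destruct (lq (re (w (RtoC x)) - q) ltac:(lra)) as [d [hd near]].
  set (t := Rmax x (1 - d / 2)).
  assert (t < 1 /\ x <= t /\ 1 - d < t).
  { unfold t; repeat split; [apply Rmax_lub_lt; lra|apply Rmax_l|].
    pose proof (Rmax_r x (1 - d / 2)); lra. }
  specialize (near t ltac:(lra) ltac:(lra)); apply Rabs_def2 in near.
  pose proof (slit_herglotz_incr w p q x t H ltac:(lra) ltac:(lra) ltac:(lra)); lra.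
Qed.

(** Removes the perturbation [eps] from the cone inequality, which is polynomial in [eps]. *)
Lemma ge0_at_right_limit (f : R -> R) : ex_derive f 0 ->
  (forall eps, 0 < eps -> 0 <= f eps) -> 0 <= f 0.
Proof.
intros hf pos; apply Rnot_lt_le; intros lt.
assert (c : continuity_pt f 0) by (apply continuity_pt_filterlim, (@ex_derive_continuous _ R_NormedModule), hf).
destruct (c (- f 0) ltac:(lra)) as [d [hd near]].
specialize (near (d / 2)); unfold D_x, no_cond, dist in near; simpl in near.
assert (h : Rabs (f (d / 2) - f 0) < - f 0).
{ apply near; repeat split; [lra|unfold Rdist; rewrite Rminus_0_r, Rabs_pos_eq; lra]. }
apply Rabs_def2 in h; specialize (pos (d / 2) ltac:(lra)); lra.
Qed.

(** For [p < q] this Moebius map sends [(p, q)] to the positive axis, preserves the upper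
    half-plane, and sends the disc with diameter [[p, q]] to the right half-plane. *)
Definition interval_ratio (p q : R) (w : Cplx) : Cplx :=
  Cdiv (Csub w (RtoC p)) (Csub (RtoC q) w).

Lemma interval_ratio_components (p q : R) (w : Cplx) : Csub (RtoC q) w <> C0 ->
  let n := Cnorm2 (Csub (RtoC q) w) in 0 < n /\
  re (interval_ratio p q w) = ((re w - p) * (q - re w) - im w * im w) / n /\
  im (interval_ratio p q w) = (q - p) * im w / n.
Proof.
intros h n; assert (hn : 0 < n) by (apply Cnorm2_gt0, h); split; [exact hn|].
unfold interval_ratio, Cdiv, Cinv; fold n; simpl; split; field; lra.
Qed.

(* In the strip this says [arg Z <= im s], where [Z = (w - p) / (q - w)]; it follows from the
   maximum principle for the perturbation [w + eps z], which avoids the slits strictly. *)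
Lemma slit_cone_upper (w : Cplx -> Cplx) (p q : R) (s : Cplx) :
  slit_herglotz w p q -> 0 < im s < PI ->
  (q - p) * im (w (cayley s)) * cos (im s) <=
  ((re (w (cayley s)) - p) * (q - re (w (cayley s))) -
   im (w (cayley s)) * im (w (cayley s))) * sin (im s).
Proof.
intros H hs; pose proof H as [hw [up [lo _]]].
assert (pq : p <= q) by (pose proof (slit_herglotz_range w p q 0 H ltac:(lra)); lra).
set (c := w (cayley s)).
(* The claimed inequality for [w + eps z] and the interval [[p - 2 eps, q + 2 eps]], cleared of
   denominators. *)
pose (f := fun eps => ((re c + eps * re (cayley s) - (p - 2 * eps)) *
   (q + 2 * eps - (re c + eps * re (cayley s))) -
   (im c + eps * im (cayley s)) * (im c + eps * im (cayley s))) * sin (im s) -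
   (q + 2 * eps - (p - 2 * eps)) * (im c + eps * im (cayley s)) * cos (im s)).
assert (lim : 0 <= f 0); [|unfold f in lim; rewrite !Rmult_0_l, !Rmult_0_r, !Rplus_0_r, !Rminus_0_r in lim; lra].
apply ge0_at_right_limit; [unfold f; auto_derive; trivial|].
intros eps he; unfold f.
(* On the real axis [|z| < 1], so [eps z] moves the values by less than [eps] and they stay strictly
   inside the enlarged interval. *)
set (p' := p - 2 * eps); set (q' := q + 2 * eps).
pose (we := fun t => Cadd (w (cayley t)) (Cmul (RtoC eps) (cayley t))).
assert (rew : forall t, re (we t) = re (w (cayley t)) + eps * re (cayley t)) by (intros; simpl; ring).
assert (imw : forall t, im (we t) = im (w (cayley t)) + eps * im (cayley t)) by (intros; simpl; ring).
assert (we_up : forall t, 0 < im t < PI -> 0 < im (we t)).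
{ intros t ht; rewrite imw; destruct (cayley_im_sign t ltac:(lra)) as [h _].
  specialize (h (proj1 ht)); specialize (up (cayley t) h).
  assert (0 < eps * im (cayley t)) by (apply Rmult_lt_0_compat; lra); lra. }
assert (we_lo : forall t, - PI < im t < 0 -> im (we t) < 0).
{ intros t ht; rewrite imw; destruct (cayley_im_sign t ltac:(lra)) as [_ [h _]].
  specialize (h (proj2 ht)); specialize (lo (cayley t) h); nra. }
assert (we_real : forall t, im t = 0 -> im (we t) = 0 /\ p' < re (we t) < q').
{ intros t ht; rewrite imw, rew; destruct (cayley_im_sign t ltac:(rewrite ht; pose proof PI_RGT_0; lra)) as [_ [_ h]].
  specialize (h ht); pose proof (cayley_in_slit t ltac:(rewrite ht; pose proof PI_RGT_0; lra)) as sl.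
  assert (ec : cayley t = RtoC (re (cayley t))) by (apply Cplx_ext; [reflexivity|exact h]).
  assert (b : -1 < re (cayley t) < 1).
  { split; apply Rnot_le_lt; intros ?; apply sl; split; trivial; [left|right]; lra. }
  set (x := re (cayley t)) in *; clearbody x; rewrite ec; change (re (RtoC x)) with x.
  change (im (RtoC x)) with 0; rewrite (slit_herglotz_real w p q _ H b).
  pose proof (slit_herglotz_range w p q _ H b); unfold p', q'; split; [ring|]; nra. }
assert (ne : forall t, - PI < im t < PI -> Csub (RtoC q') (we t) <> C0).
{ intros t ht e; pose proof (f_equal im e) as e1; pose proof (f_equal re e) as e2; simpl in e1, e2.
  destruct (Rtotal_order (im t) 0) as [h|[h|h]].
  - specialize (we_lo t ltac:(lra)); simpl in we_lo; lra.
  - specialize (we_real t h); simpl in we_real; lra.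
  - specialize (we_up t ltac:(lra)); simpl in we_up; lra. }
pose (Z := fun t => interval_ratio p' q' (we t)).
assert (hpq : 0 < q' - p') by (unfold p', q'; lra).
assert (Zup : forall t, 0 < im t < PI -> 0 < im (Z t)).
{ intros t ht; destruct (interval_ratio_components p' q' (we t) (ne t ltac:(lra))) as [hn [_ e]].
  unfold Z; rewrite e; apply Rdiv_lt_0_compat; trivial; apply Rmult_lt_0_compat; trivial; apply we_up, ht. }
assert (Zslit : forall t, - PI < im t < PI -> in_slit_plane (Z t)).
{ intros t ht; destruct (interval_ratio_components p' q' (we t) (ne t ht)) as [hn [e1 e2]].
  destruct (Rtotal_order (im t) 0) as [h|[h|h]].
  - right; unfold Z; rewrite e2; specialize (we_lo t ltac:(lra)).
    assert (0 < / Cnorm2 (Csub (RtoC q') (we t))) by (apply Rinv_0_lt_compat; lra).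
    unfold Rdiv; apply Rlt_not_eq; assert ((q' - p') * im (we t) < 0) by nra; nra.
  - left; unfold Z; rewrite e1; destruct (we_real t h) as [h1 h2]; rewrite h1.
    apply Rdiv_lt_0_compat; trivial; nra.
  - right; specialize (Zup t ltac:(lra)); lra. }
assert (hZ : forall t, - PI < im t < PI -> holc Z t).
{ intros t ht; assert (holc we t).
  { apply holc_add; [apply (holc_comp w cayley); [apply hw, cayley_in_slit, ht|apply holc_cayley, ht]|].
    apply holc_mul; [apply holc_const|apply holc_cayley, ht]. }
  apply holc_div; [apply ne, ht|..]; apply holc_sub; trivial; apply holc_const. }
pose (F := fun t => Cmul (Copp Ci) (Csub (Clog (Z t)) t)).
assert (reF : forall t, re (F t) = Carg (Z t) - im t) by (intros; simpl; ring).
assert (argle : Carg (Z s) <= im s).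
{ apply Rnot_lt_le; intros lt.
  (* At [im t = PI] the function [cayley] leaves the slit plane. On the lower edge
     [im t = PI - delta] the bound [arg Z < PI] costs only [delta]. *)
  set (delta := Rmin ((Carg (Z s) - im s) / 2) (PI - im s)).
  assert (hd : 0 < delta /\ delta <= (Carg (Z s) - im s) / 2 /\ delta <= PI - im s).
  { unfold delta; split; [apply Rmin_glb_lt; lra|split; [apply Rmin_l|apply Rmin_r]]. }
  assert (key : re (F s) <= delta); [|rewrite reF in key; lra].
  apply (holc_strip_max F 0 (PI - delta) (delta / 2) delta PI); try lra.
  - intros t ht; apply holc_mul; [apply holc_const|apply holc_sub; [|apply holc_id]].
    apply (holc_comp Clog Z); [apply holc_log, Zslit; lra|apply hZ; lra].
  - intros t ht; rewrite reF; pose proof (Carg_bounds (Z t)); lra.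
  - intros t ht [h|h]; rewrite reF, h; [|pose proof (Carg_bounds (Z t)); lra].
    rewrite Carg_real; [lra|].
    destruct (interval_ratio_components p' q' (we t) (ne t ltac:(lra))) as [hn [_ e]].
    unfold Z; rewrite e; destruct (we_real t h) as [-> _]; unfold Rdiv; ring. }
pose proof (Carg_upper (Z s) (Zup s hs)) as hA.
destruct (Carg_trig (Z s) (Zslit s ltac:(lra))) as [t1 t2].
assert (sn : 0 <= sin (im s - Carg (Z s))) by (apply sin_ge_0; lra).
rewrite sin_minus in sn.
assert (ab := Cabs_ge0 (Z s)).
assert (key : 0 <= sin (im s) * re (Z s) - cos (im s) * im (Z s)).
{ rewrite t1, t2.
  replace (sin (im s) * (Cabs (Z s) * cos (Carg (Z s))) - cos (im s) * (Cabs (Z s) * sin (Carg (Z s))))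
   with (Cabs (Z s) * (sin (im s) * cos (Carg (Z s)) - cos (im s) * sin (Carg (Z s)))) by ring.
  apply Rmult_le_pos; trivial. }
destruct (interval_ratio_components p' q' (we s) (ne s ltac:(lra))) as [hn [e1 e2]].
unfold Z in key; rewrite e1, e2 in key; rewrite rew, imw in key; fold c in key.
set (n := Cnorm2 (Csub (RtoC q') (we s))) in *.
match type of key with 0 <= sin _ * (?a / n) - cos _ * (?b / n) =>
  replace (sin (im s) * (a / n) - cos (im s) * (b / n)) with ((a * sin (im s) - b * cos (im s)) / n) in key
    by (field; lra) end.
apply (Rmult_le_compat_r n) in key; [|lra].
rewrite Rmult_0_l in key; unfold Rdiv in key; rewrite Rmult_assoc, Rinv_l, Rmult_1_r in key by lra.
exact key.
Qed.

(** In the closed disc [cos (im s) >= 0], so the left side of [slit_cone_upper] is nonnegative;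
    division by [sin (im s) > 0] leaves the disc with diameter [[p, q]]. *)
Lemma slit_cone_upper_disc (w : Cplx -> Cplx) (p q : R) (z : Cplx) :
  slit_herglotz w p q -> 0 < im z -> Cnorm2 z <= 1 ->
  im (w z) * im (w z) <= (re (w z) - p) * (q - re (w z)).
Proof.
intros H hz hn; pose proof H as [_ [up _]].
assert (pq : p <= q) by (pose proof (slit_herglotz_range w p q 0 H ltac:(lra)); lra).
destruct (cayley_surj z (in_slit_im z ltac:(lra))) as [s [hs [e1 e2]]].
assert (h1 : z <> C1) by (intros e; rewrite e in hz; simpl in hz; lra).
destruct (cayley_arg_components z h1) as [hd [c1 c2]]; rewrite <- e2 in c1, c2.
change (re (Cexp s)) with (exp (re s) * cos (im s)) in c1.
change (im (Cexp s)) with (exp (re s) * sin (im s)) in c2.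
pose proof (exp_pos (re s)) as ep.
assert (sn : 0 < sin (im s)).
{ apply (Rmult_lt_reg_l (exp (re s))); trivial; rewrite Rmult_0_r, c2; apply Rdiv_lt_0_compat; lra. }
assert (cs : 0 <= cos (im s)).
{ apply (Rmult_le_reg_l (exp (re s))); trivial; rewrite Rmult_0_r, c1.
  apply Rmult_le_pos; [lra|apply Rlt_le, Rinv_0_lt_compat, hd]. }
assert (him : 0 < im s < PI).
{ split; [|lra]; apply Rnot_le_lt; intros le; destruct (Req_dec (im s) 0) as [z0|nz].
  - rewrite z0, sin_0 in sn; lra.
  - pose proof (sin_lt_0_var (im s) (proj1 hs) ltac:(lra)); lra. }
pose proof (slit_cone_upper w p q s H him) as cone; rewrite e1 in cone.
specialize (up z hz).
assert (0 <= (q - p) * im (w z) * cos (im s)) by (repeat apply Rmult_le_pos; lra).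
assert (0 <= (re (w z) - p) * (q - re (w z)) - im (w z) * im (w z)); [|lra].
apply (Rmult_le_reg_r (sin (im s))); trivial; lra.
Qed.

(** This symmetry carries the cone condition from the upper to the lower half-plane. *)
Lemma slit_herglotz_neg (w : Cplx -> Cplx) (p q : R) : slit_herglotz w p q ->
  slit_herglotz (fun z => Copp (w (Copp z))) (- q) (- p).
Proof.
intros [hw [up [lo [lq lp]]]]; repeat split.
- intros z hz.
  apply (holc_comp Copp (fun z => w (Copp z))); [apply holc_opp|].
  apply (holc_comp w Copp); [|apply holc_opp].
  apply hw; intros [h1 h2]; apply hz; simpl in h1, h2; split; lra.
- intros z hz; simpl; specialize (lo (Copp z) ltac:(simpl; lra)); lra.
- intros z hz; simpl; specialize (up (Copp z) ltac:(simpl; lra)); lra.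
- intros eps he; destruct (lp eps he) as [d [hd near]]; exists d; split; trivial.
  intros x h1 h2; specialize (near (- x) ltac:(lra) ltac:(lra)).
  replace (Copp (RtoC x)) with (RtoC (- x)) by (apply Cplx_ext; simpl; ring); simpl.
  rewrite <- Rabs_Ropp; replace (- (- re (w (RtoC (- x))) - - p)) with (re (w (RtoC (- x))) - p) by ring; exact near.
- intros eps he; destruct (lq eps he) as [d [hd near]]; exists d; split; trivial.
  intros x h1 h2; specialize (near (- x) ltac:(lra) ltac:(lra)).
  replace (Copp (RtoC x)) with (RtoC (- x)) by (apply Cplx_ext; simpl; ring); simpl.
  rewrite <- Rabs_Ropp; replace (- (- re (w (RtoC (- x))) - - q)) with (re (w (RtoC (- x))) - q) by ring; exact near.
Qed.

Lemma slit_cone_disc (w : Cplx -> Cplx) (p q : R) (z : Cplx) :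
  slit_herglotz w p q -> in_slit z -> Cnorm2 z <= 1 ->
  Cabs (Csub (w z) (RtoC ((p + q) / 2))) <= (q - p) / 2.
Proof.
intros H hz hn.
assert (pq : p <= q) by (pose proof (slit_herglotz_range w p q 0 H ltac:(lra)); lra).
assert (key : im (w z) * im (w z) <= (re (w z) - p) * (q - re (w z))).
{ destruct (Rtotal_order (im z) 0) as [h|[h|h]].
  - assert (c := slit_cone_upper_disc _ _ _ (Copp z) (slit_herglotz_neg w p q H) ltac:(simpl; lra)
      ltac:(unfold Cnorm2 in *; simpl; lra)).
    assert (ezz : Copp (Copp z) = z) by ring; cbv beta in c; rewrite ezz in c; simpl in c; lra.
  - assert (ez : z = RtoC (re z)) by (apply Cplx_ext; [reflexivity|exact h]).
    assert (b : -1 < re z < 1).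
    { split; apply Rnot_le_lt; intros ?; apply hz; split; trivial; [left|right]; lra. }
    rewrite ez, (slit_herglotz_real w p q _ H b).
    pose proof (slit_herglotz_range w p q _ H b); rewrite Rmult_0_l; apply Rmult_le_pos; lra.
  - apply slit_cone_upper_disc; assumption. }
replace ((q - p) / 2) with (sqrt ((q - p) / 2 * ((q - p) / 2))) by (apply sqrt_square; lra).
apply sqrt_le_1_alt; unfold Cnorm2; simpl; lra.
Qed.

Lemma cayley_surj_upper (z : Cplx) : 0 < im z -> exists s, 0 < im s < PI /\ cayley s = z /\
  Cexp s = cayley_arg z.
Proof.
intros hz; destruct (cayley_surj z (in_slit_im z ltac:(lra))) as [s [hs [e1 e2]]].
exists s; repeat split; trivial; [|lra].
destruct (cayley_im_sign s hs) as [_ [n0 z0]]; rewrite e1 in n0, z0.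
destruct (Rtotal_order (im s) 0) as [h|[h|h]]; [apply n0 in h|apply z0 in h|]; lra.
Qed.

(** If [im w] vanished at one point, [holc_strip_positive] would make it vanish on the whole upper
    half-plane. Then [w] would be constant there, hence on [(-1, 1)] by continuity, against the
    distinct limits [p] and [q]. *)
Lemma slit_herglotz_im_pos (w : Cplx -> Cplx) (p q : R) (z : Cplx) :
  slit_herglotz w p q -> p < q -> 0 < im z -> 0 < im (w z).
Proof.
intros H pq hz; pose proof H as [hw [up [_ [lq lp]]]].
destruct (up z hz) as [h|h]; trivial; exfalso.
destruct (cayley_surj_upper z hz) as [s [hs [es _]]].
pose (g := fun t => w (cayley t)).
assert (hg : forall t, 0 < im t < PI -> holc g t).
{ intros t ht; apply (holc_comp w cayley); [apply hw, cayley_in_slit|apply holc_cayley]; lra. }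
assert (upc : forall t, 0 < im t < PI -> 0 < im (cayley t)).
{ intros t ht; apply (cayley_im_sign t); lra. }
assert (im0 : forall t, 0 < im t < PI -> im (g t) = 0).
{ intros t ht; destruct (up (cayley t) (upc t ht)) as [lt|eq]; [|symmetry; exact eq].
  assert (pos : 0 < re (Cmul (Copp Ci) (g s))).
  { apply (holc_strip_positive (fun t => Cmul (Copp Ci) (g t)) 0 PI t s); trivial.
    - intros r hr; apply holc_mul; [apply holc_const|apply hg, hr].
    - intros r hr; simpl; specialize (up (cayley r) (upc r hr)); unfold g; lra.
    - unfold g; simpl; lra. }
  simpl in pos; unfold g in pos; rewrite es in pos; lra. }
assert (cst : forall z', 0 < im z' -> w z' = w z).
{ intros z' hz'; destruct (cayley_surj_upper z' hz') as [s' [hs' [es' _]]].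
  rewrite <- es, <- es'; apply (holc_real_const g 0 PI hg im0); trivial. }
assert (cstr : forall x, -1 < x < 1 -> re (w (RtoC x)) = re (w z)).
{ intros x hx; destruct (hol_continuity _ _ _ _ (hw _ (in_slit_real x hx))) as [cont _].
  apply cond_eq; intros eps he.
  destruct (cont (mkposreal eps he)) as [d hd]; simpl in hd; pose proof (cond_pos d).
  specialize (hd x (d / 2) ltac:(rewrite Rminus_diag, Rabs_R0; lra)
     ltac:(rewrite Rminus_0_r, Rabs_pos_eq; lra)).
  rewrite (cst (mkC x (d / 2))) in hd by (simpl; lra).
  rewrite Rabs_minus_sym; exact hd. }
destruct (lq ((q - p) / 2) ltac:(lra)) as [d1 [hd1 n1]].
destruct (lp ((q - p) / 2) ltac:(lra)) as [d2 [hd2 n2]].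
pose proof (Rmax_l 0 (1 - d1 / 2)); pose proof (Rmax_r 0 (1 - d1 / 2)).
pose proof (Rmax_l 0 (1 - d2 / 2)); pose proof (Rmax_r 0 (1 - d2 / 2)).
assert (m1 : Rmax 0 (1 - d1 / 2) < 1) by (apply Rmax_lub_lt; lra).
assert (m2 : Rmax 0 (1 - d2 / 2) < 1) by (apply Rmax_lub_lt; lra).
specialize (n1 (Rmax 0 (1 - d1 / 2)) ltac:(lra) ltac:(lra)).
specialize (n2 (- Rmax 0 (1 - d2 / 2)) ltac:(lra) ltac:(lra)).
rewrite cstr in n1, n2 by lra.
apply Rabs_def2 in n1; apply Rabs_def2 in n2; lra.
Qed.

Lemma RtoC_add (x y : R) : RtoC (x + y) = Cadd (RtoC x) (RtoC y).
Proof. apply Cplx_ext; simpl; ring. Qed.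

Lemma RtoC_sub (x y : R) : RtoC (x - y) = Csub (RtoC x) (RtoC y).
Proof. apply Cplx_ext; simpl; ring. Qed.

Lemma RtoC_neq0 (x : R) : x <> 0 -> RtoC x <> C0.
Proof. intros h e; apply (f_equal re) in e; exact (h e). Qed.

Lemma RtoC_div (x y : R) : y <> 0 -> RtoC (x / y) = Cdiv (RtoC x) (RtoC y).
Proof.
intros h; apply Cplx_ext; unfold Cdiv, Cinv, Cnorm2; simpl; field; lra.
Qed.

(* Equality in the cone condition at one point makes the nonnegative harmonic function
   [im s - arg Z] vanish identically, where [Z] is the image of [w] in the half-plane. *)
Lemma slit_herglotz_rigidity (w : Cplx -> Cplx) (p q : R) :
  slit_herglotz w p q -> p < q ->
  im (w Ci) * im (w Ci) = (re (w Ci) - p) * (q - re (w Ci)) ->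
  exists a, -1 < a < 1 /\ forall z, 0 < im z ->
    Csub (w z) (RtoC ((p + q) / 2)) = Cmul (RtoC ((q - p) / 2)) (blaschke a z).
Proof.
intros H pq heq; pose proof H as [hw _].
assert (pos : forall t, 0 < im t < PI -> 0 < im (w (cayley t))).
{ intros t ht; apply (slit_herglotz_im_pos w p q); trivial; apply (cayley_im_sign t); lra. }
assert (ne : forall t, 0 < im t < PI -> Csub (RtoC q) (w (cayley t)) <> C0).
{ intros t ht e; apply (f_equal im) in e; simpl in e; specialize (pos t ht); lra. }
pose (Z := fun t => interval_ratio p q (w (cayley t))).
assert (Zup : forall t, 0 < im t < PI -> 0 < im (Z t)).
{ intros t ht; destruct (interval_ratio_components p q _ (ne t ht)) as [hn [_ e]].
  unfold Z; rewrite e; apply Rdiv_lt_0_compat; trivial; apply Rmult_lt_0_compat; [lra|apply pos, ht]. }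
assert (hZ : forall t, 0 < im t < PI -> holc Z t).
{ intros t ht; assert (holc (fun t => w (cayley t)) t).
  { apply (holc_comp w cayley); [apply hw, cayley_in_slit|apply holc_cayley]; lra. }
  apply holc_div; [apply ne, ht|..]; apply holc_sub; trivial; apply holc_const. }
pose (F := fun t => Csub (Clog (Z t)) t).
assert (hF : forall t, 0 < im t < PI -> holc F t).
{ intros t ht; apply holc_sub; [|apply holc_id].
  apply (holc_comp Clog Z); [apply holc_log; right; specialize (Zup t ht); lra|apply hZ, ht]. }
assert (argle : forall t, 0 < im t < PI -> Carg (Z t) <= im t).
{ intros t ht; pose proof (Carg_upper _ (Zup t ht)) as hA.
  assert (Zs : in_slit_plane (Z t)) by (right; specialize (Zup t ht); lra).
  destruct (Carg_trig (Z t) Zs) as [t1 t2].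
  destruct (slit_plane_pos _ Zs) as [_ [ab _]].
  destruct (interval_ratio_components p q _ (ne t ht)) as [hn [e1 e2]].
  change (interval_ratio p q (w (cayley t))) with (Z t) in e1, e2.
  pose proof (slit_cone_upper w p q t H ht) as cone.
  set (n := Cnorm2 (Csub (RtoC q) (w (cayley t)))) in *.
  assert (c' : 0 <= re (Z t) * sin (im t) - im (Z t) * cos (im t)).
  { rewrite e1, e2.
    match goal with |- 0 <= ?a / n * _ - ?b / n * _ =>
      replace (a / n * sin (im t) - b / n * cos (im t)) with
        ((a * sin (im t) - b * cos (im t)) / n) by (field; lra) end.
    apply Rmult_le_pos; [lra|apply Rlt_le, Rinv_0_lt_compat, hn]. }
  rewrite t1, t2 in c'.
  assert (sn : 0 <= sin (im t - Carg (Z t))).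
  { rewrite sin_minus; apply (Rmult_le_reg_l (Cabs (Z t))); trivial; lra. }
  apply Rnot_lt_le; intros lt.
  pose proof (sin_lt_0_var (im t - Carg (Z t)) ltac:(lra) ltac:(lra)); lra. }
(* The strip coordinate of [i]. The assumed equality makes [Z s0] purely imaginary, so [arg Z]
   touches [im s] there. *)
set (s0 := mkC 0 (PI / 2)).
assert (hs0 : 0 < im s0 < PI) by (simpl; pose proof PI_RGT_0; lra).
assert (cs0 : cayley s0 = Ci).
{ destruct (cayley_components s0 ltac:(lra)) as [hn [e1 e2]].
  assert (n2 : Cnorm2 (Cadd (Cexp s0) C1) = 2).
  { unfold Cnorm2; simpl; rewrite exp_0, cos_PI2, sin_PI2; ring. }
  rewrite n2 in e1, e2; change (re s0) with 0 in e1, e2; change (im s0) with (PI / 2) in e2.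
  rewrite exp_0 in e1, e2; rewrite sin_PI2 in e2.
  apply Cplx_ext; [rewrite e1|rewrite e2]; unfold Ci, re, im; field. }
assert (arg0 : Carg (Z s0) = PI / 2).
{ destruct (interval_ratio_components p q _ (ne s0 hs0)) as [hn [e1 _]].
  change (interval_ratio p q (w (cayley s0))) with (Z s0) in e1.
  rewrite cs0, heq, Rminus_diag in e1; unfold Rdiv in e1; rewrite Rmult_0_l in e1.
  assert (Zs : in_slit_plane (Z s0)) by (right; specialize (Zup s0 hs0); lra).
  destruct (slit_plane_pos _ Zs) as [_ [ab _]].
  destruct (Carg_trig (Z s0) Zs) as [t1 _]; rewrite e1 in t1.
  pose proof (Carg_upper _ (Zup s0 hs0)) as hA.
  destruct (Rtotal_order (Carg (Z s0)) (PI / 2)) as [h|[h|h]]; trivial.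
  - pose proof (cos_gt_0 (Carg (Z s0)) ltac:(lra) h); nra.
  - pose proof (cos_lt_0 (Carg (Z s0)) h ltac:(lra)); nra. }
assert (im0 : forall t, 0 < im t < PI -> im (F t) = 0).
{ intros t ht; change (im (F t)) with (Carg (Z t) + - im t).
  destruct (argle t ht) as [lt|eq]; [exfalso|lra].
  assert (r : 0 < re (Cmul Ci (F s0))).
  { apply (holc_strip_positive (fun t => Cmul Ci (F t)) 0 PI t s0); trivial.
    - intros r hr; apply holc_mul; [apply holc_const|apply hF, hr].
    - intros r hr; specialize (argle r hr); simpl; lra.
    - simpl; lra. }
  simpl in r; rewrite arg0 in r; lra. }
(* [log Z - s] is a real constant, so [Z = k e ^ s = k (1 + z) / (1 - z)]; solving for [w] yields
   the Blaschke factor with [a = (1 - k) / (1 + k)]. *)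
set (k := exp (re (F s0))).
assert (hk : 0 < k) by apply exp_pos.
assert (Zeq : forall t, 0 < im t < PI -> Z t = Cmul (RtoC k) (Cexp t)).
{ intros t ht.
  assert (e : F t = F s0) by (apply (holc_real_const F 0 PI hF im0); trivial).
  rewrite <- (Cexp_Clog (Z t)) by (right; specialize (Zup t ht); lra).
  replace (Clog (Z t)) with (Cadd (F s0) t) by (rewrite <- e; unfold F; ring).
  unfold Cexp; change (im (Cadd (F s0) t)) with (im (F s0) + im t).
  change (re (Cadd (F s0) t)) with (re (F s0) + re t).
  rewrite (im0 s0 hs0), Rplus_0_l, exp_plus; fold k; apply Cplx_ext; simpl; ring. }
exists ((1 - k) / (1 + k)); split.
{ assert (e : (1 - k) / (1 + k) = 2 / (1 + k) - 1) by (field; lra).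
  assert (0 < 2 / (1 + k)) by (apply Rdiv_lt_0_compat; lra).
  assert (2 / (1 + k) < 2); [|lra].
  apply (Rmult_lt_reg_r (1 + k)); [lra|]; replace (2 / (1 + k) * (1 + k)) with 2 by (field; lra); lra. }
intros z hz; destruct (cayley_surj_upper z hz) as [s [hs [e1 e2]]].
pose proof (Zeq s hs) as eZ; rewrite e2 in eZ; unfold Z in eZ; rewrite e1 in eZ.
pose proof (ne s hs) as nq; rewrite e1 in nq.
assert (n1 : Csub C1 z <> C0) by (intros e; apply (f_equal im) in e; simpl in e; lra).
assert (nd : Cadd (Csub C1 z) (Cmul (RtoC k) (Cadd C1 z)) <> C0).
{ intros e; pose proof (f_equal re e) as r1; pose proof (f_equal im e) as r2; simpl in r1, r2.
  assert (r3 : (k - 1) * im z = 0) by lra.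
  apply Rmult_integral in r3; destruct r3 as [r3|r3]; [|lra].
  assert (k = 1) by lra; subst k; rewrite H0 in r1; lra. }
assert (nk : RtoC (1 + k) <> C0) by (apply RtoC_neq0; lra).
assert (two : RtoC 2 <> C0) by (apply RtoC_neq0; lra).
assert (ew : Cmul (w z) (Cadd (Csub C1 z) (Cmul (RtoC k) (Cadd C1 z))) =
  Cadd (Cmul (RtoC p) (Csub C1 z)) (Cmul (Cmul (RtoC k) (RtoC q)) (Cadd C1 z))).
{ assert (cross : Cmul (Csub (w z) (RtoC p)) (Csub C1 z) =
    Cmul (Cmul (RtoC k) (Cadd C1 z)) (Csub (RtoC q) (w z))).
  { apply (f_equal (fun t => Cmul t (Cmul (Csub (RtoC q) (w z)) (Csub C1 z)))) in eZ.
    unfold interval_ratio, cayley_arg in eZ.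
    transitivity (Cmul (Cdiv (Csub (w z) (RtoC p)) (Csub (RtoC q) (w z)))
       (Cmul (Csub (RtoC q) (w z)) (Csub C1 z))); [field; exact nq|].
    rewrite eZ; field; exact n1. }
  transitivity (Cadd (Cmul (Csub (w z) (RtoC p)) (Csub C1 z))
    (Cadd (Cmul (RtoC p) (Csub C1 z)) (Cmul (w z) (Cmul (RtoC k) (Cadd C1 z))))); [ring|].
  rewrite cross; ring. }
assert (ew' : w z = Cdiv (Cadd (Cmul (RtoC p) (Csub C1 z)) (Cmul (Cmul (RtoC k) (RtoC q)) (Cadd C1 z)))
   (Cadd (Csub C1 z) (Cmul (RtoC k) (Cadd C1 z)))).
{ rewrite <- ew; field; exact nd. }
rewrite ew'; unfold blaschke; rewrite !RtoC_div, RtoC_add, !RtoC_sub, RtoC_add by lra.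
change (RtoC 1) with C1; rewrite RtoC_add in nk; change (RtoC 1) with C1 in nk.
assert (t2 : RtoC 2 = Cadd C1 C1) by (apply Cplx_ext; simpl; ring); rewrite t2 in *.
field; repeat split; [exact nk| |exact two].
intros e; apply nd; transitivity (Csub (Cadd C1 (RtoC k)) (Cmul z (Csub C1 (RtoC k)))); [ring|exact e].
Qed.

(** * The disc and its boundary *)

(** The formula places the circle at [cos (im s) = 0] and the disc at [|im s| < PI / 2]. *)
Lemma cayley_Cnorm2 (s : Cplx) : - PI < im s < PI ->
  let n := Cnorm2 (Cadd (Cexp s) C1) in
  0 < n /\ Cnorm2 (cayley s) = 1 - 4 * exp (re s) * cos (im s) / n.
Proof.
intros h n; destruct (cayley_components s h) as [hn _]; fold n in hn; split; [exact hn|].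
unfold cayley, Cdiv; rewrite Cnorm2_mul.
replace (Cnorm2 (Cinv (Cadd (Cexp s) C1))) with (/ n).
2: { unfold Cinv; change (Cnorm2 (Cadd (Cexp s) C1)) with n; unfold Cnorm2 at 1; cbn [re im].
     replace (/ n) with (n / n / n) by (field; lra).
     unfold n at 1; unfold Cnorm2 at 1; field; lra. }
apply (Rmult_eq_reg_r n); [|lra]; rewrite Rmult_assoc, Rinv_l, Rmult_1_r by lra.
replace ((1 - 4 * exp (re s) * cos (im s) / n) * n) with (n - 4 * exp (re s) * cos (im s)) by (field; lra).
unfold n, Cnorm2; simpl; ring.
Qed.

Lemma cayley_closed_disc (s : Cplx) : - (PI / 2) <= im s <= PI / 2 -> Cnorm2 (cayley s) <= 1.
Proof.
intros h; pose proof PI_RGT_0.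
destruct (cayley_Cnorm2 s ltac:(lra)) as [hn e]; rewrite e.
assert (0 <= cos (im s)) by (apply cos_ge_0; lra).
pose proof (exp_pos (re s)).
assert (0 <= 4 * exp (re s) * cos (im s) / Cnorm2 (Cadd (Cexp s) C1)); [|lra].
apply Rmult_le_pos; [nra|apply Rlt_le, Rinv_0_lt_compat, hn].
Qed.

Lemma cayley_circle (s : Cplx) : im s = - (PI / 2) \/ im s = PI / 2 ->
  Cnorm2 (cayley s) = 1 /\ im (cayley s) <> 0.
Proof.
intros h; pose proof PI_RGT_0.
assert (hs : - PI < im s < PI) by lra.
destruct (cayley_Cnorm2 s hs) as [hn e]; rewrite e.
assert (c0 : cos (im s) = 0) by (destruct h as [-> | ->]; rewrite ?cos_neg; apply cos_PI2).
rewrite c0; split; [unfold Rdiv; ring|].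
destruct (cayley_im_sign s hs) as [up [lo _]]; destruct h as [h|h];
[specialize (lo ltac:(lra))|specialize (up ltac:(lra))]; lra.
Qed.

Lemma inD_Cnorm2 (z : Cplx) : inD z <-> Cnorm2 z < 1.
Proof.
unfold inD, Cabs; split; intros h.
- apply sqrt_lt_0_alt; rewrite sqrt_1; exact h.
- rewrite <- sqrt_1; apply sqrt_lt_1_alt; split; [apply Cnorm2_ge0|exact h].
Qed.

Lemma inD_slit (z : Cplx) : inD z -> in_slit z.
Proof. intros h; apply inD_Cnorm2 in h; unfold Cnorm2 in h; intros [h1 h2]; nra. Qed.

Lemma cayley_surj_disc (z : Cplx) : inD z ->
  exists s, - (PI / 2) <= im s <= PI / 2 /\ cayley s = z.
Proof.
intros hz; destruct (cayley_surj z (inD_slit z hz)) as [s [hs [e1 e2]]]; exists s; split; [|exact e1].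
apply inD_Cnorm2 in hz.
destruct (cayley_Cnorm2 s hs) as [hn e]; rewrite e1 in e.
pose proof (exp_pos (re s)) as ep.
assert (cs : 0 < cos (im s)).
{ assert (h : 0 < 4 * exp (re s) * cos (im s) / Cnorm2 (Cadd (Cexp s) C1)) by lra.
  apply (Rmult_lt_reg_l (4 * exp (re s) / Cnorm2 (Cadd (Cexp s) C1))).
  - apply Rdiv_lt_0_compat; lra.
  - rewrite Rmult_0_r; eapply Rlt_le_trans; [exact h|right; field; lra]. }
split; apply Rnot_lt_le; intros lt.
- pose proof (cos_lt_0 (- im s) ltac:(lra) ltac:(lra)); rewrite cos_neg in *; lra.
- pose proof (cos_lt_0 (im s) ltac:(lra) ltac:(lra)); lra.
Qed.

(* Boundedness takes care of the exceptional boundary points [1] and [-1]. *)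
Lemma disc_uniqueness (f : Cplx -> Cplx) (B : R) :
  (forall z, in_slit z -> holc f z) ->
  (forall z, in_slit z -> Cnorm2 z <= 1 -> Cabs (f z) <= B) ->
  (forall z, im z <> 0 -> Cnorm2 z = 1 -> f z = C0) ->
  forall z, inD z -> f z = C0.
Proof.
intros hf hB h0.
(* [holc_strip_max] bounds a real part from above only; the factors [1], [-1], [i] and [-i] together
   give [f z = 0]. *)
assert (key : forall c z, inD z -> re (Cmul c (f z)) <= 0).
{ intros c z hz; destruct (cayley_surj_disc z hz) as [s [hs e]]; rewrite <- e.
  pose proof PI_RGT_0.
  apply (holc_strip_max (fun s => Cmul c (f (cayley s))) (- (PI / 2)) (PI / 2) (PI / 4) 0 (Cabs c * B));
    try lra; trivial.
  - intros t ht; apply holc_mul; [apply holc_const|].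
    apply (holc_comp f cayley); [apply hf, cayley_in_slit|apply holc_cayley]; lra.
  - intros t ht; eapply Rle_trans; [apply Rle_abs|eapply Rle_trans; [apply re_le_Cabs|]].
    rewrite Cabs_mul; apply Rmult_le_compat_l; [apply Cabs_ge0|].
    apply hB; [apply cayley_in_slit; lra|apply cayley_closed_disc, ht].
  - intros t _ ht; destruct (cayley_circle t ht) as [n1 n2]; rewrite (h0 _ n2 n1); simpl; lra. }
intros z hz.
pose proof (key C1 z hz) as k1; pose proof (key (Copp C1) z hz) as k2.
pose proof (key Ci z hz) as k3; pose proof (key (Copp Ci) z hz) as k4.
simpl in k1, k2, k3, k4; apply Cplx_ext; simpl; lra.
Qed.

(** The pole [1 / a], if there is one, lies on a slit. *)
Lemma blaschke_denominator (a : R) (z : Cplx) : -1 < a < 1 -> in_slit z ->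
  Csub C1 (Cmul z (RtoC a)) <> C0.
Proof.
intros ha hz e; pose proof (f_equal re e) as e1; pose proof (f_equal im e) as e2; simpl in e1, e2.
assert (z1 : re z * a = 1) by lra.
assert (a <> 0) by (intros h; rewrite h in z1; lra).
assert (im z = 0) by (apply (Rmult_eq_reg_r a); trivial; lra).
apply hz; split; trivial.
destruct (Rlt_le_dec a 0); [left|right]; nra.
Qed.

Lemma holc_blaschke (a : R) (z : Cplx) : -1 < a < 1 -> in_slit z -> holc (blaschke a) z.
Proof.
intros ha hz; apply (holc_div (fun z => Csub z (RtoC a)) (fun z => Csub C1 (Cmul z (RtoC a)))).
- apply blaschke_denominator; assumption.
- apply holc_sub; [apply holc_id|apply holc_const].
- apply holc_sub; [apply holc_const|apply holc_mul; [apply holc_id|apply holc_const]].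
Qed.

Lemma Cnorm2_inv (z : Cplx) : z <> C0 -> Cnorm2 (Cinv z) = / Cnorm2 z.
Proof.
intros h; pose proof (Cnorm2_gt0 z h) as hn; unfold Cinv; set (n := Cnorm2 z) in *.
unfold Cnorm2 at 1; cbn [re im]; replace (/ n) with (n / n / n) by (field; lra).
unfold n at 5, Cnorm2; field; lra.
Qed.

Lemma blaschke_Cnorm2 (a : R) (z : Cplx) : -1 < a < 1 -> in_slit z ->
  let n := Cnorm2 (Csub C1 (Cmul z (RtoC a))) in
  0 < n /\ Cnorm2 (blaschke a z) = 1 - (1 - Cnorm2 z) * (1 - a * a) / n.
Proof.
intros ha hz n; pose proof (blaschke_denominator a z ha hz) as hd.
assert (hn : 0 < n) by (apply Cnorm2_gt0, hd); split; [exact hn|].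
unfold blaschke, Cdiv; rewrite Cnorm2_mul, Cnorm2_inv by exact hd; fold n.
apply (Rmult_eq_reg_r n); [|lra]; rewrite Rmult_assoc, Rinv_l, Rmult_1_r by lra.
replace ((1 - (1 - Cnorm2 z) * (1 - a * a) / n) * n) with (n - (1 - Cnorm2 z) * (1 - a * a)) by (field; lra).
unfold n, Cnorm2; simpl; ring.
Qed.

Lemma blaschke_circle (a : R) (z : Cplx) : -1 < a < 1 -> im z <> 0 -> Cnorm2 z = 1 ->
  Cnorm2 (blaschke a z) = 1.
Proof.
intros ha hz hn; destruct (blaschke_Cnorm2 a z ha (in_slit_im z hz)) as [_ e].
rewrite e, hn; unfold Rdiv; ring.
Qed.

Lemma blaschke_closed_disc (a : R) (z : Cplx) : -1 < a < 1 -> in_slit z -> Cnorm2 z <= 1 ->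
  Cabs (blaschke a z) <= 1.
Proof.
intros ha hz hn; destruct (blaschke_Cnorm2 a z ha hz) as [hp e].
unfold Cabs; rewrite <- sqrt_1; apply sqrt_le_1_alt; rewrite e.
assert (0 <= (1 - Cnorm2 z) * (1 - a * a) / Cnorm2 (Csub C1 (Cmul z (RtoC a)))); [|lra].
apply Rmult_le_pos; [apply Rmult_le_pos; nra|apply Rlt_le, Rinv_0_lt_compat, hp].
Qed.

Lemma blaschke_conj (a : R) (z : Cplx) : blaschke a (Cconj z) = Cconj (blaschke a z).
Proof.
unfold blaschke, Cdiv, Cinv.
replace (Cnorm2 (Csub C1 (Cmul (Cconj z) (RtoC a)))) with (Cnorm2 (Csub C1 (Cmul z (RtoC a)))).
- apply Cplx_ext; simpl; unfold Rdiv; ring.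
- unfold Cnorm2; simpl; ring.
Qed.

(* Bisect towards a subinterval on which no finite part of the cover has enough length. *)
Lemma interval_not_null (E : R -> Prop) (c d : R) : null_set E -> c < d ->
  exists t, c < t < d /\ ~ E t.
Proof.
intros hE hcd; apply NNPP; intros hn.
(* A closed interval inside the open one keeps the limit point of the bisection in [(c, d)]. *)
set (c' := (3 * c + d) / 4); set (d' := (c + 3 * d) / 4).
assert (hcd' : c < c' /\ c' < d' /\ d' < d) by (unfold c', d'; lra).
destruct (hE (d' - c') ltac:(lra)) as [a [b [hab [hsum cov]]]].
(* With this, [f N y - f N x] is the total length that the first [N + 1] covering intervals have
   inside [[x, y]]. *)
pose (clamp := fun k t => Rmax (a k) (Rmin (b k) t)).
pose (f := fun N t => sum_f_R0 (fun k => clamp k t) N).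
assert (mono : forall k x y, x <= y -> clamp k x <= clamp k y).
{ intros k x y h; unfold clamp, Rmax, Rmin; repeat destruct Rle_dec; lra. }
assert (range : forall k x y, clamp k y - clamp k x <= b k - a k).
{ intros k x y; specialize (hab k); unfold clamp, Rmax, Rmin; repeat destruct Rle_dec; lra. }
assert (incr : forall x y, x <= y -> forall N M, (N <= M)%nat -> f N y - f N x <= f M y - f M x).
{ intros x y h N M; induction 1 as [|M _ IH]; [lra|].
  unfold f in *; simpl; specialize (mono (S M) x y h); lra. }
assert (tot : forall x y N, f N y - f N x <= sum_f_R0 (fun k => b k - a k) N).
{ intros x y N; induction N as [|N IH]; unfold f in *; simpl; [apply range|].
  specialize (range (S N) x y); lra. }
pose (uncovered := fun x y (_ _ : R) => forall N, f N y - f N x < y - x).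
destruct (rectangle_bisection uncovered c' d' 0 0) as [t [u htu]]; try lra.
- intros x y p q hxy hpq bad m n.
  apply NNPP; intros hno.
  assert (h1 : exists N, m - x <= f N m - f N x).
  { apply NNPP; intros h; apply hno; left; intros N; apply Rnot_le_lt; intros le; apply h; exists N; exact le. }
  assert (h2 : exists N, y - m <= f N y - f N m).
  { apply NNPP; intros h; apply hno; right; left; intros N; apply Rnot_le_lt; intros le; apply h; exists N; exact le. }
  destruct h1 as [N1 h1]; destruct h2 as [N2 h2].
  assert (xm : x <= m <= y) by (unfold m; lra).
  pose proof (incr x m ltac:(lra) N1 (max N1 N2) ltac:(lia)).
  pose proof (incr m y ltac:(lra) N2 (max N1 N2) ltac:(lia)).
  specialize (bad (max N1 N2)); lra.
- intros N; specialize (tot c' d' N); specialize (hsum N); lra.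
- assert (ht : c' <= t <= d') by (destruct (htu 1 Rlt_0_1) as [? [? [? [? h]]]]; lra).
  assert (Et : E t) by (apply NNPP; intros h; apply hn; exists t; split; [lra|exact h]).
  destruct (cov t Et) as [k hk].
  set (delta := Rmin (t - a k) (b k - t)).
  assert (hd : 0 < delta /\ delta <= t - a k /\ delta <= b k - t).
  { unfold delta; split; [apply Rmin_glb_lt; lra|split; [apply Rmin_l|apply Rmin_r]]. }
  destruct (htu delta (proj1 hd)) as [x [y [p [q [h1 [h2 [_ [_ [h3 [_ bad]]]]]]]]]].
  specialize (bad k).
  assert (ck : clamp k y - clamp k x = y - x).
  { unfold clamp, Rmax, Rmin; repeat destruct Rle_dec; lra. }
  assert (ge : forall M, 0 <= f M y - f M x).
  { intros M; pose proof (incr x y ltac:(lra) 0%nat M ltac:(lia)) as h.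
    assert (0 <= f 0%nat y - f 0%nat x) by (unfold f; simpl; specialize (mono 0%nat x y ltac:(lra)); lra); lra. }
  destruct k as [|k]; unfold f in bad; simpl in bad; [lra|].
  specialize (ge k); unfold f in ge; lra.
Qed.

(** * Continuity along the circle and unitarity of the boundary values *)

Definition ccontinuous (g : R -> Cplx) (t : R) : Prop :=
  continuity_pt (fun s => re (g s)) t /\ continuity_pt (fun s => im (g s)) t.

Lemma ccontinuous_const (c : Cplx) (t : R) : ccontinuous (fun _ => c) t.
Proof. split; apply continuity_pt_const; intros x y; reflexivity. Qed.

Lemma ccontinuous_add (f g : R -> Cplx) (t : R) : ccontinuous f t -> ccontinuous g t ->
  ccontinuous (fun s => Cadd (f s) (g s)) t.
Proof. intros [f1 f2] [g1 g2]; split; apply continuity_pt_plus; assumption. Qed.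

Lemma ccontinuous_mul (f g : R -> Cplx) (t : R) : ccontinuous f t -> ccontinuous g t ->
  ccontinuous (fun s => Cmul (f s) (g s)) t.
Proof.
intros [f1 f2] [g1 g2]; split;
[apply continuity_pt_minus|apply continuity_pt_plus]; apply continuity_pt_mult; assumption.
Qed.

Lemma ccontinuous_conj (f : R -> Cplx) (t : R) : ccontinuous f t ->
  ccontinuous (fun s => Cconj (f s)) t.
Proof. intros [f1 f2]; split; [exact f1|apply continuity_pt_opp; exact f2]. Qed.

Lemma ccontinuous_csum (f : R -> nat -> Cplx) (t : R) (n : nat) :
  (forall k, (k < n)%nat -> ccontinuous (fun s => f s k) t) ->
  ccontinuous (fun s => csum (f s) n) t.
Proof.
induction n as [|n IH]; intros h; [apply (ccontinuous_const C0)|].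
apply ccontinuous_add; [apply IH; intros; apply h; lia|apply h; lia].
Qed.

Lemma ccontinuous_close (g : R -> Cplx) (t eps : R) : ccontinuous g t -> 0 < eps ->
  exists delta, 0 < delta /\ forall s, Rabs (s - t) < delta ->
    Rabs (re (g s) - re (g t)) < eps /\ Rabs (im (g s) - im (g t)) < eps.
Proof.
intros [h1 h2] he.
destruct (h1 eps he) as [d1 [p1 n1]]; destruct (h2 eps he) as [d2 [p2 n2]].
exists (Rmin d1 d2); split; [apply Rmin_glb_lt; assumption|].
intros s hs; pose proof (Rmin_l d1 d2); pose proof (Rmin_r d1 d2).
destruct (Req_dec t s) as [<-|ne]; [rewrite !Rminus_diag, Rabs_R0; split; assumption|].
unfold D_x, no_cond in *; split; [apply (n1 s)|apply (n2 s)];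
repeat split; trivial; simpl; unfold Rdist; lra.
Qed.

Lemma ccontinuous_holc (f : Cplx -> Cplx) (g : R -> Cplx) (t : R) :
  holc f (g t) -> ccontinuous g t -> ccontinuous (fun s => f (g s)) t.
Proof.
intros hf hg; destruct (hol_continuity _ _ _ _ hf) as [c1 c2]; split; intros eps he.
- destruct (c1 (mkposreal eps he)) as [d hd]; simpl in hd.
  destruct (ccontinuous_close g t d hg (cond_pos d)) as [e [p n]].
  exists e; split; trivial; intros s [_ hs]; destruct (n s hs) as [n1 n2].
  specialize (hd _ _ n1 n2); rewrite !Cplx_eta in hd; exact hd.
- destruct (c2 (mkposreal eps he)) as [d hd]; simpl in hd.
  destruct (ccontinuous_close g t d hg (cond_pos d)) as [e [p n]].
  exists e; split; trivial; intros s [_ hs]; destruct (n s hs) as [n1 n2].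
  specialize (hd _ _ n1 n2); rewrite !Cplx_eta in hd; exact hd.
Qed.

Lemma circle_param (z : Cplx) : im z <> 0 -> Cnorm2 z = 1 ->
  exists t, 0 < t < 2 * PI /\ sin t <> 0 /\ Cexpi t = z.
Proof.
intros hz hn.
assert (sl : in_slit_plane z) by (right; exact hz).
destruct (Carg_trig z sl) as [e1 e2].
assert (ab : Cabs z = 1) by (unfold Cabs; rewrite hn; apply sqrt_1).
rewrite ab, Rmult_1_l in e1, e2.
pose proof (Carg_bounds z) as hA.
destruct (Rtotal_order (Carg z) 0) as [h|[h|h]].
- exists (Carg z + 2 * PI); rewrite sin_plus, sin_2PI, cos_2PI; split; [lra|split; [lra|]].
  unfold Cexpi; rewrite sin_plus, cos_plus, sin_2PI, cos_2PI; apply Cplx_ext; simpl; lra.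
- rewrite h, sin_0 in e2; lra.
- exists (Carg z); split; [lra|split; [lra|apply Cplx_ext; simpl; lra]].
Qed.

(* The boundary function extends analytically across the circle away from [1] and [-1],
   so an identity on a dense set of boundary points holds at all of them. *)
Lemma inner_unitary_circle (n : nat) (Theta W : Cplx -> Mat) :
  (forall z, inD z -> meq n (W z) (msub (Theta z) (Theta C0))) ->
  mholo_on n in_slit W -> inner_fn n Theta ->
  forall z, im z <> 0 -> Cnorm2 z = 1 ->
    let T := madd (W z) (Theta C0) in meq n (mmul n (adj T) T) mI.
Proof.
intros hW holo inn z hz hn T i j hi hj.
destruct (circle_param z hz hn) as [t0 [ht0 [st0 e0]]].
(* Continues [Theta] holomorphically to the slit plane, hence across the circle off the real axis;
   radial limits are then values of [ext]. *)
pose (ext := fun w => madd (W w) (Theta C0)).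
assert (cext : forall (g : R -> Cplx) t k l, (k < n)%nat -> (l < n)%nat -> im (g t) <> 0 ->
   ccontinuous g t -> ccontinuous (fun s => ext (g s) k l) t).
{ intros g t k l hk hl hg cg; apply ccontinuous_add; [|apply ccontinuous_const].
  apply (ccontinuous_holc (fun w => W w k l) g); trivial.
  apply cdiff_holc, holo; trivial; apply in_slit_im, hg. }
assert (cexpi : forall t, ccontinuous Cexpi t).
{ intros t; split; [apply continuity_cos|apply continuity_sin]. }
assert (good : forall t, 0 < t < 2 * PI -> sin t <> 0 ->
  ~ (0 <= t < 2 * PI /\ ~ (exists L : Mat, radial_limit n Theta (Cexpi t) L /\
                       meq n (mmul n (adj L) L) mI)) ->
  mmul n (adj (ext (Cexpi t))) (ext (Cexpi t)) i j = mI i j).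
{ intros t ht st hg.
  assert (hL : exists L : Mat, radial_limit n Theta (Cexpi t) L /\ meq n (mmul n (adj L) L) mI).
  { apply NNPP; intros h; apply hg; split; [lra|exact h]. }
  destruct hL as [L [rad un]].
  assert (eqL : forall k l, (k < n)%nat -> (l < n)%nat -> L k l = ext (Cexpi t) k l).
  { intros k l hk hl.
    assert (c := cext (fun r => Cmul (RtoC r) (Cexpi t)) 1 k l hk hl).
    cbv beta in c; replace (Cmul (RtoC 1) (Cexpi t)) with (Cexpi t) in c
      by (change (RtoC 1) with C1; ring).
    assert (cr : ccontinuous (fun r => Cmul (RtoC r) (Cexpi t)) 1).
    { apply ccontinuous_mul; [|apply ccontinuous_const].
      split; [apply derivable_continuous_pt, derivable_pt_id|].
      apply continuity_pt_const; intros x y; reflexivity. }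
    specialize (c st cr).
    assert (near : forall eps, 0 < eps -> Rabs (re (L k l) - re (ext (Cexpi t) k l)) < eps /\
      Rabs (im (L k l) - im (ext (Cexpi t) k l)) < eps).
    { intros eps he.
      destruct (ccontinuous_close _ _ (eps / 2) c ltac:(lra)) as [d1 [p1 n1]].
      destruct (rad (eps / 2) ltac:(lra)) as [d2 [p2 n2]].
      set (r := Rmax (1 / 2) (Rmax (1 - d1 / 2) (1 - d2 / 2))).
      assert (hr : 1 / 2 <= r < 1 /\ 1 - d1 < r /\ 1 - d2 < r).
      { unfold r; pose proof (Rmax_l (1 / 2) (Rmax (1 - d1 / 2) (1 - d2 / 2)));
        pose proof (Rmax_r (1 / 2) (Rmax (1 - d1 / 2) (1 - d2 / 2)));
        pose proof (Rmax_l (1 - d1 / 2) (1 - d2 / 2)); pose proof (Rmax_r (1 - d1 / 2) (1 - d2 / 2)).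
        repeat split; try lra; repeat apply Rmax_lub_lt; lra. }
      specialize (n1 r ltac:(apply Rabs_def1; lra)).
      specialize (n2 r ltac:(lra) ltac:(lra) k l hk hl).
      replace (Cmul (RtoC 1) (Cexpi t)) with (Cexpi t) in n1 by (change (RtoC 1) with C1; ring).
      assert (inr : inD (Cmul (RtoC r) (Cexpi t))).
      { apply inD_Cnorm2; rewrite Cnorm2_mul; unfold Cnorm2; simpl.
        pose proof (sin2_cos2 t) as sc; unfold Rsqr in sc.
        replace (cos t * cos t + sin t * sin t) with 1 by lra; nra. }
      assert (eT : ext (Cmul (RtoC r) (Cexpi t)) k l = Theta (Cmul (RtoC r) (Cexpi t)) k l).
      { unfold ext, madd; rewrite (hW _ inr k l hk hl); unfold msub; ring. }
      rewrite eT in n1; destruct n1 as [m1 m2].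
      pose proof (Rle_lt_trans _ _ _ (re_le_Cabs _) n2) as m3.
      pose proof (Rle_lt_trans _ _ _ (im_le_Cabs _) n2) as m4; simpl in m3, m4.
      apply Rabs_def2 in m1; apply Rabs_def2 in m2; apply Rabs_def2 in m3; apply Rabs_def2 in m4.
      split; apply Rabs_def1; lra. }
    apply Cplx_ext; apply cond_eq; intros eps he; apply near; exact he. }
  rewrite <- (un i j hi hj).
  assert (ecs : forall (f g : nat -> Cplx) m, (m <= n)%nat ->
     (forall k, (k < n)%nat -> f k = g k) -> csum f m = csum g m).
  { intros f g m hm h; induction m as [|m IH]; simpl; trivial; rewrite IH, h by lia; reflexivity. }
  unfold mmul; apply ecs; trivial; intros k hk; unfold adj; rewrite !eqL by trivial; reflexivity. }
pose (g := fun t => mmul n (adj (ext (Cexpi t))) (ext (Cexpi t)) i j).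
assert (cg : ccontinuous g t0).
{ apply (ccontinuous_csum (fun t k => Cmul (adj (ext (Cexpi t)) i k) (ext (Cexpi t) k j))).
  intros k hk; apply ccontinuous_mul; [apply (ccontinuous_conj (fun s => ext (Cexpi s) k i))|];
  apply cext; trivial; apply cexpi. }
assert (near : forall eps, 0 < eps -> Rabs (re (g t0) - re (mI i j)) < eps /\
      Rabs (im (g t0) - im (mI i j)) < eps).
{ intros eps he.
  destruct (ccontinuous_close g t0 eps cg he) as [d [pd nd]].
  (* This second radius keeps [sin t] nonzero, so that the chosen good point stays off the real
     axis. *)
  destruct (ccontinuous_close Cexpi t0 (Rabs (sin t0)) (cexpi t0) ltac:(apply Rabs_pos_lt, st0))
    as [d' [pd' nd']].
  set (delta := Rmin (Rmin d d') (2 * PI - t0)).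
  assert (hd : 0 < delta /\ delta <= d /\ delta <= d' /\ delta <= 2 * PI - t0).
  { unfold delta; repeat split; try (repeat apply Rmin_glb_lt; lra);
    unfold Rmin; repeat destruct Rle_dec; lra. }
  destruct (interval_not_null _ t0 (t0 + delta) inn ltac:(lra)) as [t [ht hgood]].
  destruct (nd' t ltac:(rewrite Rabs_pos_eq; lra)) as [_ sn]; simpl in sn.
  assert (st : sin t <> 0).
  { intros z0; rewrite z0, Rminus_0_l, Rabs_Ropp in sn; lra. }
  specialize (good t ltac:(lra) st hgood).
  destruct (nd t ltac:(rewrite Rabs_pos_eq; lra)) as [n1 n2].
  unfold g at 1 in n1; unfold g at 1 in n2; rewrite good in n1, n2.
  rewrite Rabs_minus_sym in n1; rewrite Rabs_minus_sym in n2; split; assumption. }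
transitivity (g t0); [unfold g, ext; rewrite e0; reflexivity|].
apply Cplx_ext; apply cond_eq; intros eps he; apply near; exact he.
Qed.

(** * Quadratic forms of the matrix function *)

Lemma csum_ext (f g : nat -> Cplx) (n : nat) :
  (forall k, (k < n)%nat -> f k = g k) -> csum f n = csum g n.
Proof.
induction n as [|n IH]; intros h; simpl; trivial; rewrite IH, h by (intros; try apply h; lia); reflexivity.
Qed.

Lemma csum_add (f g : nat -> Cplx) (n : nat) :
  csum (fun k => Cadd (f k) (g k)) n = Cadd (csum f n) (csum g n).
Proof. induction n as [|n IH]; simpl; [ring|rewrite IH; ring]. Qed.

Lemma csum_scale (c : Cplx) (f : nat -> Cplx) (n : nat) :
  csum (fun k => Cmul c (f k)) n = Cmul c (csum f n).
Proof. induction n as [|n IH]; simpl; [ring|rewrite IH; ring]. Qed.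

Lemma csum_conj (f : nat -> Cplx) (n : nat) :
  Cconj (csum f n) = csum (fun k => Cconj (f k)) n.
Proof.
induction n as [|n IH]; simpl; [apply Cplx_ext; simpl; ring|].
rewrite <- IH; apply Cplx_ext; simpl; ring.
Qed.

Lemma csum_exchange (f : nat -> nat -> Cplx) (n m : nat) :
  csum (fun i => csum (fun j => f i j) m) n = csum (fun j => csum (fun i => f i j) n) m.
Proof.
induction n as [|n IH]; simpl.
- induction m as [|m IHm]; simpl; [reflexivity|rewrite <- IHm; ring].
- rewrite IH, csum_add; reflexivity.
Qed.

Lemma holc_csum (f : Cplx -> nat -> Cplx) (z : Cplx) (n : nat) :
  (forall k, (k < n)%nat -> holc (fun w => f w k) z) -> holc (fun w => csum (f w) n) z.
Proof.
induction n as [|n IH]; intros h; [apply (holc_const C0)|].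
apply (holc_add (fun w => csum (f w) n) (fun w => f w n)); [apply IH; intros; apply h; lia|apply h; lia].
Qed.

Definition sform (n : nat) (A : Mat) (u v : Vec) : Cplx := inner n u (mv n A v).

Lemma holc_sform (n : nat) (A : Cplx -> Mat) (u v : Vec) (z : Cplx) :
  (forall i j, (i < n)%nat -> (j < n)%nat -> holc (fun w => A w i j) z) ->
  holc (fun w => sform n (A w) u v) z.
Proof.
intros h; unfold sform, inner, mv.
apply (holc_csum (fun w i => Cmul (Cconj (u i)) (csum (fun j => Cmul (A w i j) (v j)) n))); intros i hi.
apply holc_mul; [apply holc_const|].
apply (holc_csum (fun w j => Cmul (A w i j) (v j))); intros j hj.
apply (holc_mul (fun w => A w i j)); [apply h; trivial|apply holc_const].
Qed.

Lemma sform_ext (n : nat) (A B : Mat) (u v : Vec) : meq n A B -> sform n A u v = sform n B u v.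
Proof.
intros h; apply csum_ext; intros i hi; f_equal; apply csum_ext; intros j hj; rewrite h; trivial.
Qed.

Lemma sform_sum (n : nat) (A : Mat) (u v : Vec) :
  sform n A u v = csum (fun i => csum (fun j => Cmul (Cmul (Cconj (u i)) (v j)) (A i j)) n) n.
Proof.
apply csum_ext; intros i hi; unfold mv; rewrite <- csum_scale.
apply csum_ext; intros j hj; ring.
Qed.

Lemma sform_madd (n : nat) (A B : Mat) (u v : Vec) :
  sform n (madd A B) u v = Cadd (sform n A u v) (sform n B u v).
Proof.
rewrite !sform_sum, <- csum_add; apply csum_ext; intros i hi.
rewrite <- csum_add; apply csum_ext; intros j hj; unfold madd; ring.
Qed.

Lemma sform_mscale (n : nat) (c : Cplx) (A : Mat) (u v : Vec) :
  sform n (mscale c A) u v = Cmul c (sform n A u v).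
Proof.
rewrite !sform_sum, <- csum_scale; apply csum_ext; intros i hi.
rewrite <- csum_scale; apply csum_ext; intros j hj; unfold mscale; ring.
Qed.

Lemma sform_msub (n : nat) (A B : Mat) (u v : Vec) :
  sform n (msub A B) u v = Csub (sform n A u v) (sform n B u v).
Proof.
transitivity (sform n (madd A (mscale (Copp C1) B)) u v).
- apply sform_ext; intros i j _ _; unfold msub, madd, mscale; ring.
- rewrite sform_madd, sform_mscale; ring.
Qed.

Lemma sform_adj (n : nat) (A : Mat) (u v : Vec) :
  sform n (adj A) u v = Cconj (sform n A v u).
Proof.
rewrite !sform_sum, csum_exchange, csum_conj; apply csum_ext; intros i hi.
rewrite csum_conj; apply csum_ext; intros j hj; unfold adj; apply Cplx_ext; simpl; ring.
Qed.

Lemma sform_expand (n : nat) (A : Mat) (u v : Vec) (c : Cplx) :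
  let x := fun k => Cadd (v k) (Cmul c (u k)) in
  sform n A x x = Cadd (Cadd (sform n A v v) (Cmul c (sform n A v u)))
    (Cadd (Cmul (Cconj c) (sform n A u v)) (Cmul (Cmul c (Cconj c)) (sform n A u u))).
Proof.
intros x; rewrite !sform_sum, <- !csum_scale, <- !csum_add; apply csum_ext; intros i hi.
rewrite <- !csum_scale, <- !csum_add; apply csum_ext; intros j hj.
unfold x; replace (Cconj (Cadd (v i) (Cmul c (u i)))) with (Cadd (Cconj (v i)) (Cmul (Cconj c) (Cconj (u i))))
  by (apply Cplx_ext; simpl; ring); ring.
Qed.

(** Recovers the sesquilinear form from its diagonal, which is all that the cone condition
    controls. *)
Lemma sform_polarization (n : nat) (A : Mat) (u v : Vec) :
  let q c := let x := fun k => Cadd (v k) (Cmul c (u k)) in sform n A x x in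
  Cmul (RtoC 4) (sform n A u v) =
  Cadd (Csub (q C1) (q (Copp C1))) (Cmul Ci (Csub (q Ci) (q (Copp Ci)))).
Proof. intros q; unfold q; rewrite !sform_expand; apply Cplx_ext; simpl; ring. Qed.

Lemma Cabs_add (z w : Cplx) : Cabs (Cadd z w) <= Cabs z + Cabs w.
Proof.
pose proof (Cabs_ge0 z); pose proof (Cabs_ge0 w).
apply Rsqr_incr_0_var; [|lra]; unfold Rsqr.
replace ((Cabs z + Cabs w) * (Cabs z + Cabs w)) with
  (Cabs z * Cabs z + Cabs w * Cabs w + 2 * (Cabs z * Cabs w)) by ring.
rewrite !Cabs_sqr.
assert (c : re z * re w + im z * im w <= Cabs z * Cabs w).
{ rewrite <- Cabs_mul.
  assert (e : Cabs (Cmul z w) = Cabs (Cmul (Cconj z) w)) by (rewrite !Cabs_mul; f_equal;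
    unfold Cabs, Cnorm2; simpl; f_equal; ring).
  rewrite e; eapply Rle_trans; [apply Rle_abs|].
  replace (re z * re w + im z * im w) with (re (Cmul (Cconj z) w)) by (simpl; ring); apply re_le_Cabs. }
unfold Cnorm2; simpl; lra.
Qed.

Lemma Cabs_opp (z : Cplx) : Cabs (Copp z) = Cabs z.
Proof. unfold Cabs, Cnorm2; simpl; f_equal; ring. Qed.

Lemma Cabs_Ci_mul (z : Cplx) : Cabs (Cmul Ci z) = Cabs z.
Proof. unfold Cabs, Cnorm2; simpl; f_equal; ring. Qed.

Lemma Cabs_RtoC (x : R) : Cabs (RtoC x) = Rabs x.
Proof.
unfold Cabs, Cnorm2; simpl; rewrite Rmult_0_l, Rplus_0_r; apply sqrt_Rsqr_abs.
Qed.

(** [P delta] stands for a one-sided neighbourhood of size [delta], so that the limits at [1] and at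
    [-1] share their proofs. *)
Definition tends (P : R -> R -> Prop) (f : R -> Cplx) (l : Cplx) : Prop :=
  forall eps, 0 < eps -> exists delta, 0 < delta /\
    forall x, P delta x -> Cabs (Csub (f x) l) < eps.

Lemma tends_add (P : R -> R -> Prop) (f g : R -> Cplx) (l m : Cplx) :
  (forall d d' x, d <= d' -> P d x -> P d' x) ->
  tends P f l -> tends P g m -> tends P (fun x => Cadd (f x) (g x)) (Cadd l m).
Proof.
intros hP hf hg eps he.
destruct (hf (eps / 2) ltac:(lra)) as [d1 [p1 n1]]; destruct (hg (eps / 2) ltac:(lra)) as [d2 [p2 n2]].
exists (Rmin d1 d2); split; [apply Rmin_glb_lt; assumption|]; intros x hx.
specialize (n1 x (hP _ _ _ (Rmin_l d1 d2) hx)); specialize (n2 x (hP _ _ _ (Rmin_r d1 d2) hx)).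
replace (Csub (Cadd (f x) (g x)) (Cadd l m)) with (Cadd (Csub (f x) l) (Csub (g x) m)) by ring.
eapply Rle_lt_trans; [apply Cabs_add|lra].
Qed.

Lemma tends_scale (P : R -> R -> Prop) (c : Cplx) (f : R -> Cplx) (l : Cplx) :
  tends P f l -> tends P (fun x => Cmul c (f x)) (Cmul c l).
Proof.
intros hf eps he; pose proof (Cabs_ge0 c) as hc.
destruct (hf (eps / (Cabs c + 1))) as [d [p n]]; [apply Rdiv_lt_0_compat; lra|].
exists d; split; trivial; intros x hx; specialize (n x hx).
replace (Csub (Cmul c (f x)) (Cmul c l)) with (Cmul c (Csub (f x) l)) by ring.
rewrite Cabs_mul; pose proof (Cabs_ge0 (Csub (f x) l)).
apply Rle_lt_trans with ((Cabs c) * (eps / (Cabs c + 1))); [apply Rmult_le_compat_l; lra|].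
replace eps with ((Cabs c + 1) * (eps / (Cabs c + 1))) at 2 by (field; lra).
apply Rmult_lt_compat_r; [apply Rdiv_lt_0_compat; lra|lra].
Qed.

Lemma tends_csum (P : R -> R -> Prop) (f : R -> nat -> Cplx) (l : nat -> Cplx) (n : nat) :
  (forall d d' x, d <= d' -> P d x -> P d' x) ->
  (forall k, (k < n)%nat -> tends P (fun x => f x k) (l k)) ->
  tends P (fun x => csum (f x) n) (csum l n).
Proof.
intros hP; induction n as [|n IH]; intros h.
- intros eps he; exists 1; split; [lra|]; intros x _; simpl.
  replace (Csub C0 C0) with (RtoC 0) by (apply Cplx_ext; simpl; ring).
  rewrite Cabs_RtoC, Rabs_R0; exact he.
- apply (tends_add P (fun x => csum (f x) n) (fun x => f x n)); trivial;
  [apply IH; intros; apply h; lia|apply h; lia].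
Qed.

Lemma tends_form (P : R -> R -> Prop) (n : nat) (A : R -> Mat) (B : Mat) (u v : Vec) :
  (forall d d' x, d <= d' -> P d x -> P d' x) ->
  (forall i j, (i < n)%nat -> (j < n)%nat -> tends P (fun x => A x i j) (B i j)) ->
  tends P (fun x => sform n (A x) u v) (sform n B u v).
Proof.
intros hP h.
apply (tends_csum P (fun x i => Cmul (Cconj (u i)) (mv n (A x) v i))); trivial; intros i hi.
apply (tends_scale P _ (fun x => mv n (A x) v i)).
apply (tends_csum P (fun x j => Cmul (A x i j) (v j))); trivial; intros j hj.
intros eps he; destruct (tends_scale P (v j) _ _ (h i j hi hj) eps he) as [d [p q]].
exists d; split; trivial; intros x hx; specialize (q x hx).
replace (Csub (Cmul (A x i j) (v j)) (Cmul (B i j) (v j))) with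
  (Csub (Cmul (v j) (A x i j)) (Cmul (v j) (B i j))) by ring; exact q.
Qed.

Definition left_of_1 (delta x : R) : Prop := 1 - delta < x < 1 /\ -1 < x.
Definition right_of_m1 (delta x : R) : Prop := -1 < x < -1 + delta /\ x < 1.

Lemma mlim_left_tends (n : nat) (F : Cplx -> Mat) (L : Mat) : mlim_left n F 1 L ->
  forall i j, (i < n)%nat -> (j < n)%nat -> tends left_of_1 (fun x => F (RtoC x) i j) (L i j).
Proof.
intros h i j hi hj eps he; destruct (h eps he) as [d [p q]]; exists d; split; trivial.
intros x [h1 h2]; apply q; trivial; lra.
Qed.

Lemma mlim_right_tends (n : nat) (F : Cplx -> Mat) (L : Mat) : mlim_right n F (-1) L ->
  forall i j, (i < n)%nat -> (j < n)%nat -> tends right_of_m1 (fun x => F (RtoC x) i j) (L i j).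
Proof.
intros h i j hi hj eps he; destruct (h eps he) as [d [p q]]; exists d; split; trivial.
intros x [h1 h2]; apply q; trivial; lra.
Qed.

Lemma left_of_1_mono (d d' x : R) : d <= d' -> left_of_1 d x -> left_of_1 d' x.
Proof. unfold left_of_1; lra. Qed.

Lemma right_of_m1_mono (d d' x : R) : d <= d' -> right_of_m1 d x -> right_of_m1 d' x.
Proof. unfold right_of_m1; lra. Qed.

Lemma sform_slit_herglotz (n : nat) (W : Cplx -> Mat) (W1 Wm1 : Mat) (v : Vec) :
  herglotz_nevanlinna n W -> mholo_on n in_slit W ->
  mlim_left n W 1 W1 -> mlim_right n W (-1) Wm1 ->
  slit_herglotz (fun z => sform n (W z) v v) (re (sform n Wm1 v v)) (re (sform n W1 v v)).
Proof.
intros [_ [_ hpos]] holo l1 lm1.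
assert (im_form : forall z, im z <> 0 -> 0 <= im z * im (sform n (W z) v v)).
{ intros z hz; destruct (hpos z hz) as [_ p]; specialize (p v).
  change (inner n v ?x) with (sform n (mscale (RtoC (im z)) (mImag (W z))) v v) in p.
  rewrite sform_mscale in p; unfold mImag in p; rewrite sform_mscale, sform_msub, sform_adj in p.
  simpl in p; lra. }
repeat split.
- intros z hz; apply holc_sform; intros i j hi hj; apply cdiff_holc, holo; trivial.
- intros z hz; specialize (im_form z ltac:(lra)); nra.
- intros z hz; specialize (im_form z ltac:(lra)); nra.
- intros eps he.
  destruct (tends_form _ n (fun x => W (RtoC x)) W1 v v left_of_1_mono (mlim_left_tends n W W1 l1) eps he)
    as [d [p q]]; exists d; split; trivial; intros x h1 h2.
  specialize (q x (conj h1 h2)); eapply Rle_lt_trans; [|exact q].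
  eapply Rle_trans; [|apply re_le_Cabs]; right; f_equal.
- intros eps he.
  destruct (tends_form _ n (fun x => W (RtoC x)) Wm1 v v right_of_m1_mono (mlim_right_tends n W Wm1 lm1) eps he)
    as [d [p q]]; exists d; split; trivial; intros x h1 h2.
  specialize (q x (conj h1 h2)); eapply Rle_lt_trans; [|exact q].
  eapply Rle_trans; [|apply re_le_Cabs]; right; f_equal.
Qed.

(** The symmetry of [W] is given off the real axis only; it reaches [x] by letting [y] tend to [0]
    in [W (x + i y)] and [W (x - i y)]. *)
Lemma herglotz_hermitian_real (n : nat) (W : Cplx -> Mat) (x : R) :
  herglotz_nevanlinna n W -> mholo_on n in_slit W -> -1 < x < 1 ->
  meq n (W (RtoC x)) (adj (W (RtoC x))).
Proof.
intros [_ [sym _]] holo hx i j hi hj.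
destruct (hol_continuity _ _ _ _ (cdiff_holc _ _ (holo _ (in_slit_real x hx) i j hi hj))) as [c1 c2].
destruct (hol_continuity _ _ _ _ (cdiff_holc _ _ (holo _ (in_slit_real x hx) j i hj hi))) as [c3 c4].
assert (near : forall eps, 0 < eps -> exists y, 0 < y /\
  Rabs (re (W (mkC x y) i j) - re (W (RtoC x) i j)) < eps /\
  Rabs (im (W (mkC x y) i j) - im (W (RtoC x) i j)) < eps /\
  Rabs (re (W (mkC x (- y)) j i) - re (W (RtoC x) j i)) < eps /\
  Rabs (im (W (mkC x (- y)) j i) - im (W (RtoC x) j i)) < eps).
{ intros eps he; destruct (c1 (mkposreal eps he)) as [d1 n1]; destruct (c2 (mkposreal eps he)) as [d2 n2].
  destruct (c3 (mkposreal eps he)) as [d3 n3]; destruct (c4 (mkposreal eps he)) as [d4 n4].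
  simpl in n1, n2, n3, n4.
  pose proof (cond_pos d1); pose proof (cond_pos d2); pose proof (cond_pos d3); pose proof (cond_pos d4).
  set (y := Rmin (Rmin d1 d2) (Rmin d3 d4) / 2).
  assert (hy : 0 < y /\ y < d1 /\ y < d2 /\ y < d3 /\ y < d4).
  { assert (0 < Rmin (Rmin d1 d2) (Rmin d3 d4)) by (repeat apply Rmin_glb_lt; lra).
    unfold y; repeat split; try lra; unfold Rmin in *; repeat destruct Rle_dec; lra. }
  exists y; split; [tauto|].
  assert (xx : forall d : posreal, Rabs (x - x) < d) by (intros d; rewrite Rminus_diag, Rabs_R0; apply cond_pos).
  assert (yy : forall d : posreal, y < d -> Rabs (y - 0) < d /\ Rabs (- y - 0) < d).
  { intros d hd; rewrite !Rminus_0_r, Rabs_Ropp, Rabs_pos_eq; lra. }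
  repeat split; [apply n1|apply n2|apply n3|apply n4]; trivial; apply yy; lra. }
assert (eq : forall a b, (forall eps, 0 < eps -> exists c, Rabs (c - a) < eps /\ Rabs (c - b) < eps) -> a = b).
{ intros a b h; apply cond_eq; intros eps he; destruct (h (eps / 2) ltac:(lra)) as [c [h1 h2]].
  apply Rabs_def2 in h1; apply Rabs_def2 in h2; apply Rabs_def1; lra. }
assert (s : forall y, 0 < y -> W (mkC x y) i j = Cconj (W (mkC x (- y)) j i)).
{ intros y hy; pose proof (sym (mkC x (- y)) ltac:(simpl; lra) i j hi hj) as e.
  unfold Cconj at 1 in e; simpl in e; rewrite Ropp_involutive in e; exact e. }
unfold adj; apply Cplx_ext; apply eq; intros eps he; destruct (near eps he) as [y [hy [n1 [n2 [n3 n4]]]]];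
rewrite (s y hy) in n1, n2; simpl in n1, n2.
- exists (re (W (mkC x (- y)) j i)); split; [exact n1|exact n3].
- exists (- im (W (mkC x (- y)) j i)); split; [exact n2|].
  simpl; rewrite <- Rabs_Ropp; match goal with |- Rabs ?a < _ => replace a with
    (im (W (mkC x (- y)) j i) - im (W (RtoC x) j i)) by ring end; exact n4.
Qed.

Lemma tends_unique (P : R -> R -> Prop) (f : R -> Cplx) (l m : Cplx) :
  (forall d d' x, d <= d' -> P d x -> P d' x) -> (forall d, 0 < d -> exists x, P d x) ->
  tends P f l -> tends P f m -> l = m.
Proof.
intros hP ne hf hg.
assert (close : forall eps, 0 < eps -> Cabs (Csub l m) < eps).
{ intros eps he; destruct (hf (eps / 2) ltac:(lra)) as [d1 [p1 n1]];
  destruct (hg (eps / 2) ltac:(lra)) as [d2 [p2 n2]].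
  destruct (ne (Rmin d1 d2)) as [x hx]; [apply Rmin_glb_lt; assumption|].
  specialize (n1 x (hP _ _ _ (Rmin_l d1 d2) hx)); specialize (n2 x (hP _ _ _ (Rmin_r d1 d2) hx)).
  replace (Csub l m) with (Cadd (Copp (Csub (f x) l)) (Csub (f x) m)) by ring.
  eapply Rle_lt_trans; [apply Cabs_add|rewrite Cabs_opp; lra]. }
apply Cplx_ext; apply cond_eq; intros eps he; specialize (close eps he);
(eapply Rle_lt_trans; [|exact close]);
[eapply Rle_trans; [|apply re_le_Cabs]|eapply Rle_trans; [|apply im_le_Cabs]]; right; f_equal.
Qed.

Lemma tends_hermitian (P : R -> R -> Prop) (n : nat) (W : Cplx -> Mat) (L : Mat) :
  (forall d d' x, d <= d' -> P d x -> P d' x) -> (forall d, 0 < d -> exists x, P d x) ->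
  (forall d x, P d x -> -1 < x < 1) ->
  herglotz_nevanlinna n W -> mholo_on n in_slit W ->
  (forall i j, (i < n)%nat -> (j < n)%nat -> tends P (fun x => W (RtoC x) i j) (L i j)) ->
  meq n L (adj L).
Proof.
intros hP ne inside hN holo lim i j hi hj.
apply (tends_unique P (fun x => W (RtoC x) i j)); trivial; [apply lim; trivial|].
intros eps he; destruct (lim j i hj hi eps he) as [d [p q]]; exists d; split; trivial.
intros x hx; rewrite (herglotz_hermitian_real n W x hN holo (inside d x hx) i j hi hj); unfold adj.
specialize (q x hx).
replace (Cabs (Csub (Cconj (W (RtoC x) j i)) (Cconj (L j i)))) with (Cabs (Csub (W (RtoC x) j i) (L j i)));
  [exact q|unfold Cabs, Cnorm2; simpl; f_equal; ring].
Qed.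

Lemma mlim_left_hermitian (n : nat) (W : Cplx -> Mat) (L : Mat) :
  herglotz_nevanlinna n W -> mholo_on n in_slit W -> mlim_left n W 1 L -> meq n L (adj L).
Proof.
intros hN holo lim; apply (tends_hermitian left_of_1 n W L left_of_1_mono); trivial.
- intros d hd; exists (Rmax 0 (1 - d / 2)); unfold left_of_1.
  pose proof (Rmax_l 0 (1 - d / 2)); pose proof (Rmax_r 0 (1 - d / 2)).
  assert (Rmax 0 (1 - d / 2) < 1) by (apply Rmax_lub_lt; lra); lra.
- unfold left_of_1; intros; lra.
- apply mlim_left_tends, lim.
Qed.

Lemma mlim_right_hermitian (n : nat) (W : Cplx -> Mat) (L : Mat) :
  herglotz_nevanlinna n W -> mholo_on n in_slit W -> mlim_right n W (-1) L -> meq n L (adj L).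
Proof.
intros hN holo lim; apply (tends_hermitian right_of_m1 n W L right_of_m1_mono); trivial.
- intros d hd; exists (- Rmax 0 (1 - d / 2)); unfold right_of_m1.
  pose proof (Rmax_l 0 (1 - d / 2)); pose proof (Rmax_r 0 (1 - d / 2)).
  assert (Rmax 0 (1 - d / 2) < 1) by (apply Rmax_lub_lt; lra); lra.
- unfold right_of_m1; intros; lra.
- apply mlim_right_tends, lim.
Qed.

Lemma sform_hermitian_im (n : nat) (A : Mat) (v : Vec) : meq n A (adj A) -> im (sform n A v v) = 0.
Proof.
intros h; pose proof (sform_ext n A (adj A) v v h) as e; rewrite sform_adj in e.
apply (f_equal im) in e; simpl in e; lra.
Qed.

Lemma meq_hermitian_combination (n : nat) (a b : R) (A B : Mat) :
  meq n A (adj A) -> meq n B (adj B) ->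
  let H := madd (mscale (RtoC a) A) (mscale (RtoC b) B) in meq n H (adj H).
Proof.
intros hA hB H i j hi hj; unfold H, madd, mscale, adj.
rewrite (hA i j hi hj), (hB i j hi hj); unfold adj; apply Cplx_ext; simpl; ring.
Qed.

(** The bound involves [G] but not [A], so for [A = C z] it is uniform in [z], as [disc_uniqueness]
    requires. *)
Lemma sform_bounded (n : nat) (A G : Mat) (u v : Vec) :
  (forall x, Cabs (sform n A x x) <= re (sform n G x x)) ->
  Cabs (sform n A u v) <=
    let q c := let x := fun k => Cadd (v k) (Cmul c (u k)) in re (sform n G x x) in
    q C1 + q (Copp C1) + (q Ci + q (Copp Ci)).
Proof.
intros h.
pose (q := fun c => let x := fun k => Cadd (v k) (Cmul c (u k)) in re (sform n G x x)).
change (Cabs (sform n A u v) <= q C1 + q (Copp C1) + (q Ci + q (Copp Ci))).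
assert (e : 4 * Cabs (sform n A u v) <= q C1 + q (Copp C1) + (q Ci + q (Copp Ci))).
{ replace (4 * Cabs (sform n A u v)) with (Cabs (Cmul (RtoC 4) (sform n A u v)))
    by (rewrite Cabs_mul, Cabs_RtoC, Rabs_pos_eq; lra).
  rewrite sform_polarization; unfold Csub.
  eapply Rle_trans; [apply Cabs_add|]; apply Rplus_le_compat; [|rewrite Cabs_Ci_mul];
  (eapply Rle_trans; [apply Cabs_add|]); rewrite Cabs_opp; apply Rplus_le_compat; apply h. }
pose proof (Cabs_ge0 (sform n A u v)); lra.
Qed.

(** Packs the analysis for the linear algebra, which uses no limit or derivative afterwards.
    Centring [W] at the half sum turns discs with diameter [[p, q]] into the bound by [G], and the
    same shift reduces [Theta C0] to the term [Q X Q] of the operator ball. *)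
Lemma inner_sqs_data (n : nat) (Theta : Cplx -> Mat) :
  Sqs n Theta -> inner_fn n Theta ->
  exists (C : Cplx -> Mat) (G K Q X : Mat),
  (forall z, inD z -> meq n (Theta z) (madd (C z) K)) /\
  (forall v z, in_slit z -> Cnorm2 z <= 1 -> Cabs (sform n (C z) v v) <= re (sform n G v v)) /\
  (forall v, 0 < re (sform n G v v) -> Cabs (sform n (C Ci) v v) = re (sform n G v v) ->
     exists a, -1 < a < 1 /\ forall z, 0 < im z ->
       sform n (C z) v v = Cmul (RtoC (re (sform n G v v))) (blaschke a z)) /\
  (forall u v a, -1 < a < 1 ->
     (forall z, im z <> 0 -> Cnorm2 z = 1 -> sform n (C z) u v = Cmul (blaschke a z) (inner n u v)) ->
     forall z, inD z -> sform n (C z) u v = Cmul (blaschke a z) (inner n u v)) /\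
  (forall z, im z <> 0 -> meq n (C (Cconj z)) (adj (C z))) /\
  (forall z, im z <> 0 -> Cnorm2 z = 1 ->
     meq n (mmul n (adj (madd (C z) K)) (madd (C z) K)) mI) /\
  meq n G (adj G) /\ meq n Q (adj Q) /\ meq n (mmul n Q Q) (msub mI G) /\
  contraction n X /\ meq n K (mmul n Q (mmul n X Q)).
Proof.
intros [W [hW [hN [holo [W1 [Wm1 [l1 [lm1 [_ ball]]]]]]]]] inn.
destruct ball as [_ [Q [X [hQ [hQQ [hX hT]]]]]].
assert (h1 : meq n W1 (adj W1)) by (eapply mlim_left_hermitian; eassumption).
assert (hm1 : meq n Wm1 (adj Wm1)) by (eapply mlim_right_hermitian; eassumption).
pose (M := madd (mscale (RtoC (/ 2)) W1) (mscale (RtoC (/ 2)) Wm1)).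
pose (G := madd (mscale (RtoC (/ 2)) W1) (mscale (RtoC (- / 2)) Wm1)).
assert (hM : meq n M (adj M)) by (apply meq_hermitian_combination; assumption).
assert (hG : meq n G (adj G)) by (apply meq_hermitian_combination; assumption).
pose (C := fun z => msub (W z) M).
pose (K := madd (Theta C0) M).
assert (sh := fun v => sform_slit_herglotz n W W1 Wm1 v hN holo l1 lm1).
assert (eG : forall v, re (sform n G v v) = (re (sform n W1 v v) - re (sform n Wm1 v v)) / 2).
{ intros v; unfold G; rewrite sform_madd, !sform_mscale; simpl; field. }
assert (eM : forall v, sform n M v v = RtoC ((re (sform n Wm1 v v) + re (sform n W1 v v)) / 2)).
{ intros v; apply Cplx_ext; [|exact (sform_hermitian_im n M v hM)].
  unfold M; rewrite sform_madd, !sform_mscale; simpl; field. }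
assert (cone : forall v z, in_slit z -> Cnorm2 z <= 1 -> Cabs (sform n (C z) v v) <= re (sform n G v v)).
{ intros v z hz hn; unfold C; rewrite sform_msub, eM, eG.
  exact (slit_cone_disc _ _ _ z (sh v) hz hn). }
assert (hC : forall z k l, (k < n)%nat -> (l < n)%nat -> in_slit z -> holc (fun w => C w k l) z).
{ intros z k l hk hl hz; apply (holc_sub (fun w => W w k l)); [|apply (holc_const (M k l))].
  apply cdiff_holc, holo; trivial. }
exists C, G, K, Q, X; split; [|split; [exact cone|split; [|split; [|split; [|split; [|split; [exact hG|split]]]]]]].
- intros z hz i j hi hj; unfold C, K, madd, msub; rewrite (hW z hz i j hi hj); unfold msub; ring.
- intros v pos eq; rewrite eG in pos.
  set (w := fun z => sform n (W z) v v).
  set (p := re (sform n Wm1 v v)) in *; set (q := re (sform n W1 v v)) in *.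
  destruct (slit_herglotz_rigidity w p q (sh v) ltac:(lra)) as [a [ha hb]].
  + unfold C in eq; rewrite sform_msub, eM, eG in eq; fold p q in eq; fold (w Ci) in eq.
    apply (f_equal (fun t => t * t)) in eq; rewrite Cabs_sqr in eq; unfold Cnorm2 in eq; simpl in eq; lra.
  + exists a; split; [exact ha|]; intros z hz; unfold C; rewrite sform_msub, eM, eG; apply hb, hz.
- intros u v a ha circ z hz.
  pose (f := fun z => Csub (sform n (C z) u v) (Cmul (blaschke a z) (inner n u v))).
  assert (fz : f z = C0).
  { pose (B := let q c := let x := fun k => Cadd (v k) (Cmul c (u k)) in re (sform n G x x) in
      q C1 + q (Copp C1) + (q Ci + q (Copp Ci))).
    apply (disc_uniqueness f (B + Cabs (inner n u v))); trivial.
    - intros t ht; apply holc_sub.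
      + apply (holc_sform n C u v); intros k l hk hl; apply hC; trivial.
      + apply holc_mul; [apply holc_blaschke; trivial|apply holc_const].
    - intros t ht hn; unfold f, Csub; eapply Rle_trans; [apply Cabs_add|].
      rewrite Cabs_opp, Cabs_mul; apply Rplus_le_compat.
      + apply (sform_bounded n (C t) G u v); intros x; apply cone; trivial.
      + pose proof (Cabs_ge0 (inner n u v)); pose proof (blaschke_closed_disc a t ha ht hn); nra.
    - intros t ht hn; unfold f; rewrite circ by trivial; ring. }
  unfold f in fz; replace (sform n (C z) u v) with
    (Cadd (Csub (sform n (C z) u v) (Cmul (blaschke a z) (inner n u v))) (Cmul (blaschke a z) (inner n u v))) by ring.
  rewrite fz; ring.
- intros z hz i j hi hj; destruct hN as [_ [sym _]].
  unfold C, msub; rewrite (sym z hz i j hi hj), (hM i j hi hj); unfold adj; apply Cplx_ext; simpl; ring.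
- intros z hz hn i j hi hj.
  pose proof (inner_unitary_circle n Theta W hW holo inn z hz hn i j hi hj) as e.
  rewrite <- e; apply csum_ext; intros k hk; unfold adj, C, K, madd, msub; f_equal; [f_equal|]; ring.
- apply hQ.
- split; [|split; [exact hX|]].
  + intros i j hi hj; rewrite (hQQ i j hi hj); unfold G, msub, madd, mscale; apply Cplx_ext; simpl; ring.
  + intros i j hi hj; unfold K; unfold madd at 1; rewrite (hT i j hi hj).
    unfold M, madd, mscale; apply Cplx_ext; simpl; ring.
Qed.

(** * Linear algebra of the unitary boundary values *)

Module HermitianForms.
Set Implicit Arguments.
Unset Strict Implicit.
Import all_boot all_order all_algebra mathcomp.algebra_tactics.ring.
Import Order.TTheory GRing.Theory Num.Theory.
Local Open Scope ring_scope.

Section Forms.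
Variables (C : numClosedFieldType) (n : nat).
Implicit Types (A B G H L : 'M[C]_n) (u v x y : 'cV[C]_n).

Definition adjmx p q (A : 'M[C]_(p, q)) : 'M[C]_(q, p) := map_mx Num.conj A^T.

Lemma adjmxM p q r (A : 'M[C]_(p, q)) (B : 'M_(q, r)) :
  adjmx (A *m B) = adjmx B *m adjmx A.
Proof. by rewrite /adjmx trmx_mul map_mxM. Qed.

Lemma adjmxD p q (A B : 'M[C]_(p, q)) : adjmx (A + B) = adjmx A + adjmx B.
Proof. by rewrite /adjmx linearD map_mxD. Qed.

Lemma adjmxB p q (A B : 'M[C]_(p, q)) : adjmx (A - B) = adjmx A - adjmx B.
Proof. by rewrite /adjmx linearB map_mxB. Qed.

Lemma adjmxZ p q c (A : 'M[C]_(p, q)) : adjmx (c *: A) = c^* *: adjmx A.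
Proof. by apply/matrixP => i j; rewrite !mxE rmorphM. Qed.

Lemma adjmxK p q (A : 'M[C]_(p, q)) : adjmx (adjmx A) = A.
Proof. by apply/matrixP => i j; rewrite !mxE conjCK. Qed.

Lemma adjmx1 p : adjmx (1%:M : 'M[C]_p) = 1%:M.
Proof. by rewrite /adjmx trmx1 map_mx1. Qed.

Definition frm A u v : C := (adjmx u *m A *m v) 0 0.
Definition dot u v : C := (adjmx u *m v) 0 0.

Lemma frmE A u v : frm A u v = dot u (A *m v).
Proof. by rewrite /frm /dot mulmxA. Qed.

Lemma dotDr u v w : dot u (v + w) = dot u v + dot u w.
Proof. by rewrite /dot mulmxDr mxE. Qed.

Lemma dotBr u v w : dot u (v - w) = dot u v - dot u w.
Proof. by rewrite /dot mulmxBr !mxE. Qed.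

Lemma dotZr u c v : dot u (c *: v) = c * dot u v.
Proof. by rewrite /dot -scalemxAr mxE. Qed.

Lemma dotC u v : dot u v = (dot v u)^*.
Proof.
by rewrite /dot -{1}(adjmxK v) -adjmxM /adjmx !mxE.
Qed.

Lemma dotBl u v w : dot (u - v) w = dot u w - dot v w.
Proof. by rewrite dotC dotBr rmorphB /= -!dotC. Qed.

Lemma dotZl u c v : dot (c *: u) v = c^* * dot u v.
Proof. by rewrite dotC dotZr rmorphM /= -dotC. Qed.

Lemma dot_adj A u v : dot (A *m u) v = dot u (adjmx A *m v).
Proof. by rewrite /dot adjmxM mulmxA. Qed.

Lemma dotE u : dot u u = \sum_i `|u i 0| ^+ 2.
Proof. by rewrite /dot mxE; apply: eq_bigr => i _; rewrite !mxE normCKC. Qed.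

Lemma dot_ge0 u : 0 <= dot u u.
Proof. by rewrite dotE sumr_ge0 // => i _; rewrite exprn_ge0. Qed.

Lemma dot_eq0 u : dot u u = 0 -> u = 0.
Proof.
rewrite dotE => /eqP; rewrite psumr_eq0 => [/allP h|i _]; last by rewrite exprn_ge0.
apply/matrixP => i j; rewrite ord1 mxE.
by have := h i (mem_index_enum i); rewrite /= sqrf_eq0 normr_eq0 => /eqP.
Qed.

Lemma dot_inj x y : (forall u, dot u x = dot u y) -> x = y.
Proof.
move=> h; apply/eqP; rewrite -subr_eq0; apply/eqP/dot_eq0.
by rewrite dotBr h subrr.
Qed.

(** A nonnegative form that vanishes at [x] is minimal there, so its variation in the direction of
    [A x] has to vanish. *)
Lemma frm_zero A x :
  adjmx A = A -> (forall v, 0 <= frm A v v) -> frm A x x = 0 -> A *m x = 0.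
Proof.
move=> hA pos x0; set y := A *m x.
have expand t : t \is Num.real -> 0 <= - (2 * t * dot y y) + t ^+ 2 * frm A y y.
  move=> tr; have := pos (x - t *: y).
  have -> : frm A (x - t *: y) (x - t *: y) =
     frm A x x - (t * frm A x y + t^* * frm A y x) + t * t^* * frm A y y.
    rewrite !frmE mulmxBr -scalemxAr !dotBl !dotBr !dotZl !dotZr; ring.
  rewrite x0 (CrealP tr) (frmE A x y) (frmE A y x).
  rewrite -{1}hA -dot_adj -/y expr2 => h; apply: le_trans h _.
  by rewrite le_eqVlt; apply/orP; left; apply/eqP; ring.
have [yy0|ypos] : dot y y = 0 \/ 0 < dot y y.
- by have := dot_ge0 y; rewrite le_eqVlt => /orP[/eqP <-|]; [left|right].
- exact: dot_eq0.
exfalso; set q := frm A y y in expand; set d := dot y y in expand ypos *.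
have q0 : 0 <= q := pos y.
have dr : 0 < q + d by rewrite ltr_wpDl.
(* This [t] makes the quadratic polynomial negative, and its denominator is positive even if
   [q = 0]. *)
have := expand (d / (q + d)) (ger0_real (divr_ge0 (ltW ypos) (ltW dr))).
have -> : - (2 * (d / (q + d)) * d) + (d / (q + d)) ^+ 2 * q =
  - (d ^+ 2 / (q + d) ^+ 2 * (q + 2 * d)) by field; rewrite gt_eqF.
rewrite oppr_ge0 => le0; suff /lt_le_trans/(_ le0) : 0 < d ^+ 2 / (q + d) ^+ 2 * (q + 2 * d) by rewrite ltxx.
by rewrite mulr_gt0 ?divr_gt0 ?exprn_gt0 // ltr_wpDl // mulr_gt0.
Qed.

Lemma frm_adj A u v : frm (adjmx A) u v = (frm A v u)^*.
Proof. by rewrite !frmE -dotC dot_adj. Qed.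

Lemma frmD A B u v : frm (A + B) u v = frm A u v + frm B u v.
Proof. by rewrite !frmE mulmxDl dotDr. Qed.

Lemma frmB A B u v : frm (A - B) u v = frm A u v - frm B u v.
Proof. by rewrite !frmE mulmxBl dotBr. Qed.

Lemma frmZ c A u v : frm (c *: A) u v = c * frm A u v.
Proof. by rewrite !frmE -scalemxAl dotZr. Qed.

Lemma addC_conj_le (z : C) : z + z^* <= 2 * `|z|.
Proof.
have -> : z + z^* = 2 * 'Re z by rewrite ReE mulrC divfK ?pnatr_eq0.
by rewrite ler_pM2l ?ltr0n // (leif_Re_Creal z).1.
Qed.

Lemma unimodular_norm (l : C) : l * l^* = 1 -> `|l| = 1.
Proof. by move=> h; apply/eqP; rewrite -(@pexpr_eq1 _ _ 2) // normCK h. Qed.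

(** The modulus bound says that the real part of [l^*] times [frm A v v] is at most [frm G v v] for
    every unimodular [l]. Each rotation is thus a nonnegative hermitian form, accessible to
    [frm_zero]. *)
Lemma rotated_cone A G l :
  adjmx G = G -> (forall v, `|frm A v v| <= frm G v v) -> l * l^* = 1 ->
  let H := 2 *: G - (l^* *: A + l *: adjmx A) in
  adjmx H = H /\ (forall v, 0 <= frm H v v).
Proof.
move=> hG cone hl H; split.
  by rewrite /H adjmxB adjmxD !adjmxZ hG adjmxK conjCK conjC_nat [l *: _ + _]addrC.
move=> v; rewrite /H frmB frmD !frmZ frm_adj subr_ge0.
have -> : l * (frm A v v)^* = (l^* * frm A v v)^* by rewrite rmorphM /= conjCK.
apply: le_trans (addC_conj_le _) _.
by rewrite ler_pM2l ?ltr0n // normrM norm_conjC (unimodular_norm hl) mul1r.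
Qed.

(** The rotations by [1] and by [i] give [A x = - adjmx A x] and [A x = adjmx A x]. *)
Lemma dominated_kernel A G x :
  adjmx G = G -> (forall v, `|frm A v v| <= frm G v v) -> G *m x = 0 -> A *m x = 0.
Proof.
move=> hG cone Gx.
have c0 : frm A x x = 0.
  by apply/eqP; rewrite -normr_le0 (le_trans (cone x)) // frmE Gx /dot mulmx0 mxE.
have rot l : l * l^* = 1 -> l^* *: (A *m x) + l *: (adjmx A *m x) = 0.
  move=> hl; have [hH pos] := rotated_cone hG cone hl.
  have := @frm_zero _ x hH pos; rewrite frmB frmD !frmZ frm_adj c0 conjC0 !mulr0 addr0.
  rewrite frmE Gx {1}/dot mulmx0 mxE mulr0 subrr => /(_ erefl).
  rewrite mulmxBl mulmxDl -!scalemxAl Gx scaler0 sub0r => /eqP.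
  by rewrite oppr_eq0 => /eqP.
have := rot 1; rewrite conjC1 mulr1 !scale1r => /(_ erefl) h1.
have := rot 'i; rewrite conjCi mulrN -expr2 sqrCi opprK => /(_ erefl).
rewrite scaleNr addrC => /eqP; rewrite subr_eq0 => /eqP h.
have h2 : adjmx A *m x = A *m x.
  have := congr1 (fun w => 'i^-1 *: w) h; rewrite !scalerA mulVf ?neq0Ci ?scale1r //.
by move: h1; rewrite h2 -mulr2n -scaler_nat => /eqP; rewrite scaler_eq0 pnatr_eq0 => /eqP.
Qed.

(* Equality in [N = |c + k| <= |c| + |k| <= g + (N - g)] puts [x] in the kernel of the
   positive forms measuring the defect of each inequality. *)
Lemma eigenvector_split A G K Q X l x :
  adjmx G = G -> (forall v, `|frm A v v| <= frm G v v) ->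
  adjmx Q = Q -> Q *m Q = 1%:M - G -> (forall v, dot (X *m v) (X *m v) <= dot v v) ->
  K = Q *m (X *m Q) -> l * l^* = 1 -> (A + K) *m x = l *: x ->
  [/\ A *m x = l *: (G *m x), adjmx A *m x = l^* *: (G *m x)
    & K *m x = l *: ((1%:M - G) *m x)].
Proof.
move=> hG cone hQ QQ contr eK hl eig.
have [hH pos] := rotated_cone hG cone hl.
set H := _ - _ in hH pos.
set q := Q *m x; set w := X *m q.
have Kx : K *m x = Q *m w by rewrite eK -!mulmxA.
have qq : dot q q = dot x x - frm G x x.
  by rewrite /q dot_adj hQ mulmxA QQ mulmxBl mul1mx dotBr -frmE.
have qw : frm K x x = dot q w by rewrite frmE Kx /q dot_adj hQ.
have sum : frm A x x + frm K x x = l * dot x x.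
  by rewrite -frmD frmE eig dotZr.
have sumC : (frm A x x)^* + (frm K x x)^* = l^* * dot x x.
  by rewrite -rmorphD /= sum rmorphM /= -dotC.
have ll : l^* * l = 1 by rewrite mulrC.
(* Both terms on the left are nonnegative, and the right side is at most zero because [X] is a
   contraction; hence both defects vanish. *)
have key : dot (w - l *: q) (w - l *: q) + frm H x x = dot w w - dot q q.
  rewrite !dotBl !dotBr !dotZl !dotZr /H frmB frmD !frmZ frm_adj (dotC w q) -qw.
  have -> : (frm A x x)^* = l^* * dot x x - (frm K x x)^* by rewrite -sumC addrK.
  have -> : frm A x x = l * dot x x - frm K x x by rewrite -sum addrK.
  have -> : frm G x x = dot x x - dot q q by rewrite qq opprB addrC subrK.
  have e1 : l^* * (l * dot q q) = dot q q by rewrite mulrA ll mul1r.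
  rewrite !mulrBr e1 !mulrA ll hl !mul1r; ring.
have le0 : dot (w - l *: q) (w - l *: q) + frm H x x <= 0.
  by rewrite key subr_le0 contr.
have d0 : dot (w - l *: q) (w - l *: q) = 0.
  apply/eqP; rewrite eq_le dot_ge0 andbT; apply: le_trans le0; by rewrite lerDl pos.
have f0 : frm H x x = 0 by move: le0 (pos x); rewrite d0 add0r => h1 h2; apply/eqP; rewrite eq_le h1 h2.
have wq : w = l *: q by apply/eqP; rewrite -subr_eq0; apply/eqP/dot_eq0.
have eKx : K *m x = l *: ((1%:M - G) *m x) by rewrite Kx wq -scalemxAr /q mulmxA QQ.
have eAx : A *m x = l *: (G *m x).
  have := eig; rewrite mulmxDl eKx mulmxBl mul1mx scalerBr => e.
  by move: e; rewrite addrCA -[RHS]addr0 => /addrI /eqP; rewrite subr_eq0 => /eqP.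
split=> //.
have := frm_zero hH pos f0; rewrite mulmxBl mulmxDl -!scalemxAl eAx scalerA ll scale1r.
move/eqP; rewrite subr_eq0 scaler_nat mulr2n => /eqP /addrI e.
by rewrite e scalerA ll scale1r.
Qed.

(** The spectral theorem has the shape [N = P^-1 D P], so the eigenvectors, common to [N] and its
    adjoint, are the columns of [adjmx P]. *)
Lemma spectral_columns N : N *m adjmx N = adjmx N *m N ->
  exists (P : 'M[C]_n) (d : 'I_n -> C), [/\ P *m adjmx P = 1%:M, adjmx P *m P = 1%:M,
    forall j, N *m col j (adjmx P) = d j *: col j (adjmx P)
    & forall j, adjmx N *m col j (adjmx P) = (d j)^* *: col j (adjmx P)].
Proof.
move=> hN; have nN : N \is normalmx by apply/normalmxP.
have := orthomx_spectralP nN; set P := spectralmx N; set d := spectral_diag N => eN.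
have uP : P *m adjmx P = 1%:M by apply/unitarymxP; exact: spectral_unitarymx.
have uP' : adjmx P *m P = 1%:M by apply: mulmx1C.
have iP : invmx P = adjmx P by apply: invmx_unitary; exact: spectral_unitarymx.
rewrite iP in eN.
have diagE (D : 'rV[C]_n) j : adjmx P *m diag_mx D *m P *m col j (adjmx P) = D 0 j *: col j (adjmx P).
  rewrite colE !mulmxA -[_ *m P *m _]mulmxA uP mulmx1 -colE mul_mx_diag -colE.
  by apply/matrixP => i k; rewrite !mxE mulrC.
exists P, (fun j => d 0 j); split=> // j; first by rewrite {1}eN diagE.
have -> : adjmx N = adjmx P *m diag_mx (map_mx Num.conj d) *m P.
  rewrite eN !adjmxM adjmxK mulmxA; congr (_ *m _ *m _).
  by rewrite /adjmx tr_diag_mx map_diag_mx.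
by rewrite diagE mxE.
Qed.

Lemma eq_on_columns (P A B : 'M[C]_n) : adjmx P *m P = 1%:M ->
  (forall j, A *m col j (adjmx P) = B *m col j (adjmx P)) -> A = B.
Proof.
move=> uP h; rewrite -[A]mulmx1 -[B]mulmx1 -uP !mulmxA; congr (_ *m _).
apply/matrixP => i j.
by have := congr1 (fun M : 'cV_n => M i 0) (h j); rewrite !colE !mulmxA -!colE !mxE.
Qed.

(** The two kinds of diagonal entry, a Blaschke factor or a unimodular constant, as they appear
    along a single eigenvector [y]. *)
Definition family_on_columns (Z T : Type) (disc : Z -> Prop) (ok : T -> Prop) (b : T -> Z -> C)
    (Th : Z -> 'M[C]_n) y : Prop :=
  (exists2 a, ok a & forall z, disc z -> Th z *m y = b a z *: y) \/
  (exists2 l : C, l * l^* = 1 & forall z, disc z -> Th z *m y = l *: y).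

(** The disc, the arcs, the conjugation and the Blaschke factors are abstract here, which leaves
    linear algebra over a numerically closed field; [i0] stands for [i]. The condition on
    [b a i0 ^+ 2] records that a Blaschke factor is not real at [i]. *)
Theorem inner_structure (Z T : Type) (disc closed circ upper : Z -> Prop) (cj : Z -> Z) (i0 : Z)
    (ok : T -> Prop) (b : T -> Z -> C) (F : Z -> 'M[C]_n) G K Q X :
  (forall z, disc z -> closed z) -> (forall z, circ z -> closed z) ->
  (forall z, circ z -> circ (cj z)) ->
  (forall z, circ z -> upper z \/ upper (cj z)) -> circ i0 -> upper i0 ->
  (forall a z, ok a -> circ z -> b a z * (b a z)^* = 1) ->
  (forall a z, b a (cj z) = (b a z)^*) ->
  (forall a, ok a -> b a i0 ^+ 2 != 1) ->
  (forall v z, closed z -> `|frm (F z) v v| <= frm G v v) ->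
  (forall v, 0 < frm G v v -> `|frm (F i0) v v| = frm G v v ->
     exists2 a, ok a & forall z, upper z -> frm (F z) v v = frm G v v * b a z) ->
  (forall u v a, ok a -> (forall z, circ z -> frm (F z) u v = b a z * dot u v) ->
     forall z, disc z -> frm (F z) u v = b a z * dot u v) ->
  (forall z, circ z -> F (cj z) = adjmx (F z)) ->
  (forall z, circ z -> adjmx (F z + K) *m (F z + K) = 1%:M) ->
  adjmx G = G -> adjmx Q = Q -> Q *m Q = 1%:M - G ->
  (forall v, dot (X *m v) (X *m v) <= dot v v) -> K = Q *m (X *m Q) ->
  exists P : 'M[C]_n, [/\ P *m adjmx P = 1%:M, adjmx P *m P = 1%:M &
    forall j, family_on_columns disc ok b (fun z => F z + K) (col j (adjmx P))].
Proof.
move=> dc cc ccj cup ci ui bcirc bcj bi cone rigid uniq sym uni hG hQ QQ contr eK.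
set A := F i0; set L := A + K.
have coneA v : `|frm A v v| <= frm G v v by apply: cone; apply: cc.
have LL : adjmx L *m L = 1%:M := uni i0 ci.
have LL' : L *m adjmx L = 1%:M by apply: mulmx1C.
have eigen_unimod x l : x != 0 -> L *m x = l *: x -> l * l^* = 1.
  move=> x0 e; have : dot (L *m x) (L *m x) = dot x x by rewrite dot_adj mulmxA LL mul1mx.
  rewrite e dotZl dotZr mulrA => /eqP; rewrite -subr_eq0 -[X in _ - X]mul1r -mulrBl mulf_eq0.
  case/orP => [|/eqP /dot_eq0 /eqP]; last by rewrite (negbTE x0).
  by rewrite subr_eq0 mulrC => /eqP.
have col_neq0 (P : 'M[C]_n) j : P *m adjmx P = 1%:M -> col j (adjmx P) != 0.
  move=> uP; apply/eqP => e; have := congr1 (fun M : 'M_n => M j j) uP.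
  have -> : (P *m adjmx P) j j = (P *m col j (adjmx P)) j 0 by rewrite colE mulmxA -colE [RHS]mxE.
  by rewrite e mulmx0 !mxE eqxx => /eqP; rewrite eq_sym oner_eq0.
(* [L] is unitary, hence normal; the matrix identities below are checked on its orthonormal
   eigenbasis. *)
have [P [d [uP uP' LP LPa]]] := spectral_columns (etrans LL' (esym LL)).
have split_j j := eigenvector_split hG coneA hQ QQ contr eK
   (eigen_unimod _ _ (col_neq0 P j uP) (LP j)) (LP j).
have eA : A = G *m L.
  apply: (eq_on_columns uP') => j; case: (split_j j) => -> _ _.
  by rewrite -mulmxA LP -scalemxAr.
have eAa : adjmx A = G *m adjmx L.
  apply: (eq_on_columns uP') => j; case: (split_j j) => _ -> _.
  by rewrite -mulmxA LPa -scalemxAr.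
have eK' : K = (1%:M - G) *m L.
  apply: (eq_on_columns uP') => j; case: (split_j j) => _ _ ->.
  by rewrite -mulmxA LP -scalemxAr.
(* The adjoint of [adjmx A = G *m adjmx L] reads [A = L *m G]. *)
have GL : G *m L = L *m G.
  by rewrite -eA -[A]adjmxK eAa adjmxM adjmxK hG.
have GLa : G *m adjmx L = adjmx L *m G.
  by rewrite -{1}hG -adjmxM -GL adjmxM hG.
(* Unitarity at [cj i0], where the value of [F] is [adjmx A]. *)
have uni' : adjmx (G *m adjmx L + (1%:M - G) *m L) *m (G *m adjmx L + (1%:M - G) *m L) = 1%:M.
  by rewrite -eAa -eK' -sym //; apply/uni/ccj.
clearbody L.
(* Otherwise the form of [G] is positive at this column, and rigidity yields a factor with
   [b a i0 = d j], whose square is not [1]. *)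
have real_kernel j : d j ^+ 2 = 1 -> G *m col j (adjmx P) = 0.
  move=> d2; set x := col j _; apply: (frm_zero hG).
    by move=> v; apply: le_trans (coneA v).
  have g0 : 0 <= frm G x x by apply: le_trans (coneA x).
  move: g0; rewrite le_eqVlt => /orP[/eqP <- //|gpos]; exfalso.
  have fA : frm A x x = d j * frm G x x.
    by case: (split_j j) => e _ _; rewrite frmE e dotZr -frmE.
  have [|a oka ha] := rigid x gpos.
    rewrite fA normrM (unimodular_norm (eigen_unimod _ _ (col_neq0 P j uP) (LP j))) mul1r.
    by rewrite ger0_norm // ltW.
  have := ha _ ui; rewrite fA mulrC => /(mulfI (lt0r_neq0 gpos)) e.
  by move: (bi a oka); rewrite -e d2 eqxx.
have GG : G *m G = G.
  apply: (eq_on_columns uP') => j; set x := col j _.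
  have [/real_kernel e|d2] := eqVneq (d j ^+ 2) 1; first by rewrite -mulmxA e mulmx0.
  have dd := eigen_unimod _ _ (col_neq0 P j uP) (LP j).
  have ddc : (d j)^* * d j = 1 by rewrite mulrC.
  have Lx : L *m x = d j *: x := LP j; have Lax : adjmx L *m x = (d j)^* *: x := LPa j.
  have comm B (w : 'cV[C]_n) c : G *m B = B *m G -> B *m w = c *: w -> B *m (G *m w) = c *: (G *m w).
    by move=> eB e; rewrite mulmxA -eB -mulmxA e -scalemxAr.
  have := congr1 (fun M => M *m x) uni'; rewrite /= mul1mx -mulmxA adjmxD !adjmxM adjmxK hG adjmxB adjmx1 hG.
  rewrite mulmxDl -!mulmxA [adjmx L *m x]LPa [L *m x]LP -/x !(mulmxBl, mul1mx, mulmxBr, mulmxDr, =^~ scalemxAr).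
  have Lg := comm _ _ _ GL (LP j); have Lag := comm _ _ _ GLa (LPa j).
  rewrite -/x in Lg Lag; rewrite mulmx1 !(mulmxDl, mulNmx) -!mulmxA (comm _ _ _ GL Lg) (comm _ _ _ GLa Lag) Lg Lag ?Lx ?Lax.
  set gx := G *m x; set ggx := G *m gx; clearbody gx ggx x; move/matrixP => e.
  apply/matrixP => k k'; have := e k k'; rewrite !mxE => e'.
  (* Unitarity at [cj i0] factors in this way. As [d j] is unimodular, the first factor times
     [d j ^+ 2] is [(d j ^+ 2 - 1) ^+ 2], which is nonzero in this case. *)
  have : (d j ^+ 2 + (d j)^* ^+ 2 - 2) * (gx k k' - ggx k k') = 0.
    move: e' ddc; move: (d j) ((d j)^*) (x k k') (gx k k') (ggx k k') => D Dc X0 g gg e' DD.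
    have -> : (D ^+ 2 + Dc ^+ 2 - 2) * (g - gg) =
      (Dc * (D * gg + (Dc * g - Dc * gg)) +
        (D * (D * g + (Dc * X0 - Dc * g)) - D * (D * gg + (Dc * g - Dc * gg)))) - X0 + (1 - Dc * D) * (X0 - 2 * g + 2 * gg) by ring.
    by rewrite DD subrr mul0r addr0 e' subrr.
  move/eqP; rewrite mulf_eq0 => /orP[|]; last by rewrite subr_eq0 => /eqP.
  move/eqP => z0; exfalso; move/eqP: d2; apply; apply/eqP; rewrite -subr_eq0 -sqrf_eq0.
  have -> : (d j ^+ 2 - 1) ^+ 2 = (d j ^+ 2 + (d j)^* ^+ 2 - 2) * d j ^+ 2 +
     (1 - (d j)^* * d j) * (1 + (d j)^* * d j) by ring.
  by rewrite z0 ddc subrr !mul0r addr0.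
(* A single normal matrix whose eigenvectors are joint ones of the commuting [L] and [G]: an
   eigenvalue is [(1 + g) l], so its modulus yields [g] through [(1 + G) ^+ 2 = 1 + 3 G], and its
   phase yields [l]. *)
set T0 := L *m (1%:M + G).
have sq : (1%:M + G) *m (1%:M + G) = 1%:M + 3 *: G.
  rewrite mulmxDl !mulmxDr !mul1mx mulmx1 GG.
  by apply/matrixP => k k'; rewrite !mxE; ring.
have adjG1 : adjmx (1%:M + G) = 1%:M + G by rewrite adjmxD adjmx1 hG.
have TaT : adjmx T0 *m T0 = 1%:M + 3 *: G.
  by rewrite /T0 adjmxM adjG1 mulmxA -[_ *m adjmx L *m L]mulmxA LL mulmx1 sq.
have TTa : T0 *m adjmx T0 = 1%:M + 3 *: G.
  rewrite /T0 adjmxM adjG1 mulmxA -[_ *m _ *m (_ + G)]mulmxA sq mulmxDr mulmx1 -scalemxAr -GL scalemxAl.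
  by rewrite -[X in X + _]mul1mx -mulmxDl -mulmxA LL' mulmx1.
have [P' [t [uR uR' TR TRa]]] := spectral_columns (etrans TTa (esym TaT)).
exists P'; split=> // j; have := TR j; have := TRa j; have := col_neq0 P' j uR.
set y := col j _ => y0 Tay Ty.
set g := (t j * (t j)^* - 1) / 3.
have Gy : G *m y = g *: y.
  have : (1%:M + 3 *: G) *m y = (t j * (t j)^*) *: y.
    by rewrite -TaT -mulmxA Ty -scalemxAr Tay scalerA.
  rewrite mulmxDl mul1mx -scalemxAl /g => e.
  rewrite mulrC -scalerA scalerBl scale1r -e [y + _]addrC addrK scalerA mulVf ?scale1r //.
  by rewrite pnatr_eq0.
have g01 : g = 0 \/ g = 1.
  have : g *: (g *: y) = g *: y by rewrite -{2}Gy -GG -mulmxA Gy -scalemxAr Gy.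
  rewrite scalerA => /eqP; rewrite -subr_eq0 -scalerBl scaler_eq0 (negbTE y0) orbF.
  rewrite -[X in _ - X]mulr1 -mulrBr mulf_eq0 subr_eq0 => /orP[/eqP|/eqP]; by [left|right].
have Ly : (1 + g) *: (L *m y) = t j *: y.
  by rewrite -Ty /T0 -mulmxA mulmxDl mul1mx Gy mulmxDr -scalemxAr scalerDl scale1r.
have Ky l : L *m y = l *: y -> K *m y = (l * (1 - g)) *: y.
  by move=> e; rewrite eK' -mulmxA e -scalemxAr mulmxBl mul1mx Gy -{1}[y]scale1r -scalerBl scalerA.
case: g01 => eg; rewrite eg in Gy Ly Ky.
(* On the kernel of [G] the cone condition kills every [F z], and [K] acts there as [L]. *)
- right; move: Ly; rewrite addr0 scale1r => Ly.
  exists (t j); first exact: eigen_unimod y0 Ly.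
  move=> z dz; rewrite mulmxDl (Ky _ Ly) subr0 mulr1.
  rewrite (dominated_kernel hG (fun v => cone v z (dc z dz))) ?add0r //.
  by rewrite Gy scale0r.
left; rewrite scale1r in Gy.
have two0 : (1 + 1 : C) != 0 by rewrite -mulr2n pnatr_eq0.
set l := (1 + 1)^-1 * t j.
have Lyl : L *m y = l *: y by rewrite -scalerA -Ly scalerA mulVf ?scale1r.
have Ky0 : K *m y = 0 by rewrite (Ky _ Lyl) subrr mulr0 scale0r.
have ul := eigen_unimod _ _ y0 Lyl.
have Ay : A *m y = l *: y by rewrite eA -mulmxA Lyl -scalemxAr Gy.
have Gyy : frm G y y = dot y y by rewrite frmE Gy.
have ypos : 0 < dot y y.
  rewrite lt_neqAle dot_ge0 andbT eq_sym; apply: contra y0 => /eqP /dot_eq0 ->; exact: eqxx.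
have [||a oka ha] := rigid y; first by rewrite Gyy.
  by rewrite Gyy frmE Ay dotZr normrM (unimodular_norm ul) mul1r ger0_norm // ltW.
have yreal : (dot y y)^* = dot y y by rewrite -dotC.
exists a => //.
(* Rigidity covers the upper arc; [sym] and [bcj] reflect it to the lower one. *)
have form_circ z : circ z -> frm (F z) y y = b a z * dot y y.
  move=> cz; case: (cup z cz) => uz; first by rewrite ha // Gyy mulrC.
  have := ha _ uz; rewrite sym // frm_adj bcj Gyy => /(congr1 Num.conj).
  by rewrite conjCK rmorphM /= conjCK yreal mulrC.
(* As [K y = 0], unitarity makes [F z] preserve the norm of [y]; a diagonal form of modulus
   [dot y y] is then the equality case of Cauchy-Schwarz. *)
have Fcirc z : circ z -> F z *m y = b a z *: y.
  move=> cz; set u := F z *m y; have bb := bcirc a z oka cz.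
  have yu : dot y u = b a z * dot y y by rewrite -form_circ // frmE.
  have uy : dot u y = (b a z)^* * dot y y by rewrite dotC yu rmorphM /= yreal.
  have uu : dot u u = dot y y.
    have -> : u = (F z + K) *m y by rewrite mulmxDl Ky0 addr0.
    by rewrite dot_adj mulmxA uni // mul1mx.
  apply/eqP; rewrite -subr_eq0; apply/eqP/dot_eq0.
  rewrite !dotBl !dotBr !dotZl !dotZr uu uy yu.
  have -> : dot y y - b a z * ((b a z)^* * dot y y) -
    ((b a z)^* * (b a z * dot y y) - (b a z)^* * (b a z * dot y y)) =
    (1 - b a z * (b a z)^*) * dot y y by ring.
  by rewrite bb subrr mul0r.
(* [uniq] concerns scalar forms, so the eigenvector equation is tested against every [u]. *)
move=> z dz; rewrite mulmxDl Ky0 addr0; apply: dot_inj => u.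
by rewrite -frmE dotZr; apply: (uniq u y a oka) => // w cw; rewrite frmE Fcirc // dotZr.
Qed.
End Forms.
End HermitianForms.

(** A real zero keeps the value at [i] off the real axis, which excludes the eigenvalues [1] and
    [-1] on the range of [G]. *)
Lemma blaschke_Ci_im (a : R) : -1 < a < 1 -> 0 < im (blaschke a Ci).
Proof.
intros ha.
assert (e : im (blaschke a Ci) = (1 - a * a) / (1 + a * a)).
{ unfold blaschke, Cdiv, Cinv, Cnorm2; simpl; field; nra. }
rewrite e; apply Rdiv_lt_0_compat; nra.
Qed.

(** * Rational functions without poles in the disc *)

Fixpoint padd (p q : list Cplx) : list Cplx :=
  match p, q with
  | nil, _ => q
  | _, nil => p
  | c :: p', d :: q' => Cadd c d :: padd p' q'
  end.

Fixpoint pmul (p q : list Cplx) : list Cplx :=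
  match p with
  | nil => nil
  | c :: p' => padd (map (Cmul c) q) (C0 :: pmul p' q)
  end.

Lemma peval_padd (p q : list Cplx) (z : Cplx) :
  peval (padd p q) z = Cadd (peval p z) (peval q z).
Proof.
revert q; induction p as [|c p IH]; intros [|d q]; simpl; try ring; rewrite IH; ring.
Qed.

Lemma peval_map_Cmul (c : Cplx) (p : list Cplx) (z : Cplx) :
  peval (map (Cmul c) p) z = Cmul c (peval p z).
Proof. induction p as [|d p IH]; simpl; [ring|rewrite IH; ring]. Qed.

Lemma peval_pmul (p q : list Cplx) (z : Cplx) :
  peval (pmul p q) z = Cmul (peval p z) (peval q z).
Proof.
induction p as [|c p IH]; simpl; [ring|].
rewrite peval_padd, peval_map_Cmul; simpl; rewrite IH; ring.
Qed.

Definition rational_fun (f : Cplx -> Cplx) : Prop :=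
  exists p q : list Cplx,
    (forall z, inD z -> peval q z <> C0) /\
    (forall z, inD z -> f z = Cdiv (peval p z) (peval q z)).

Lemma C1_neq0 : C1 <> C0.
Proof. intros e; apply (f_equal re) in e; simpl in e; lra. Qed.

Lemma Cmul_neq0 (z w : Cplx) : z <> C0 -> w <> C0 -> Cmul z w <> C0.
Proof.
intros hz hw e; apply Cnorm2_gt0 in hz; apply Cnorm2_gt0 in hw.
pose proof (Cnorm2_mul z w) as h; rewrite e in h; unfold Cnorm2 at 1 in h; simpl in h; nra.
Qed.

Lemma rational_fun_const (c : Cplx) : rational_fun (fun _ => c).
Proof.
exists (c :: nil), (C1 :: nil); simpl; split; intros z hz.
- replace (Cadd C1 (Cmul z C0)) with C1 by ring; exact C1_neq0.
- replace (Cadd C1 (Cmul z C0)) with C1 by ring; field; exact C1_neq0.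
Qed.

Lemma rational_fun_add (f g : Cplx -> Cplx) : rational_fun f -> rational_fun g ->
  rational_fun (fun z => Cadd (f z) (g z)).
Proof.
intros [p [q [h1 h2]]] [r [s [h3 h4]]].
exists (padd (pmul p s) (pmul r q)), (pmul q s); split; intros z hz;
rewrite ?peval_padd, !peval_pmul.
- apply Cmul_neq0; [apply h1|apply h3]; exact hz.
- rewrite h2, h4 by exact hz; field; split; [apply h3|apply h1]; exact hz.
Qed.

Lemma rational_fun_mul (f g : Cplx -> Cplx) : rational_fun f -> rational_fun g ->
  rational_fun (fun z => Cmul (f z) (g z)).
Proof.
intros [p [q [h1 h2]]] [r [s [h3 h4]]].
exists (pmul p r), (pmul q s); split; intros z hz; rewrite !peval_pmul.
- apply Cmul_neq0; [apply h1|apply h3]; exact hz.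
- rewrite h2, h4 by exact hz; field; split; [apply h3|apply h1]; exact hz.
Qed.

Lemma rational_fun_csum (f : nat -> Cplx -> Cplx) (n : nat) :
  (forall k, (k < n)%nat -> rational_fun (f k)) ->
  rational_fun (fun z => csum (fun k => f k z) n).
Proof.
induction n as [|n IH]; intros h; [apply (rational_fun_const C0)|].
apply (rational_fun_add (fun z => csum (fun k => f k z) n) (f n));
[apply IH; intros; apply h; lia|apply h; lia].
Qed.

Lemma rational_fun_blaschke (a : R) : -1 < a < 1 -> rational_fun (blaschke a).
Proof.
intros ha; exists (Copp (RtoC a) :: C1 :: nil), (C1 :: Copp (RtoC a) :: nil); split; intros z hz; simpl.
- intros e; apply (blaschke_denominator a z ha (inD_slit z hz)).
  transitivity (Cadd C1 (Cmul z (Cadd (Copp (RtoC a)) (Cmul z C0)))); [ring|exact e].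
- assert (e1 : Csub z (RtoC a) = Cadd (Copp (RtoC a)) (Cmul z (Cadd C1 (Cmul z C0)))) by ring.
  assert (e2 : Csub C1 (Cmul z (RtoC a)) = Cadd C1 (Cmul z (Cadd (Copp (RtoC a)) (Cmul z C0)))) by ring.
  unfold blaschke; rewrite e1, e2; reflexivity.
Qed.

Lemma rational_fun_diag_form (m : nat) (a : nat -> R) (X : Mat) (i j : nat) :
  (forall k, (k < m)%nat -> -1 < a k < 1) ->
  rational_fun (fun z => diag_form m a X z i j).
Proof.
intros ha; unfold diag_form; destruct (Nat.ltb_spec i m) as [lt|ge].
- destruct (Nat.eqb i j); [apply rational_fun_blaschke, ha, lt|apply rational_fun_const].
- destruct (Nat.ltb j m); apply rational_fun_const.
Qed.

Lemma csum_single (f : nat -> Cplx) (n k : nat) : (k < n)%nat ->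
  (forall j, (j < n)%nat -> j <> k -> f j = C0) -> csum f n = f k.
Proof.
induction n as [|n IH]; intros hk h; [lia|simpl].
destruct (Nat.eq_dec k n) as [->|ne].
- replace (csum f n) with C0; [ring|].
  assert (z : forall m, (m <= n)%nat -> csum f m = C0).
  { induction m as [|m IHm]; intros hm; simpl; trivial; rewrite IHm, h by lia; ring. }
  symmetry; apply z; lia.
- rewrite IH, (h n) by (intros; try apply h; lia); ring.
Qed.

Lemma unitary_diagonal (n : nat) (d : nat -> Cplx) :
  (forall k, (k < n)%nat -> Cmul (d k) (Cconj (d k)) = C1) ->
  unitary n (fun i j => if Nat.eqb i j then d i else C0).
Proof.
intros hd; assert (c0 : Cconj C0 = C0) by (apply Cplx_ext; simpl; ring).
split; intros i j hi hj; unfold mmul, adj, mI; rewrite (csum_single _ n i hi).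
- rewrite Nat.eqb_refl; destruct (Nat.eqb_spec i j) as [<-|ne]; [|ring].
  rewrite <- (hd i hi); ring.
- intros k hk ne; destruct (Nat.eqb_spec k i); [contradiction|rewrite c0; ring].
- rewrite Nat.eqb_refl, (Nat.eqb_sym j i); destruct (Nat.eqb_spec i j) as [<-|ne]; [apply hd, hi|].
  rewrite c0; ring.
- intros k hk ne; destruct (Nat.eqb_spec i k) as [e|]; [symmetry in e; contradiction|ring].
Qed.

(** * Disc, arcs and half-plane as data for the abstract structure theorem *)

Definition real_disc (a : R) : Prop := -1 < a < 1.
Definition closed_disc (z : Cplx) : Prop := in_slit z /\ Cnorm2 z <= 1.
Definition open_arcs (z : Cplx) : Prop := im z <> 0 /\ Cnorm2 z = 1.
Definition upper_half (z : Cplx) : Prop := 0 < im z.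

Lemma inD_closed_disc (z : Cplx) : inD z -> closed_disc z.
Proof. intros h; split; [apply inD_slit, h|apply Rlt_le, inD_Cnorm2, h]. Qed.

Lemma open_arcs_closed_disc (z : Cplx) : open_arcs z -> closed_disc z.
Proof. intros [h1 h2]; split; [apply in_slit_im, h1|lra]. Qed.

Lemma open_arcs_conj (z : Cplx) : open_arcs z -> open_arcs (Cconj z).
Proof. intros [h1 h2]; split; [simpl; intros h; apply h1; lra|rewrite <- h2; unfold Cnorm2; simpl; ring]. Qed.

Lemma open_arcs_upper (z : Cplx) : open_arcs z -> upper_half z \/ upper_half (Cconj z).
Proof.
unfold upper_half; intros [h1 _]; simpl.
destruct (Rtotal_order (im z) 0) as [h|[h|h]]; [right|contradiction|left]; lra.
Qed.

Lemma open_arcs_Ci : open_arcs Ci.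
Proof. split; [exact R1_neq_R0|unfold Cnorm2; simpl; lra]. Qed.

Lemma upper_half_Ci : upper_half Ci.
Proof. unfold upper_half; simpl; lra. Qed.

Lemma blaschke_open_arcs (a : R) (z : Cplx) : real_disc a -> open_arcs z ->
  Cmul (blaschke a z) (Cconj (blaschke a z)) = C1.
Proof.
intros ha [h1 h2]; pose proof (blaschke_circle a z ha h1 h2) as e.
unfold Cnorm2 in e; destruct (blaschke a z) as [u v]; simpl in e; apply Cplx_ext; simpl; lra.
Qed.

Lemma blaschke_Ci_sqr (a : R) : real_disc a -> Cmul (blaschke a Ci) (blaschke a Ci) <> C1.
Proof.
intros ha e; pose proof (blaschke_Ci_im a ha).
destruct (blaschke a Ci) as [u v].
pose proof (f_equal re e) as e1; pose proof (f_equal im e) as e2; simpl in *.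
assert (u * v = 0) by lra; assert (u = 0) by nra; nra.
Qed.

(** * Transfer between the two matrix encodings and the diagonal form *)

Module InnerDiagonalization.
Set Implicit Arguments.
Unset Strict Implicit.
Import all_boot all_order all_algebra complex Rstruct.
Import Order.TTheory GRing.Theory Num.Theory.
Import HermitianForms.
Local Open Scope ring_scope.

Notation CC := (complex Rdefinitions.R).

Definition phi (z : Cplx) : CC := Complex (re z) (im z).
Definition psi (c : CC) : Cplx := mkC (complex.Re c) (complex.Im c).

Lemma phiK z : psi (phi z) = z. Proof. by case: z. Qed.
Lemma psiK c : phi (psi c) = c. Proof. by case: c. Qed.

Lemma phi1 : phi C1 = 1. Proof. by []. Qed.
Lemma phiD z w : phi (Cadd z w) = phi z + phi w. Proof. by []. Qed.
Lemma phiM z w : phi (Cmul z w) = phi z * phi w. Proof. by []. Qed.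
Lemma phi_conj z : phi (Cconj z) = (phi z)^*. Proof. by []. Qed.

Lemma phi_norm z : `|phi z| = phi (RtoC (Cabs z)).
Proof. by rewrite normc_def /phi /= /Cabs RsqrtE. Qed.

Lemma phi_le x y : Rle x y -> phi (RtoC x) <= phi (RtoC y).
Proof. by move=> /RleP h; rewrite lecE /= eqxx. Qed.

Lemma phi_csum (f : nat -> Cplx) n : phi (csum f n) = \sum_(k < n) phi (f k).
Proof. by elim: n => [|n IH] /=; rewrite ?big_ord0 // big_ord_recr /= -IH phiD. Qed.

Definition toM n (A : Mat) : 'M[CC]_n := \matrix_(i, j) phi (A i j).
Definition toV n (u : Vec) : 'cV[CC]_n := \col_i phi (u i).

(** Vectors indexed by [nat] have entries beyond [n]; the filler [C0] is invisible to [meq n] and to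
    sums of length [n]. *)
Definition at_index n (f : 'I_n -> Cplx) (k : nat) : Cplx :=
  if insub k is Some i then f i else C0.

Lemma at_indexE n (f : 'I_n -> Cplx) (i : 'I_n) : at_index f i = f i.
Proof. by rewrite /at_index valK. Qed.

Definition ofM n (A : 'M[CC]_n) : Mat := fun i j =>
  at_index (fun i' : 'I_n => at_index (fun j' : 'I_n => psi (A i' j')) j) i.
Definition ofV n (u : 'cV[CC]_n) : Vec := at_index (fun i => psi (u i 0)).

Lemma ofMK n (A : 'M[CC]_n) : toM n (ofM A) = A.
Proof. by apply/matrixP => i j; rewrite mxE /ofM !at_indexE psiK. Qed.

Lemma ofVK n (u : 'cV[CC]_n) : toV n (ofV u) = u.
Proof. by apply/matrixP => i j; rewrite mxE /ofV at_indexE psiK ord1. Qed.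

Lemma toM_eq n A B : meq n A B <-> toM n A = toM n B.
Proof.
split=> [h|/matrixP h i j /ssrnat.ltP hi /ssrnat.ltP hj].
  by apply/matrixP => i j; rewrite !mxE h //; apply/ssrnat.ltP.
by have := h (Ordinal hi) (Ordinal hj); rewrite !mxE => /(congr1 psi); rewrite !phiK.
Qed.

Lemma toM_mul n A B : toM n (mmul n A B) = toM n A *m toM n B.
Proof.
by apply/matrixP => i j; rewrite !mxE phi_csum; apply: eq_bigr => k _; rewrite !mxE phiM.
Qed.

Lemma toM_mv n A u : toV n (mv n A u) = toM n A *m toV n u.
Proof.
by apply/matrixP => i j; rewrite !mxE phi_csum; apply: eq_bigr => k _; rewrite !mxE phiM.
Qed.

Lemma toM_adj n A : toM n (adj A) = adjmx (toM n A).
Proof. by apply/matrixP => i j; rewrite !mxE. Qed.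

Lemma toM_add n A B : toM n (madd A B) = toM n A + toM n B.
Proof. by apply/matrixP => i j; rewrite !mxE. Qed.

Lemma toM_sub n A B : toM n (msub A B) = toM n A - toM n B.
Proof. by apply/matrixP => i j; rewrite !mxE. Qed.

Lemma toM_id n : toM n mI = 1%:M.
Proof.
apply/matrixP => i j; rewrite !mxE /mI; have [->|ne] := eqVneq i j.
  by rewrite Nat.eqb_refl.
by case: Nat.eqb_spec => // /val_inj e; rewrite e eqxx in ne.
Qed.

Lemma dot_toV n u v : dot (toV n u) (toV n v) = phi (inner n u v).
Proof.
by rewrite /dot !mxE phi_csum; apply: eq_bigr => k _; rewrite !mxE phiM.
Qed.

Lemma frm_toM n A u v : frm (toM n A) (toV n u) (toV n v) = phi (sform n A u v).
Proof. by rewrite frmE -toM_mv dot_toV. Qed.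

Lemma unitary_toM n U : toM n U *m adjmx (toM n U) = 1%:M -> unitary n U.
Proof.
move=> h; split; apply/toM_eq; rewrite toM_mul toM_adj toM_id //.
exact: mulmx1C.
Qed.

Lemma inner_sqs_columns n (Theta : Cplx -> Mat) : Sqs n Theta -> inner_fn n Theta ->
  exists P : 'M[CC]_n, [/\ P *m adjmx P = 1%:M, adjmx P *m P = 1%:M & forall j,
    family_on_columns inD real_disc
      (fun a z => phi (blaschke a z)) (fun z => toM n (Theta z)) (col j (adjmx P))].
Proof.
move=> hS hI; have [F [G [K [Q [X [hT [cone [rigid [uniq [sym [uni [hG [hQ [QQ [hX eK]]]]]]]]]]]]]]] :=
  inner_sqs_data n Theta hS hI.
(* The order on complex numbers compares imaginary parts for equality, so the diagonal forms of [G]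
   must first be known to be real. *)
have formG v : sform n G v v = RtoC (re (sform n G v v)).
  apply: Cplx_ext => //; exact: sform_hermitian_im.
have [P [uP uP' col_P]] : exists P : 'M[CC]_n, [/\ P *m adjmx P = 1%:M, adjmx P *m P = 1%:M & forall j,
    family_on_columns inD real_disc
      (fun a z => phi (blaschke a z)) (fun z => toM n (F z) + toM n K) (col j (adjmx P))].
  apply: (@inner_structure _ n Cplx Rdefinitions.R inD
    closed_disc open_arcs upper_half Cconj Ci _ (fun a z => phi (blaschke a z))
    (fun z => toM n (F z)) (toM n G) (toM n K) (toM n Q) (toM n X)).
  - exact: inD_closed_disc.
  - exact: open_arcs_closed_disc.
  - exact: open_arcs_conj.
  - exact: open_arcs_upper.
  - exact: open_arcs_Ci.
  - exact: upper_half_Ci.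
  - by move=> a z ha hz; rewrite -phi_conj -phiM blaschke_open_arcs.
  - by move=> a z; rewrite blaschke_conj phi_conj.
  - move=> a ha; apply/eqP; rewrite expr2 -phiM -phi1 => /(congr1 psi); rewrite !phiK.
    exact: blaschke_Ci_sqr.
  - move=> v z [h1 h2]; rewrite -(ofVK v) !frm_toM phi_norm formG; exact/phi_le/cone.
  - move=> v; rewrite -(ofVK v) !frm_toM phi_norm formG => pos /(congr1 psi); rewrite !phiK => /(congr1 re) /= e.
    have pos' : Rlt 0 (re (sform n G (ofV v) (ofV v))).
      by apply/RltP; move: pos; rewrite ltcE /= => /andP[].
    have [a [ha h]] := rigid _ pos' e; exists a => // z uz.
    by rewrite !frm_toM h // phiM -formG.
  - move=> u v a ha h z dz; rewrite -(ofVK u) -(ofVK v) frm_toM dot_toV -phiM.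
    congr phi; apply: uniq => // w hw hw'; apply: (can_inj phiK).
    by rewrite phiM -dot_toV -frm_toM !ofVK h.
  - by move=> z [h1 _]; rewrite -toM_adj; apply/toM_eq/sym.
  - by move=> z [h1 h2]; rewrite -toM_add -toM_adj -toM_mul -toM_id; apply/toM_eq/uni.
  - by rewrite -toM_adj; apply/esym/toM_eq.
  - by rewrite -toM_adj; apply/esym/toM_eq.
  - by rewrite -toM_mul -toM_id -toM_sub; apply/toM_eq.
  - move=> v; rewrite -(ofVK v) -toM_mv lecE !ger0_Im ?dot_ge0 // eqxx /= !dot_toV.
    exact/RleP/hX.
  - by rewrite -!toM_mul; apply/toM_eq.
exists P; split=> // j.
have eT z : inD z -> toM n (Theta z) = toM n (F z) + toM n K.
  by move=> dz; rewrite -toM_add; apply/toM_eq/hT.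
case: (col_P j) => [[a oka h]|[l hl h]]; [left; exists a => // z dz|right; exists l => // z dz];
by rewrite eT // h.
Qed.

Lemma ltbE i j : Nat.ltb i j = (i < j)%N.
Proof. by apply/idP/idP => [/Nat.ltb_lt/ssrnat.ltP //|/ssrnat.ltP/Nat.ltb_lt]. Qed.

Lemma eqbE i j : Nat.eqb i j = (i == j)%N.
Proof. by apply/idP/idP => [/Nat.eqb_eq ->|/eqP ->]; rewrite ?Nat.eqb_refl. Qed.

Lemma inner_sqs_diagonal n (Theta : Cplx -> Mat) : Sqs n Theta -> inner_fn n Theta ->
  exists (U : Mat) (m : nat) (a : nat -> Rdefinitions.R) (X : Mat),
    unitary n U /\ Peano.le m n /\ (forall k, Peano.lt k m -> real_disc (a k)) /\
    unitary (Nat.sub n m) X /\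
    forall z, inD z -> meq n (mmul n (adj U) (mmul n (Theta z) U)) (diag_form m a X z).
Proof.
move=> hS hI; have [P [uP uP' cols]] := inner_sqs_columns hS hI.
pose y j := col j (adjmx P).
(* The tag [inl] marks a Blaschke eigenvector, [inr] a constant one; one choice of tags fixes [m],
   [a] and [X]. *)
pose spec j (e : Rdefinitions.R + CC) := match e with
  | inl a => real_disc a /\ forall z, inD z -> toM n (Theta z) *m y j = phi (blaschke a z) *: y j
  | inr l => l * l^* = 1 /\ forall z, inD z -> toM n (Theta z) *m y j = l *: y j end.
have [c hc] : exists c, forall j, spec j (c j).
  apply: ClassicalChoice.choice => j.
  by case: (cols j) => [[a h1 h2]|[l h1 h2]]; [exists (inl a)|exists (inr l)].
pose moving j := if c j is inl _ then true else false.
(* [diag_form] expects the Blaschke factors first; the list order defines the permutation [sigma] of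
   the eigenvectors. *)
pose s := [seq j <- enum 'I_n | moving j] ++ [seq j <- enum 'I_n | ~~ moving j].
have ps : perm_eq s (enum 'I_n) by apply/permPl/perm_filterC.
have us : uniq s by rewrite (perm_uniq ps) enum_uniq.
have ss : size s = n by rewrite (perm_size ps) size_enum_ord.
pose m := size [seq j <- enum 'I_n | moving j].
have mn : (m <= n)%N by rewrite -ss size_cat leq_addr.
(* The default [k] is never reached, since [s] has length [n]. *)
pose sigma (k : 'I_n) := nth k s k.
have sigma_inj : injective sigma.
  move=> k k'; rewrite /sigma (set_nth_default k') ?ss // => /eqP.
  by rewrite nth_uniq ?ss // => /eqP/val_inj.
have moving_sigma k : moving (sigma k) = (k < m)%N.
  rewrite /sigma /s nth_cat -/m; case: ltnP => h.
    by have := mem_nth k h; rewrite mem_filter => /andP[].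
  have h' : (k - m < size [seq j <- enum 'I_n | ~~ moving j])%N.
    by rewrite ltn_subLR // -size_cat ss.
  by have := mem_nth k h'; rewrite mem_filter => /andP[/negbTE].
pose V : 'M[CC]_n := \matrix_(i, k) adjmx P i (sigma k).
have VV : adjmx V *m V = 1%:M.
  apply/matrixP => i j.
  have <- : (P *m adjmx P) (sigma i) (sigma j) = (1%:M : 'M[CC]_n) i j.
    by rewrite uP !mxE (inj_eq sigma_inj).
  rewrite [LHS]mxE [RHS]mxE.
  by apply: eq_bigr => k _; rewrite !mxE conjCK.
have VV' : V *m adjmx V = 1%:M by apply: mulmx1C.
(* The zero defaults are harmless: [a] matters only below [m], and [lam] only from [m] to
   [n - 1]. *)
pose a k : Rdefinitions.R := if insub k is Some i then (if c (sigma i) is inl a then a else IZR Z0) else IZR Z0.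
pose lam := at_index (fun i => if c (sigma i) is inr l then psi l else C0).
(* In this basis the constant block is itself diagonal; its indices restart at [0], hence the shift
   by [m]. *)
pose X : Mat := fun i j => if Nat.eqb i j then lam (addn m i) else C0.
exists (ofM V), m, a, X; split; [|split; [|split; [|split]]].
- by apply: unitary_toM; rewrite ofMK.
- exact/ssrnat.leP.
- move=> k /ssrnat.ltP km; have kn := leq_trans km mn.
  have := moving_sigma (Ordinal kn); have := hc (sigma (Ordinal kn)); rewrite /spec.
  rewrite /a (insubT (fun k => (k < n)%N) kn) /= /moving km.
  by case: (c _) => // a0 [].
- apply: (unitary_diagonal (Nat.sub n m) (fun k => lam (addn m k))) => k /ssrnat.ltP.
  rewrite -[Nat.sub n m]/(n - m)%N ltn_subRL => kn.
  have := moving_sigma (Ordinal kn); have := hc (sigma (Ordinal kn)); rewrite /spec.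
  rewrite -[addn m k]/(nat_of_ord (Ordinal kn)) /lam at_indexE /moving /= ltnNge leq_addr /=.
  case: (c _) => // l [hl _] _; apply: (can_inj phiK); by rewrite phiM phi_conj psiK hl.
move=> z dz; apply/toM_eq; rewrite !toM_mul toM_adj ofMK.
pose ev (k : 'I_n) : CC := match c (sigma k) with inl a => phi (blaschke a z) | inr l => l end.
have -> : toM n (Theta z) *m V = V *m diag_mx (\row_k ev k).
  apply/matrixP => i k; rewrite mul_mx_diag [RHS]mxE [X in _ * X]mxE.
  have colV : col k V = y (sigma k) by apply/matrixP => p q; rewrite !mxE.
  have -> : (toM n (Theta z) *m V) i k = (toM n (Theta z) *m col k V) i 0.
    by rewrite colE mulmxA -colE [RHS]mxE.
  have -> : V i k = col k V i 0 by rewrite [RHS]mxE.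
  rewrite colV /ev; have := hc (sigma k); rewrite /spec.
  by case: (c _) => [a0|l] [_ h]; rewrite h // mxE mulrC.
rewrite mulmxA VV mul1mx; apply/matrixP => i j; rewrite !mxE /diag_form !ltbE eqbE -[(nat_of_ord i == nat_of_ord j)]/(i == j).
have := moving_sigma i; rewrite /ev /moving; case: ltnP => im.
  have [_|ne] := eqVneq i j; last by rewrite mulr0n.
  by rewrite mulr1n /a valK; case: (c _).
case: ltnP => jm.
  have -> : (i == j) = false by apply/negbTE; apply: contraTneq jm => <-; rewrite -leqNgt.
  by rewrite mulr0n.
rewrite /X eqbE -[Nat.sub i m]/(i - m)%N -[Nat.sub j m]/(j - m)%N.
have -> : ((i - m)%N == (j - m)%N) = (i == j).
  by rewrite -(eqn_add2r m) !subnK.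
rewrite subnKC //; case: (i == j); last by rewrite mulr0n.
by rewrite mulr1n /lam at_indexE; case: (c _) => // l _; rewrite psiK.
Qed.

Lemma unitary_conjugate n (U A D : Mat) : unitary n U ->
  meq n (mmul n (adj U) (mmul n A U)) D -> meq n A (mmul n U (mmul n D (adj U))).
Proof.
case=> _ /toM_eq; rewrite toM_mul toM_adj toM_id => uU /toM_eq e; apply/toM_eq.
rewrite !toM_mul -e !toM_mul !toM_adj !mulmxA uU mul1mx.
by rewrite -mulmxA uU mulmx1.
Qed.
End InnerDiagonalization.

Theorem theorem5p4 (n : nat) (Theta : Cplx -> Mat) :
  Sqs n Theta -> inner_fn n Theta -> nonconstant_on_D n Theta ->
  rational_on_D n Theta /\
  exists (U : Mat) (m : nat) (a : nat -> R) (X : Mat),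
    unitary n U /\ (m <= n)%nat /\
    (forall k, (k < m)%nat -> -1 < a k < 1) /\
    unitary (n - m) X /\
    forall z, inD z ->
      meq n (mmul n (adj U) (mmul n (Theta z) U)) (diag_form m a X z).
Proof.
intros hS hI _.
destruct (InnerDiagonalization.inner_sqs_diagonal hS hI) as [U [m [a [X [hU [hm [ha [hX hD]]]]]]]].
split; [|exists U, m, a, X; repeat split; trivial; apply hU || apply ha || apply hX; assumption].
intros i j hi hj.
(* Undoing the conjugation by [U] writes each entry of [Theta] as a finite sum of constants times
   entries of the diagonal form, all rational without poles in the disc. *)
assert (r : rational_fun (fun z => mmul n U (mmul n (diag_form m a X z) (adj U)) i j)).
{ apply (rational_fun_csum (fun k z => Cmul (U i k) (mmul n (diag_form m a X z) (adj U) k j))).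
  intros k hk; apply rational_fun_mul; [apply rational_fun_const|].
  apply (rational_fun_csum (fun l z => Cmul (diag_form m a X z k l) (adj U l j))).
  intros l hl; apply rational_fun_mul; [|apply rational_fun_const].
  apply rational_fun_diag_form; exact ha. }
destruct r as [p [q [h1 h2]]]; exists p, q; split; [exact h1|].
intros z hz; rewrite <- (h2 z hz).
exact (InnerDiagonalization.unitary_conjugate hU (hD z hz) hi hj).
Qed.
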